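(* Let $\eta(s)$ denote the entire function equal to $\sum_{n=1}^\infty(-1)^{n-1}n^{-s}$ for $\Re s>0$ (so $\eta(s)=(1-2^{1-s})\zeta(s)$). For all $s\in\mathbb{C}$ and all $s_0\in\mathbb{C}$ with $\Re s_0>-1$, $$\eta(s+s_0)=\frac{1}{\Gamma(s_0+1)}\sum_{m=0}^\infty(m+1)\left(\int_0^\infty\frac{x^{s_0}e^{-x(m+1)}}{(1+e^{-x})^{m+2}}\,dx\right)\sum_{j=0}^m\frac{(-1)^j\binom{m}{j}}{(j+1)^s}.$$ Furthermore, for all $s,s_0\in\mathbb{C}$, $$\eta(s+s_0)=\sum_{m=0}^\infty\frac{(-1)^m}{m!}\sum_{l=1}^{m+1}s(m+1,l)\,\eta(s_0+1-l)\sum_{j=0}^m\frac{(-1)^j\binom{m}{j}}{(j+1)^s}.$$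
   Context: $s(m+1,l)$ are the (signed) Stirling numbers of the first kind, defined by $x(x-1)\cdots(x-m)=\sum_{l}s(m+1,l)x^l$. *)

(* Defs.v *)
From Stdlib Require Import Reals ZArith.
From Coquelicot Require Export Coquelicot.
Open Scope R_scope.

Definition cexp (z : C) : C :=
  (exp (Re z) * cos (Im z), exp (Re z) * sin (Im z))%R.

Definition cpow (a : R) (z : C) : C := cexp (Cmult z (RtoC (ln a))).

(* signed Stirling numbers of the first kind s(n,k), defined by
   x(x-1)...(x-n+1) = sum_k s(n,k) x^k, i.e. s(0,0)=1, s(0,k+1)=0, s(n+1,0)=0,
   s(n+1,k+1) = s(n,k) - n s(n,k+1). *)
Fixpoint stirling1 (n k : nat) : Z :=
  match n, k with
  | O, O => 1%Z
  | O, S _ => 0%Z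
  | S _, O => 0%Z
  | S n', S k' => (stirling1 n' k' - Z.of_nat n' * stirling1 n' k)%Z
  end.

Fixpoint csum (f : nat -> C) (n : nat) : C :=
  match n with
  | O => f O
  | S n' => Cplus (csum f n') (f n)
  end.

Definition is_dirichlet_eta (eta : C -> C) : Prop :=
  (forall z : C, @ex_derive C_AbsRing C_NormedModule eta z) /\
  (forall s : C, 0 < Re s ->
     @is_series C_AbsRing C_NormedModule
       (fun n : nat => Cmult (RtoC ((-1) ^ n)) (cpow (INR (n + 1)) (Copp s)))
       (eta s)).

Definition Gamma_int (z : C) : C :=
  @RInt_gen C_R_CompleteNormedModule
    (fun x : R => Cmult (cpow x (Cminus z 1)) (RtoC (exp (- x))))
    (at_right 0) (Rbar_locally p_infty).

Definition alt_binom_sum (m : nat) (s : C) : C :=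
  csum (fun j => Cmult (RtoC ((-1) ^ j * Binomial.C m j))
                       (cpow (INR (j + 1)) (Copp s))) m.

(* Main.v *)
Require Import Defs.
From Stdlib Require Import Reals ZArith Lra Lia Classical ClassicalEpsilon.
From Coquelicot Require Import Coquelicot.
Open Scope R_scope.

(* Write [A_k z] for the [k]-th alternating difference at [0] of [n |-> (n+1)^-z].
   Comparing derivatives with those of the completely monotone [x^-|z|] shows
   that [A_k z] grows at most polynomially in [k], locally uniformly in [z].  So
   the Euler transform [sum_k 2^-(k+1) A_k z] converges everywhere; it equals
   [eta z] for [Re z >= 2], hence everywhere by unique continuation (Goursat's
   theorem on rectangles, with a Gaussian weight).  Inserting it in the Stirling
   coefficient gives
     [b_m = sum_k 2^-(k+1) C(k,m) D_(k-m,m)],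
   where [D_(p,m)] is the [p]-th difference of [(n+1)^-s0] at [m], and the
   Leibniz rule [A_k (s+s0) = sum_m C(k,m) A_m(s) D_(k-m,m)] turns
   [sum_m b_m A_m(s)] into the Euler transform at [s + s0] after an absolutely
   convergent exchange of summations.  Finally [b_m Gamma(s0+1)] is identified
   with the integral by writing [(n+1)^-(s0+1) Gamma(s0+1)] as a Laplace
   transform and summing a negative binomial series. *)

(** Goursat's argument is needed because [eta] is only assumed complex differentiable, with no
    continuity of the derivative. The Gaussian weight takes the place of Cauchy's formula and of
    power series: on a vertical line it isolates the value at one point. The exchange of summations
    rests on positivity. For the completely monotone [x^-|z|] the numbers [C(k,m) D_(k-m,m)] are
    nonnegative and add up to 1 over [m]; for general [z] their moduli therefore add up to at most a
    polynomial in [k], and the binomial coefficients do not eat up the factor [2^-(k+1)]. Two gaps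
    remain for the integral formula. The Laplace transform yields differences of [(n+1)^-(s0+1)],
    whereas [b_m] contains those of [(n+1)^-s0]; a summation by parts in [k] links the two. And the
    formula divides by [Gamma(s0+1)], so the Gamma integral must be shown not to vanish on [Re > 0]:
    the functional equation carries a zero far to the right, where the concentration of the
    integrand excludes it. *)

(** * Finite complex sums and complex series *)

Lemma csum_ext (f g : nat -> C) (n : nat) :
  (forall i, (i <= n)%nat -> f i = g i) -> csum f n = csum g n.
Proof.
  induction n as [|n IH]; intros H; simpl.
  - apply H; lia.
  - rewrite IH, H; auto with arith.
Qed.

Lemma csum_plus (f g : nat -> C) (n : nat) :
  csum (fun i => (f i + g i)%C) n = (csum f n + csum g n)%C.
Proof. induction n as [|n IH]; simpl; [easy|rewrite IH; ring]. Qed.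

Lemma csum_minus (f g : nat -> C) (n : nat) :
  csum (fun i => (f i - g i)%C) n = (csum f n - csum g n)%C.
Proof. induction n as [|n IH]; simpl; [easy|rewrite IH; ring]. Qed.

Lemma csum_scal (c : C) (f : nat -> C) (n : nat) :
  csum (fun i => (c * f i)%C) n = (c * csum f n)%C.
Proof. induction n as [|n IH]; simpl; [easy|rewrite IH; ring]. Qed.

Lemma csum_shift (f : nat -> C) (n : nat) :
  csum f (S n) = (f O + csum (fun i => f (S i)) n)%C.
Proof.
  induction n as [|n IH]; [easy|].
  change (csum f (S (S n))) with (csum f (S n) + f (S (S n)))%C.
  rewrite IH; simpl; ring.
Qed.

Lemma csum_sum_n (f : nat -> C) (n : nat) :
  @sum_n C_AbelianMonoid f n = csum f n.
Proof.
  induction n as [|n IH]; simpl.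
  - apply sum_O.
  - now rewrite sum_Sn, IH.
Qed.

Lemma Cmod_csum (f : nat -> C) (n : nat) :
  Cmod (csum f n) <= sum_f_R0 (fun i => Cmod (f i)) n.
Proof.
  induction n as [|n IH]; simpl; [lra|].
  eapply Rle_trans; [apply Cmod_triangle|]; lra.
Qed.

Lemma sqrt2_le_2 : sqrt 2 <= 2.
Proof.
  rewrite <- (sqrt_Rsqr 2) at 2 by lra. apply sqrt_le_1; unfold Rsqr; lra.
Qed.

(** Convergence is expressed by a real sequence of moduli, so that the squeeze theorem for real
    sequences applies directly. *)
Definition cseries (a : nat -> C) (l : C) : Prop :=
  is_lim_seq (fun n => Cmod (csum a n - l)) 0.

Lemma cseries_is_series (a : nat -> C) (l : C) :
  cseries a l <-> @is_series C_AbsRing C_NormedModule a l.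
Proof.
  unfold cseries, is_series; split; intros H.
  - apply filterlim_locally; intros eps.
    apply is_lim_seq_spec in H.
    destruct (H eps) as [N HN]; exists N; intros n Hn.
    specialize (HN n Hn).
    rewrite Rminus_0_r, Rabs_pos_eq in HN by apply Cmod_ge_0.
    apply C_NormedModule_mixin_compat1.
    rewrite <- csum_sum_n in HN; exact HN.
  - apply is_lim_seq_spec; intros eps.
    (* A ball of C is a square, whose points are only within [sqrt 2] times the radius in modulus;
       halving [eps] compensates, as [sqrt 2 <= 2]. *)
    assert (Hp : 0 < eps / 2) by (destruct eps; simpl; lra).
    destruct (proj1 (filterlim_locally _ _) H (mkposreal _ Hp)) as [N HN]; exists N; intros n Hn.
    specialize (HN n Hn).
    rewrite Rminus_0_r, Rabs_pos_eq by apply Cmod_ge_0.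
    apply C_NormedModule_mixin_compat2 in HN; simpl in HN.
    pose proof sqrt2_le_2.
    rewrite <- csum_sum_n.
    eapply Rlt_le_trans; [exact HN|].
    destruct eps as [e he]; simpl in *; nra.
Qed.

Lemma cseries_ext (a b : nat -> C) (l : C) :
  (forall n, a n = b n) -> cseries a l -> cseries b l.
Proof.
  intros H; apply is_lim_seq_ext; intros n.
  now rewrite (csum_ext a b) by auto.
Qed.

Lemma cseries_unique (a : nat -> C) (l l' : C) :
  cseries a l -> cseries a l' -> l = l'.
Proof.
  intros H H'.
  assert (H0 : is_lim_seq (fun _ => Cmod (l - l')) 0).
  { apply is_lim_seq_le_le with (u := fun _ => 0)
      (w := fun n => Cmod (csum a n - l) + Cmod (csum a n - l')).
    - intros n; split; [apply Cmod_ge_0|].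
      replace (l - l')%C with (- (csum a n - l) + (csum a n - l'))%C by ring.
      rewrite <- (Cmod_opp (csum a n - l)). apply Cmod_triangle.
    - apply is_lim_seq_const.
    - replace (Finite 0) with (Rbar_plus 0 0) by (simpl; f_equal; lra).
      apply is_lim_seq_plus'; auto. }
  assert (E : Cmod (l - l') = 0).
  { pose proof (is_lim_seq_unique _ _ H0) as E.
    rewrite Lim_seq_const in E; congruence. }
  apply Cmod_eq_0 in E.
  replace l with ((l - l') + l')%C by ring. rewrite E; ring.
Qed.

Lemma cseries_scal (c : C) (a : nat -> C) (l : C) :
  cseries a l -> cseries (fun n => (c * a n)%C) (c * l).
Proof.
  rewrite !cseries_is_series; intros H.
  exact (@is_series_scal C_AbsRing C_NormedModule c a l H).
Qed.

Lemma cseries_plus (a b : nat -> C) (l m : C) :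
  cseries a l -> cseries b m -> cseries (fun n => (a n + b n)%C) (l + m).
Proof.
  rewrite !cseries_is_series; intros H H'.
  exact (@is_series_plus C_AbsRing C_NormedModule a b l m H H').
Qed.

Lemma cseries_csum (a : nat -> nat -> C) (l : nat -> C) (n : nat) :
  (forall i, (i <= n)%nat -> cseries (a i) (l i)) ->
  cseries (fun k => csum (fun i => a i k) n) (csum l n).
Proof.
  induction n as [|n IH]; intros H; simpl.
  - apply H; lia.
  - apply cseries_plus; [apply IH; auto with arith|apply H; lia].
Qed.

Lemma ex_cseries_abs (a : nat -> C) (M : nat -> R) :
  (forall n, Cmod (a n) <= M n) -> ex_series M -> exists l, cseries a l.
Proof.
  intros H HM.
  destruct (@ex_series_le C_AbsRing C_CompleteNormedModule a M) as [l Hl]; auto.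
  exists l. now apply cseries_is_series.
Qed.

Lemma cseries_Cmod_le (a : nat -> C) (M : nat -> R) (l : C) (S : R) :
  (forall n, Cmod (a n) <= M n) -> is_series M S -> cseries a l -> Cmod l <= S.
Proof.
  intros H HM Ha.
  assert (HS : is_lim_seq (fun n => Cmod (csum a n - l) + sum_n M n) (0 + S)).
  { apply is_lim_seq_plus'; auto. }
  replace (0 + S) with S in HS by ring.
  refine (is_lim_seq_le (fun _ => Cmod l) _ (Cmod l) S _ (is_lim_seq_const _) HS).
  intros n.
  replace l with (- (csum a n - l) + csum a n)%C at 1 by ring.
  eapply Rle_trans; [apply Cmod_triangle|]. rewrite Cmod_opp.
  apply Rplus_le_compat_l.
  eapply Rle_trans; [apply Cmod_csum|].
  rewrite sum_n_Reals. now apply sum_Rle.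
Qed.

(** * Alternating differences *)

(** Zero for [k > n], where [Binomial.C n k] has the default value [n!/k!]; sums and recursions can
    thus run past the diagonal. *)
Fixpoint binom (n k : nat) : nat :=
  match n, k with
  | _, O => 1
  | O, S _ => 0
  | S n', S k' => binom n' k' + binom n' k
  end%nat.

Lemma binom_0_r (n : nat) : binom n 0 = 1%nat.
Proof. now destruct n. Qed.

Lemma binom_gt (n k : nat) : (n < k)%nat -> binom n k = 0%nat.
Proof.
  revert k; induction n as [|n IH]; intros [|k] H; try lia; simpl; auto.
  rewrite !IH; lia.
Qed.

Lemma binom_diag (n : nat) : binom n n = 1%nat.
Proof.
  induction n as [|n IH]; simpl; auto.
  rewrite IH, binom_gt; lia.
Qed.

Lemma binom_C (n k : nat) : (k <= n)%nat -> INR (binom n k) = Binomial.C n k.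
Proof.
  revert k; induction n as [|n IH]; intros k H.
  - replace k with O by lia. now rewrite C_n_0.
  - destruct k as [|k]; [now rewrite C_n_0|].
    destruct (Nat.eq_dec k n) as [->|Hk].
    + now rewrite binom_diag, C_n_n.
    + simpl binom. rewrite plus_INR, !IH by lia.
      apply pascal; lia.
Qed.

Lemma binom_absorb (n k : nat) :
  (S k * binom (S n) (S k) = S n * binom n k)%nat.
Proof.
  revert k; induction n as [|n IH]; intros k.
  - destruct k as [|k]; simpl; lia.
  - destruct k as [|k].
    + simpl binom. rewrite !binom_0_r.
      pose proof (IH O) as H. simpl binom in H. rewrite !binom_0_r in H. nia.
    + change (binom (S (S n)) (S (S k))) with (binom (S n) (S k) + binom (S n) (S (S k)))%nat.
      pose proof (IH k) as H1; pose proof (IH (S k)) as H2.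
      change (binom (S n) (S k)) with (binom n k + binom n (S k))%nat in *.
      nia.
Qed.

(** This is [(I - E)^p f] at [m], with [E] the shift. The sign makes all differences of a completely
    monotone sequence nonnegative. *)
Fixpoint adiff (p m : nat) (f : nat -> C) : C :=
  match p with
  | O => f m
  | S p' => (adiff p' m f - adiff p' (S m) f)%C
  end.

Lemma adiff_ext (p m : nat) (f g : nat -> C) :
  (forall i, f i = g i) -> adiff p m f = adiff p m g.
Proof.
  intros H; revert m; induction p as [|p IH]; intros m; simpl; [auto|].
  now rewrite !IH.
Qed.

Lemma adiff_plus (p m : nat) (f g : nat -> C) :
  adiff p m (fun i => (f i + g i)%C) = (adiff p m f + adiff p m g)%C.
Proof.
  revert m; induction p as [|p IH]; intros m; simpl; [easy|rewrite !IH; ring].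
Qed.

Lemma adiff_minus (p m : nat) (f g : nat -> C) :
  adiff p m (fun i => (f i - g i)%C) = (adiff p m f - adiff p m g)%C.
Proof.
  revert m; induction p as [|p IH]; intros m; simpl; [easy|rewrite !IH; ring].
Qed.

Lemma adiff_scal (c : C) (p m : nat) (f : nat -> C) :
  adiff p m (fun i => (c * f i)%C) = (c * adiff p m f)%C.
Proof.
  revert m; induction p as [|p IH]; intros m; simpl; [easy|rewrite !IH; ring].
Qed.

Lemma adiff_csum (p m : nat) (f : nat -> nat -> C) (n : nat) :
  adiff p m (fun i => csum (fun l => f l i) n) = csum (fun l => adiff p m (f l)) n.
Proof.
  induction n as [|n IH]; simpl; [easy|].
  now rewrite adiff_plus, IH.
Qed.

Lemma adiff_shift (p m : nat) (f : nat -> C) :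
  adiff p m (fun i => f (S i)) = adiff p (S m) f.
Proof.
  revert m; induction p as [|p IH]; intros m; simpl; [easy|now rewrite !IH].
Qed.

Lemma adiff_S (p m : nat) (f : nat -> C) :
  adiff (S p) m f = adiff p m (fun i => (f i - f (S i))%C).
Proof. now rewrite adiff_minus, adiff_shift. Qed.

Lemma adiff_binom_sum (p m : nat) (f : nat -> C) :
  adiff p m f =
  csum (fun j => (RtoC ((-1) ^ j * INR (binom p j)) * f (m + j)%nat)%C) p.
Proof.
  revert m f; induction p as [|p IH]; intros m f.
  - simpl. rewrite Nat.add_0_r. apply injective_projections; simpl; ring.
  - simpl adiff. rewrite !IH.
    set (F := fun j => (RtoC ((-1) ^ j * INR (binom p j)) * f (m + j)%nat)%C).
    transitivity (csum F (S p) -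
      csum (fun j => (RtoC ((-1) ^ j * INR (binom p j)) * f (S m + j)%nat)%C) p)%C.
    { simpl csum. unfold F at 3. rewrite (binom_gt p (S p)) by lia.
      replace (RtoC ((-1) ^ S p * INR 0)) with (RtoC 0) by (f_equal; simpl; ring).
      ring. }
    rewrite !csum_shift.
    replace (RtoC ((-1) ^ 0 * INR (binom (S p) 0)) * f (m + 0)%nat)%C with (F O)
      by (unfold F; now rewrite !binom_0_r).
    unfold Cminus at 1. rewrite <- Cplus_assoc. f_equal.
    change (csum (fun i => F (S i)) p -
      csum (fun j => (RtoC ((-1) ^ j * INR (binom p j)) * f (S m + j)%nat)%C) p
      = csum (fun i => (RtoC ((-1) ^ S i * INR (binom (S p) (S i))) * f (m + S i)%nat)%C) p)%C.
    rewrite <- csum_minus. apply csum_ext; intros i Hi. unfold F.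
    rewrite <- plus_n_Sm. simpl binom. rewrite plus_INR.
    apply injective_projections; simpl; ring.
Qed.

(** Iterates the one-step rule [f h - E(f h) = (f - E f) (E h) + f (h - E h)], with [E] the shift:
    each difference spent on [f] moves the base point of [h] by one. *)
Lemma adiff_mult (k : nat) (f h : nat -> C) :
  adiff k 0 (fun i => (f i * h i)%C) =
  csum (fun m => (RtoC (INR (binom k m)) * adiff m 0 f * adiff (k - m) m h)%C) k.
Proof.
  revert f h; induction k as [|k IH]; intros f h.
  - simpl. ring.
  - rewrite adiff_S.
    rewrite (adiff_ext _ _ _ (fun i => ((f i - f (S i)) * h (S i) + f i * (h i - h (S i)))%C))
      by (intros; ring).
    rewrite adiff_plus, (IH (fun i => (f i - f (S i))%C) (fun i => h (S i))),
      (IH f (fun i => (h i - h (S i))%C)).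
    rewrite csum_shift.
    set (F := fun m => (RtoC (INR (binom k m)) * adiff m 0 f * adiff (S k - m) m h)%C).
    assert (E2 : csum (fun m => RtoC (INR (binom k m)) * adiff m 0 f *
        adiff (k - m) m (fun i => (h i - h (S i))))%C k = csum F (S k)).
    { simpl csum. unfold F at 2. rewrite (binom_gt k (S k)) by lia.
      replace (RtoC (INR 0)) with (RtoC 0) by reflexivity.
      rewrite (csum_ext _ F); [ring|]. intros i Hi. unfold F.
      rewrite <- adiff_S. do 2 f_equal. lia. }
    rewrite E2, csum_shift.
    replace (RtoC (INR (binom (S k) 0)) * adiff 0 0 f * adiff (S k - 0) 0 h)%C with (F O)
      by (unfold F; now rewrite !binom_0_r).
    rewrite (Cplus_comm (F O)), Cplus_assoc, (Cplus_comm (F O)).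
    f_equal. rewrite <- csum_plus. apply csum_ext; intros i Hi. unfold F.
    rewrite <- adiff_S, adiff_shift.
    replace (S k - S i)%nat with (k - i)%nat by lia.
    simpl binom. rewrite plus_INR, RtoC_plus. ring.
Qed.

(** One difference sends [C(i, m+1)] to [- C(i, m)], so the factor [C(i, m)] uses up [m] of the
    differences and leaves a sign. *)
Lemma adiff_binom_mult (k m : nat) (h : nat -> C) :
  adiff k 0 (fun i => (RtoC (INR (binom i m)) * h i)%C) =
  (RtoC ((-1) ^ m * INR (binom k m)) * adiff (k - m) m h)%C.
Proof.
  revert m h; induction k as [|k IH]; intros m h.
  - destruct m; simpl; [apply injective_projections; simpl; ring|].
    rewrite Rmult_0_r. ring.
  - destruct m as [|m].
    + rewrite (adiff_ext _ _ _ h), binom_0_r; [simpl; apply injective_projections; simpl; ring|].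
      intros i; rewrite binom_0_r; simpl; ring.
    + rewrite adiff_S.
      rewrite (adiff_ext _ _ _ (fun i => (RtoC (INR (binom i (S m))) * (h i - h (S i))
         - RtoC (INR (binom i m)) * h (S i))%C))
        by (intros i; simpl binom; rewrite plus_INR, RtoC_plus; ring).
      rewrite adiff_minus, (IH (S m) (fun i => (h i - h (S i))%C)), (IH m (fun i => h (S i))).
      rewrite <- adiff_S, adiff_shift. simpl binom. rewrite plus_INR.
      replace (S k - S m)%nat with (k - m)%nat by lia.
      (* For [k <= m] truncated subtraction breaks [S (k - S m) = k - m], but then the coefficient
         [binom k (S m)] is zero. *)
      destruct (Nat.le_gt_cases (S m) k) as [H|H].
      * replace (S (k - S m)) with (k - m)%nat by lia.
        apply injective_projections; simpl; ring.
      * rewrite (binom_gt k (S m)) by lia.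
        apply injective_projections; simpl; ring.
Qed.

(** The operator identity [((I - E) + E)^k = I], read at [0]. It follows from the Leibniz rule when
    the first factor is the indicator of [0], all of whose differences at [0] equal 1. For
    completely monotone [h] it says that the terms are nonnegative weights of total [h 0]. *)
Lemma sum_adiff_binom (k : nat) (h : nat -> C) :
  csum (fun m => (RtoC (INR (binom k m)) * adiff (k - m) m h)%C) k = h O.
Proof.
  set (d := fun i : nat => match i with O => RtoC 1 | _ => RtoC 0 end).
  assert (Hz : forall p m (f : nat -> C), (forall i, f (S i) = 0) -> adiff p (S m) f = 0).
  { intros p; induction p as [|p IH]; intros m f H; simpl; [apply H|].
    rewrite !IH by auto; ring. }
  assert (H0 : forall p (f : nat -> C), (forall i, f (S i) = 0) -> adiff p 0 f = f O).
  { intros p; induction p as [|p IH]; intros f H; simpl; [easy|].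
    rewrite IH, Hz by auto; ring. }
  pose proof (adiff_mult k d h) as E.
  rewrite H0 in E by (intros; simpl; ring). simpl in E.
  replace (1 * h O)%C with (h O) in E by ring. rewrite E.
  apply csum_ext; intros i _. rewrite (H0 i d) by auto. simpl; ring.
Qed.

(** Since [(n+1)^-s0] is [n+1] times [(n+1)^-(s0+1)], this expresses the differences at [s0] by
    those at [s0+1]. *)
Lemma adiff_mult_succ (p m : nat) (f : nat -> C) :
  adiff (S p) m (fun i => (RtoC (INR (i + 1)) * f i)%C) =
  (RtoC (INR (m + S p + 1)) * adiff (S p) m f - RtoC (INR (S p)) * adiff p m f)%C.
Proof.
  revert m; induction p as [|p IH]; intros m.
  - cbn [adiff]. rewrite !plus_INR, !S_INR. change (INR 0) with 0.
    apply injective_projections; simpl; ring.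
  - change (adiff (S (S p)) m (fun i => (RtoC (INR (i + 1)) * f i)%C)) with
     (adiff (S p) m (fun i => (RtoC (INR (i + 1)) * f i)%C) - adiff (S p) (S m) (fun i => (RtoC (INR (i + 1)) * f i)%C))%C.
    rewrite !IH.
    change (adiff (S (S p)) m f) with (adiff (S p) m f - adiff (S p) (S m) f)%C.
    replace (adiff p m f) with (adiff (S p) m f + adiff p (S m) f)%C by (simpl; ring).
    generalize (adiff (S p) m f), (adiff (S p) (S m) f), (adiff p (S m) f).
    intros u v w. rewrite !plus_INR, !S_INR. change (INR 0) with 0.
    apply injective_projections; simpl; ring.
Qed.

(** * Complex powers *)

Lemma exp_nondecreasing (a b : R) : a <= b -> exp a <= exp b.
Proof.
  intros [H|H]; [now apply Rlt_le, exp_increasing|rewrite H; lra].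
Qed.

Lemma cexp_plus (a b : C) : cexp (a + b) = (cexp a * cexp b)%C.
Proof.
  destruct a as [a1 a2], b as [b1 b2]; unfold cexp; simpl.
  rewrite exp_plus, cos_plus, sin_plus.
  apply injective_projections; simpl; ring.
Qed.

Lemma cexp_0 : cexp 0 = 1.
Proof.
  unfold cexp; simpl; rewrite exp_0, cos_0, sin_0.
  apply injective_projections; simpl; ring.
Qed.

Lemma Cmod_cexp (z : C) : Cmod (cexp z) = exp (Re z).
Proof.
  unfold Cmod, cexp; simpl.
  replace (_ + _) with (Rsqr (exp (Re z)) * (Rsqr (sin (Im z)) + Rsqr (cos (Im z))))
    by (unfold Rsqr; ring).
  rewrite sin2_cos2, Rmult_1_r. apply sqrt_Rsqr, Rlt_le, exp_pos.
Qed.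

Lemma cpow_plus (a : R) (z w : C) : cpow a (z + w) = (cpow a z * cpow a w)%C.
Proof. unfold cpow. rewrite <- cexp_plus. f_equal; ring. Qed.

Lemma cpow_mult (a b : R) (z : C) :
  0 < a -> 0 < b -> cpow (a * b) z = (cpow a z * cpow b z)%C.
Proof.
  intros Ha Hb; unfold cpow.
  rewrite <- cexp_plus, ln_mult, RtoC_plus by auto. f_equal; ring.
Qed.

Lemma cpow_real (a r : R) : cpow a (RtoC r) = RtoC (exp (r * ln a)).
Proof.
  unfold cpow, cexp; simpl.
  replace (r * 0 + 0 * ln a) with 0 by ring.
  replace (r * ln a - 0 * 0) with (r * ln a) by ring.
  rewrite cos_0, sin_0. apply injective_projections; simpl; ring.
Qed.

Lemma cpow_INR (a : R) (n : nat) : 0 < a -> cpow a (RtoC (INR n)) = RtoC (a ^ n).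
Proof.
  intros Ha. rewrite cpow_real. f_equal.
  fold (Rpower a (INR n)). now apply Rpower_pow.
Qed.

Lemma cpow_1_r (a : R) : 0 < a -> cpow a 1 = RtoC a.
Proof. intros Ha. rewrite cpow_real, Rmult_1_l, exp_ln; auto. Qed.

Lemma Cmod_cpow (a : R) (z : C) : Cmod (cpow a z) = exp (Re z * ln a).
Proof.
  unfold cpow. rewrite Cmod_cexp. f_equal. destruct z; simpl; ring.
Qed.

Lemma is_derive_Re_cpow (z : C) (x : R) : 0 < x ->
  is_derive (fun x => Re (cpow x z)) x (Re (z * cpow x (z - 1))).
Proof.
  intros Hx.
  unfold Cminus; rewrite cpow_plus, <- RtoC_opp, cpow_real.
  unfold cpow, cexp; destruct z as [a b]; simpl.
  auto_derive; [auto|].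
  replace (exp (- (1) * ln x)) with (/ x) by
    (replace (- (1) * ln x) with (- ln x) by ring; now rewrite exp_Ropp, exp_ln).
  unfold Rminus. field; lra.
Qed.

Lemma is_derive_Im_cpow (z : C) (x : R) : 0 < x ->
  is_derive (fun x => Im (cpow x z)) x (Im (z * cpow x (z - 1))).
Proof.
  intros Hx.
  unfold Cminus; rewrite cpow_plus, <- RtoC_opp, cpow_real.
  unfold cpow, cexp; destruct z as [a b]; simpl.
  auto_derive; [auto|].
  replace (exp (- (1) * ln x)) with (/ x) by
    (replace (- (1) * ln x) with (- ln x) by ring; now rewrite exp_Ropp, exp_ln).
  unfold Rminus. field; lra.
Qed.

(** * Bounds for alternating differences of powers *)

Fixpoint fdiff (p : nat) (u : R -> R) (a : R) : R :=
  match p with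
  | O => u a
  | S p' => fdiff p' u a - fdiff p' u (a + 1)
  end.

Lemma fdiff_S (p : nat) (u : R -> R) (a : R) :
  fdiff (S p) u a = fdiff p (fun x => u x - u (x + 1)) a.
Proof.
  revert a; induction p as [|p IH]; intros a; [easy|].
  change (fdiff (S p) u a - fdiff (S p) u (a + 1) =
    fdiff p (fun x => u x - u (x + 1)) a - fdiff p (fun x => u x - u (x + 1)) (a + 1)).
  now rewrite <- !IH.
Qed.

Lemma fdiff_scal (c : R) (p : nat) (u : R -> R) (a : R) :
  fdiff p (fun x => c * u x) a = c * fdiff p u a.
Proof.
  revert a; induction p as [|p IH]; intros a; simpl; [easy|].
  rewrite !IH; ring.
Qed.

(* [(-1)^k] times the [k]-th derivatives of a function. *)
Definition alt_derivs (U : nat -> R -> R) : Prop :=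
  forall k x, 0 < x -> is_derive (U k) x (- U (S k) x).

Lemma alt_derivs_step (U : nat -> R -> R) :
  alt_derivs U -> alt_derivs (fun k x => U k x - U k (x + 1)).
Proof.
  intros H k x Hx.
  replace (- (U (S k) x - U (S k) (x + 1))) with
    (minus (- U (S k) x) (- U (S k) (x + 1))) by (unfold minus, plus, opp; simpl; ring).
  apply (is_derive_minus (V := R_NormedModule)); [now apply H|].
  replace (- U (S k) (x + 1)) with (scal 1 (- U (S k) (x + 1)))
    by (unfold scal; simpl; unfold mult; simpl; ring).
  apply (is_derive_comp (U k) (fun x => x + 1)); [apply H; lra|].
  auto_derive; [auto|ring].
Qed.

Lemma nonincreasing_of_derive (f df : R -> R) (a b : R) :
  a <= b -> (forall x, a <= x <= b -> is_derive f x (df x)) ->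
  (forall x, a <= x <= b -> df x <= 0) -> f b <= f a.
Proof.
  intros Hab Hd Hn.
  destruct (MVT_gen f a b df) as [c [Hc E]].
  - intros x; rewrite Rmin_left, Rmax_right by auto. intros Hx; apply Hd; lra.
  - intros x; rewrite Rmin_left, Rmax_right by auto. intros Hx.
    apply continuity_pt_filterlim.
    apply (ex_derive_continuous (V := R_NormedModule)). exists (df x). now apply Hd.
  - rewrite Rmin_left, Rmax_right in Hc by auto.
    specialize (Hn c Hc). nra.
Qed.

(** A difference is minus the integral of the derivative over a unit interval, so a bound between
    [p]-th derivatives passes to [p]-th differences. Instead of integrating, each step uses that
    [G p + U p] and [G p - U p] are nonincreasing. *)
Lemma fdiff_compare (p : nat) (U G : nat -> R -> R) (a : R) :
  0 < a -> alt_derivs U -> alt_derivs G ->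
  (forall x, a <= x <= a + INR p -> Rabs (U p x) <= G p x) ->
  Rabs (fdiff p (U O) a) <= fdiff p (G O) a.
Proof.
  revert U G; induction p as [|p IH]; intros U G Ha HU HG H.
  - apply H; simpl; lra.
  - rewrite !fdiff_S.
    apply (IH (fun k x => U k x - U k (x + 1)) (fun k x => G k x - G k (x + 1)));
      auto using alt_derivs_step.
    intros x Hx.
    assert (HS : forall y, x <= y <= x + 1 -> Rabs (U (S p) y) <= G (S p) y).
    { intros y Hy; apply H; rewrite S_INR; lra. }
    assert (H1 : G p (x + 1) + U p (x + 1) <= G p x + U p x).
    { apply (nonincreasing_of_derive (fun y => G p y + U p y)
        (fun y => - G (S p) y + - U (S p) y)); [lra| |].
      - intros y Hy. apply (is_derive_plus (V := R_NormedModule)); [apply HG|apply HU]; lra.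
      - intros y Hy. specialize (HS y Hy). unfold Rabs in HS; destruct (Rcase_abs _); lra. }
    assert (H2 : G p (x + 1) - U p (x + 1) <= G p x - U p x).
    { apply (nonincreasing_of_derive (fun y => G p y - U p y)
        (fun y => - G (S p) y - - U (S p) y)); [lra| |].
      - intros y Hy. apply (is_derive_minus (V := R_NormedModule)); [apply HG|apply HU]; lra.
      - intros y Hy. specialize (HS y Hy). unfold Rabs in HS; destruct (Rcase_abs _); lra. }
    unfold Rabs; destruct (Rcase_abs _); lra.
Qed.

Fixpoint cpoch (z : C) (k : nat) : C :=
  match k with O => RtoC 1 | S k' => (cpoch z k' * (z + RtoC (INR k')))%C end.

(** Factor by factor, [|z + j| <= |z| + j]. This is what singles out [x^-|z|] as the comparison
    function. The vanishing imaginary part is carried along so that the real part is the whole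
    product. *)
Lemma Cmod_cpoch_le (z : C) (k : nat) :
  Cmod (cpoch z k) <= Re (cpoch (RtoC (Cmod z)) k) /\ Im (cpoch (RtoC (Cmod z)) k) = 0.
Proof.
  induction k as [|k [IH1 IH2]].
  - simpl. rewrite Cmod_1. lra.
  - simpl. unfold Re, Im in *. rewrite IH2. split; [|ring].
    rewrite Cmod_mult.
    replace (_ - _) with (fst (cpoch (RtoC (Cmod z)) k) * (Cmod z + INR k)) by ring.
    apply Rmult_le_compat; auto using Cmod_ge_0.
    eapply Rle_trans; [apply Cmod_triangle|].
    rewrite Cmod_R, (Rabs_pos_eq (INR k)); [lra|apply pos_INR].
Qed.

Definition pow_derivs (z : C) (k : nat) (x : R) : C :=
  (cpoch z k * cpow x (- (z + RtoC (INR k))))%C.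

Lemma pow_derivs_0 (z : C) (x : R) : pow_derivs z 0 x = cpow x (- z).
Proof.
  unfold pow_derivs; simpl.
  replace (- (z + 0))%C with (- z)%C by ring. ring.
Qed.

Lemma alt_derivs_pow_derivs (z : C) :
  alt_derivs (fun k x => Re (pow_derivs z k x)) /\
  alt_derivs (fun k x => Im (pow_derivs z k x)).
Proof.
  assert (E : forall k x, (- pow_derivs z (S k) x =
    cpoch z k * (- (z + RtoC (INR k)) * cpow x (- (z + RtoC (INR k)) - 1)))%C).
  { intros k x. unfold pow_derivs. simpl cpoch. rewrite S_INR, RtoC_plus.
    replace (- (z + (RtoC (INR k) + 1)))%C with (- (z + RtoC (INR k)) - 1)%C by ring.
    ring. }
  split; intros k x Hx;
  pose proof (is_derive_Re_cpow (- (z + RtoC (INR k))) x Hx) as H1;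
  pose proof (is_derive_Im_cpow (- (z + RtoC (INR k))) x Hx) as H2;
  specialize (E k x).
  - replace (- Re (pow_derivs z (S k) x)) with (Re (- pow_derivs z (S k) x)%C) by easy.
    rewrite E. unfold pow_derivs. destruct (cpoch z k) as [c1 c2].
    unfold Cmult at 1 2; unfold Re at 1 2; simpl fst.
    apply (is_derive_minus (V := R_NormedModule)); apply (is_derive_scal); assumption.
  - replace (- Im (pow_derivs z (S k) x)) with (Im (- pow_derivs z (S k) x)%C) by easy.
    rewrite E. unfold pow_derivs. destruct (cpoch z k) as [c1 c2].
    unfold Cmult at 1 2; unfold Im at 1 2; simpl snd.
    apply (is_derive_plus (V := R_NormedModule)); apply (is_derive_scal); assumption.
Qed.

Definition npow (z : C) (n : nat) : C := cpow (INR (n + 1)) (- z).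

Lemma Re_adiff (p m : nat) (f : nat -> C) (u : R -> R) :
  (forall i, Re (f i) = u (INR (i + 1))) ->
  Re (adiff p m f) = fdiff p u (INR (m + 1)).
Proof.
  intros H; revert m; induction p as [|p IH]; intros m; cbn [adiff fdiff]; [auto|].
  change (Re (adiff p m f) - Re (adiff p (S m) f) =
    fdiff p u (INR (m + 1)) - fdiff p u (INR (m + 1) + 1)).
  rewrite !IH, <- S_INR; do 3 f_equal; lia.
Qed.

Lemma Im_adiff (p m : nat) (f : nat -> C) (u : R -> R) :
  (forall i, Im (f i) = u (INR (i + 1))) ->
  Im (adiff p m f) = fdiff p u (INR (m + 1)).
Proof.
  intros H; revert m; induction p as [|p IH]; intros m; cbn [adiff fdiff]; [auto|].
  change (Im (adiff p m f) - Im (adiff p (S m) f) =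
    fdiff p u (INR (m + 1)) - fdiff p u (INR (m + 1) + 1)).
  rewrite !IH, <- S_INR; do 3 f_equal; lia.
Qed.

Lemma Cmod_le_Rabs (z : C) : Cmod z <= Rabs (Re z) + Rabs (Im z).
Proof.
  destruct z as [x y]; simpl.
  replace (x, y) with (RtoC x + Ci * RtoC y)%C
    by (apply injective_projections; simpl; ring).
  eapply Rle_trans; [apply Cmod_triangle|].
  rewrite Cmod_mult, Cmod_Ci, !Cmod_R; simpl; lra.
Qed.

Lemma Im_le_Cmod (z : C) : Rabs (Im z) <= Cmod z.
Proof. eapply Rle_trans; [apply Rmax_r|apply Rmax_Cmod]. Qed.

(* The [p]-th derivative of [x^-z] is at most [x^(|z|-Re z)] times that of the
   completely monotone function [x^-|z|]. *)
Lemma Cmod_adiff_npow_le (p m : nat) (z : C) :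
  Cmod (adiff p m (npow z)) <=
  2 * exp ((Cmod z - Re z) * ln (INR (m + p + 1))) *
  Re (adiff p m (npow (RtoC (Cmod z)))).
Proof.
  set (M := exp ((Cmod z - Re z) * ln (INR (m + p + 1)))).
  set (r := RtoC (Cmod z)).
  assert (Hm : 0 < INR (m + 1)) by (apply lt_0_INR; lia).
  destruct (alt_derivs_pow_derivs z) as [DR DI].
  destruct (alt_derivs_pow_derivs r) as [DG _].
  assert (DM : alt_derivs (fun k x => M * Re (pow_derivs r k x))).
  { intros k x Hx. replace (- (M * _)) with (M * (- Re (pow_derivs r (S k) x))) by ring.
    apply is_derive_scal. now apply DG. }
  assert (B : forall x, INR (m + 1) <= x <= INR (m + 1) + INR p ->
    Cmod (pow_derivs z p x) <= M * Re (pow_derivs r p x)).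
  { intros x Hx. unfold pow_derivs.
    destruct (Cmod_cpoch_le z p) as [C1 C2]. fold r in C1, C2.
    rewrite Cmod_mult, Cmod_cpow.
    replace (- (r + RtoC (INR p)))%C with (RtoC (- (Cmod z + INR p)))
      by (unfold r; rewrite RtoC_opp, RtoC_plus; ring).
    rewrite cpow_real.
    replace (Re (cpoch r p * _)) with (Re (cpoch r p) * exp (- (Cmod z + INR p) * ln x))
      by (unfold Re, Im in *; simpl; rewrite C2; ring).
    replace (Re (- (z + RtoC (INR p)))) with (- (Re z + INR p)) by (destruct z; simpl; ring).
    rewrite (Rmult_comm M), Rmult_assoc.
    apply Rmult_le_compat; auto using Cmod_ge_0.
    - apply Rlt_le, exp_pos.
    - unfold M. rewrite <- exp_plus. apply exp_nondecreasing.
      assert (Hl : ln x <= ln (INR (m + p + 1))).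
      { apply Rcomplements.ln_le; [lra|].
        replace (m + p + 1)%nat with (m + 1 + p)%nat by lia. rewrite plus_INR; lra. }
      assert (Hr : 0 <= Cmod z - Re z).
      { pose proof (re_le_Cmod z). pose proof (Rle_abs (Re z)). lra. }
      nra. }
  assert (EG : Re (adiff p m (npow r)) = fdiff p (fun x => Re (pow_derivs r 0 x)) (INR (m + 1))).
  { apply Re_adiff; intros i. now rewrite pow_derivs_0. }
  (* The real and imaginary parts are compared separately, hence the factor 2 in the statement. *)
  assert (HR : Rabs (Re (adiff p m (npow z))) <= M * Re (adiff p m (npow r))).
  { rewrite EG, (Re_adiff p m (npow z) (fun x => Re (pow_derivs z 0 x))),
      <- fdiff_scal by (intros i; now rewrite pow_derivs_0).
    apply (fdiff_compare p (fun k x => Re (pow_derivs z k x)) (fun k x => M * Re (pow_derivs r k x))); auto.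
    intros x Hx. eapply Rle_trans; [apply re_le_Cmod|auto]. }
  assert (HI : Rabs (Im (adiff p m (npow z))) <= M * Re (adiff p m (npow r))).
  { rewrite EG, (Im_adiff p m (npow z) (fun x => Im (pow_derivs z 0 x))),
      <- fdiff_scal by (intros i; now rewrite pow_derivs_0).
    apply (fdiff_compare p (fun k x => Im (pow_derivs z k x)) (fun k x => M * Re (pow_derivs r k x))); auto.
    intros x Hx. eapply Rle_trans; [apply Im_le_Cmod|auto]. }
  eapply Rle_trans; [apply Cmod_le_Rabs|]. lra.
Qed.

Lemma Re_csum (f : nat -> C) (n : nat) :
  Re (csum f n) = sum_f_R0 (fun i => Re (f i)) n.
Proof. induction n as [|n IH]; simpl; [easy|now rewrite <- IH]. Qed.

(** Along the sum [m + (k - m) + 1] stays equal to [k + 1], so the comparison factor is the same for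
    all terms and is at most [(k+1)^N], because [|z| - Re z <= 2 |z|]. What is left is the weighted
    sum for [x^-|z|], equal to its value 1 at [n = 0]. *)
Lemma sum_Cmod_adiff_npow_le (k N : nat) (z : C) :
  2 * Cmod z <= INR N ->
  sum_f_R0 (fun m => INR (binom k m) * Cmod (adiff (k - m) m (npow z))) k
  <= 2 * INR (k + 1) ^ N.
Proof.
  intros HN.
  assert (Hk : 1 <= INR (k + 1)).
  { rewrite plus_INR; pose proof (pos_INR k); simpl; lra. }
  set (r := RtoC (Cmod z)).
  apply Rle_trans with (2 * INR (k + 1) ^ N *
    sum_f_R0 (fun m => Re (RtoC (INR (binom k m)) * adiff (k - m) m (npow r))) k).
  - rewrite scal_sum. apply sum_Rle; intros m Hm.
    replace (Re (RtoC (INR (binom k m)) * adiff (k - m) m (npow r))) with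
      (INR (binom k m) * Re (adiff (k - m) m (npow r))) by (unfold Re; simpl; ring).
    rewrite Rmult_assoc. apply Rmult_le_compat_l; [apply pos_INR|].
    eapply Rle_trans; [apply Cmod_adiff_npow_le|]. fold r.
    rewrite (Rmult_comm (Re _)).
    replace (m + (k - m) + 1)%nat with (k + 1)%nat by lia.
    (* The comparison applied to [r] itself bounds a modulus by a positive multiple of this real
       part, which gives its sign. *)
    assert (Hpos : 0 <= Re (adiff (k - m) m (npow r))).
    { pose proof (Cmod_adiff_npow_le (k - m) m r) as Hr.
      replace (RtoC (Cmod r)) with r in Hr
        by (unfold r; now rewrite (Cmod_R (Cmod z)), Rabs_pos_eq by apply Cmod_ge_0).
      pose proof (Cmod_ge_0 (adiff (k - m) m (npow r))).
      pose proof (exp_pos ((Cmod r - Re r) * ln (INR (m + (k - m) + 1)))).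
      nra. }
    apply Rmult_le_compat_r; auto.
    apply Rmult_le_compat_l; [lra|].
    rewrite <- Rpower_pow by lra. unfold Rpower. apply exp_nondecreasing.
    apply Rmult_le_compat_r.
    + rewrite <- ln_1. apply Rcomplements.ln_le; lra.
    + pose proof (re_le_Cmod z). pose proof (Rle_abs (- Re z)). rewrite Rabs_Ropp in H0. lra.
  - rewrite <- Re_csum, sum_adiff_binom.
    replace (npow r 0) with (RtoC 1); [simpl; lra|].
    unfold npow, cpow. change (INR (0 + 1)) with 1. rewrite ln_1, Cmult_0_r.
    symmetry; apply cexp_0.
Qed.

(** The term [m = 0] of the previous sum of nonnegative terms. As [N] depends only on a bound for
    [|z|], the estimate is uniform on discs. *)
Lemma Cmod_adiff_npow_poly (k N : nat) (z : C) :
  2 * Cmod z <= INR N -> Cmod (adiff k 0 (npow z)) <= 2 * INR (k + 1) ^ N.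
Proof.
  intros HN. eapply Rle_trans; [|apply (sum_Cmod_adiff_npow_le k N z HN)].
  set (f := fun m => INR (binom k m) * Cmod (adiff (k - m) m (npow z))).
  assert (Hf : forall m, 0 <= f m).
  { intros m; apply Rmult_le_pos; [apply pos_INR|apply Cmod_ge_0]. }
  replace (Cmod (adiff k 0 (npow z))) with (f O).
  - clearbody f. clear HN. induction k as [|k IH]; simpl; [lra|].
    pose proof (Hf (S k)); lra.
  - unfold f. rewrite binom_0_r, Nat.sub_0_r. simpl; ring.
Qed.

Lemma alt_binom_sum_adiff (m : nat) (s : C) : alt_binom_sum m s = adiff m 0 (npow s).
Proof.
  unfold alt_binom_sum. rewrite adiff_binom_sum.
  apply csum_ext; intros i Hi. now rewrite <- binom_C.
Qed.

(** * Complex differentiability and Goursat's theorem *)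

(** An epsilon-delta form common to the two normed-module structures on C: the hypothesis on [eta]
    uses [C_NormedModule], the product and chain rules use [AbsRing_NormedModule C_AbsRing]. *)
Definition cderiv (f : C -> C) (z l : C) : Prop :=
  forall eps, 0 < eps -> exists d, 0 < d /\ forall w, Cmod (w - z) < d ->
    Cmod (f w - f z - (w - z) * l) <= eps * Cmod (w - z).

Definition holomorphic (f : C -> C) : Prop := forall z, exists l, cderiv f z l.

Lemma cderiv_is_derive (f : C -> C) (z l : C) :
  cderiv f z l <-> @is_derive C_AbsRing (AbsRing_NormedModule C_AbsRing) f z l.
Proof.
  split.
  - intros H; split; [apply is_linear_scal_l|].
    intros x Hx eps.
    apply (is_filter_lim_locally_unique (V := AbsRing_NormedModule C_AbsRing)) in Hx. subst x.
    destruct (H eps (cond_pos eps)) as [d [Hd Hw]].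
    exists (mkposreal d Hd). intros w Hb. exact (Hw w Hb).
  - intros [_ H] eps Heps.
    destruct (H z (fun P HP => HP) (mkposreal eps Heps)) as [d Hd].
    exists d; split; [apply cond_pos|]. intros w Hw. exact (Hd w Hw).
Qed.

Lemma ex_derive_cderiv (f : C -> C) (z : C) :
  @ex_derive C_AbsRing C_NormedModule f z -> exists l, cderiv f z l.
Proof.
  intros [l [_ H]]; exists l; intros eps Heps.
  destruct (H z (fun P HP => HP) (mkposreal eps Heps)) as [d Hd].
  exists d; split; [apply cond_pos|]. intros w Hw. exact (Hd w Hw).
Qed.

Lemma holomorphic_plus (f g : C -> C) :
  holomorphic f -> holomorphic g -> holomorphic (fun z => (f z + g z)%C).
Proof.
  intros Hf Hg z. destruct (Hf z) as [a Ha], (Hg z) as [b Hb].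
  exists (a + b)%C. apply cderiv_is_derive in Ha, Hb. apply cderiv_is_derive.
  exact (is_derive_plus (V := AbsRing_NormedModule C_AbsRing) f g z a b Ha Hb).
Qed.

Lemma holomorphic_mult (f g : C -> C) :
  holomorphic f -> holomorphic g -> holomorphic (fun z => (f z * g z)%C).
Proof.
  intros Hf Hg z. destruct (Hf z) as [a Ha], (Hg z) as [b Hb].
  exists (a * g z + f z * b)%C. apply cderiv_is_derive in Ha, Hb. apply cderiv_is_derive.
  exact (is_derive_mult f g z a b Ha Hb Cmult_comm).
Qed.

Lemma holomorphic_comp (f g : C -> C) :
  holomorphic f -> holomorphic g -> holomorphic (fun z => f (g z)).
Proof.
  intros Hf Hg z. destruct (Hf (g z)) as [a Ha], (Hg z) as [b Hb].
  exists (b * a)%C. apply cderiv_is_derive in Ha, Hb. apply cderiv_is_derive.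
  exact (is_derive_comp (V := AbsRing_NormedModule C_AbsRing) f g z a b Ha Hb).
Qed.

Lemma holomorphic_ext (f g : C -> C) :
  (forall z, f z = g z) -> holomorphic f -> holomorphic g.
Proof.
  intros E H z. destruct (H z) as [l Hl]; exists l; intros eps He.
  destruct (Hl eps He) as [d [Hd Hw]]; exists d; split; auto.
  intros w Hwd. rewrite <- !E; auto.
Qed.

Lemma holomorphic_const (c : C) : holomorphic (fun _ => c).
Proof.
  intros z; exists 0; intros eps He; exists 1; split; [lra|]. intros w _.
  replace (c - c - (w - z) * 0)%C with (RtoC 0) by ring. rewrite Cmod_0.
  pose proof (Cmod_ge_0 (w - z)); nra.
Qed.

Lemma holomorphic_id : holomorphic (fun z => z).
Proof.
  intros z; exists 1; intros eps He; exists 1; split; [lra|]. intros w _.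
  replace (w - z - (w - z) * 1)%C with (RtoC 0) by ring. rewrite Cmod_0.
  pose proof (Cmod_ge_0 (w - z)); nra.
Qed.

Lemma holomorphic_csum (f : nat -> C -> C) (n : nat) :
  (forall k, holomorphic (f k)) -> holomorphic (fun z => csum (fun k => f k z) n).
Proof.
  intros H; induction n as [|n IH]; simpl; [apply H|].
  now apply holomorphic_plus.
Qed.

Lemma Rabs_sin_le (b : R) : Rabs (sin b) <= Rabs b.
Proof.
  destruct (Rcase_abs b) as [H|H].
  - rewrite (Rabs_left b) by lra. destruct (MVT_gen sin b 0 cos) as [c [_ E]].
    + intros; auto_derive; auto; ring.
    + intros; apply continuity_pt_filterlim, continuous_sin.
    + rewrite sin_0 in E. replace (sin b) with (cos c * b) by lra.
      rewrite Rabs_mult, (Rabs_left b) by lra.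
      assert (Rabs (cos c) <= 1) by (apply Rabs_le, COS_bound).
      pose proof (Rabs_pos (cos c)). nra.
  - rewrite (Rabs_pos_eq b) by lra. destruct (MVT_gen sin 0 b cos) as [c [_ E]].
    + intros; auto_derive; auto; ring.
    + intros; apply continuity_pt_filterlim, continuous_sin.
    + rewrite sin_0 in E. replace (sin b) with (cos c * b) by lra.
      rewrite Rabs_mult, (Rabs_pos_eq b) by lra.
      assert (Rabs (cos c) <= 1) by (apply Rabs_le, COS_bound).
      pose proof (Rabs_pos (cos c)). nra.
Qed.

Lemma cos_ge_quadratic (b : R) : 1 - b * b / 2 <= cos b.
Proof.
  replace b with (2 * (b / 2)) at 3 by field. rewrite cos_2a_sin.
  pose proof (Rabs_sin_le (b / 2)) as H.
  apply Rsqr_le_abs_1 in H. unfold Rsqr in H. nra.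
Qed.

Lemma sin_minus_id_le (b : R) : Rabs b <= 1 -> Rabs (sin b - b) <= b * b.
Proof.
  intros Hb.
  destruct (MVT_gen (fun x => sin x - x) 0 b (fun x => cos x - 1)) as [c [Hc E]].
  - intros; auto_derive; auto; ring.
  - intros; apply continuity_pt_filterlim.
    apply (continuous_minus (V := R_NormedModule)); [apply continuous_sin|apply continuous_id].
  - rewrite sin_0 in E. replace (sin b - b) with ((cos c - 1) * b) by lra.
    assert (Hcb : Rabs c <= Rabs b).
    { unfold Rmin, Rmax in Hc. unfold Rabs; destruct (Rle_dec 0 b);
      destruct (Rcase_abs c), (Rcase_abs b); lra. }
    pose proof (cos_ge_quadratic c) as H1. pose proof (COS_bound c) as H2.
    rewrite Rabs_mult, (Rabs_left1 (cos c - 1)) by lra.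
    assert (c * c <= Rabs c).
    { replace (c * c) with (Rabs c * Rabs c) by (rewrite <- Rabs_mult; apply Rabs_pos_eq; nra).
      pose proof (Rabs_pos c); nra. }
    replace (b * b) with (Rabs b * Rabs b) by (rewrite <- Rabs_mult; apply Rabs_pos_eq; nra).
    pose proof (Rabs_pos b). nra.
Qed.

(** The upper bound comes from [1 - a <= exp (- a)], that is [exp a <= 1 / (1 - a)]. *)
Lemma exp_quadratic (a : R) : Rabs a <= 1 / 2 -> 0 <= exp a - 1 - a <= 2 * (a * a).
Proof.
  intros H. apply Rabs_le_between in H.
  pose proof (exp_ineq1_le a). pose proof (exp_ineq1_le (- a)) as H2.
  rewrite exp_Ropp in H2. pose proof (exp_pos a) as Hp.
  split; [lra|].
  assert (exp a * (1 - a) <= 1).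
  { replace 1 with (exp a * / exp a) at 2 by (field; lra).
    apply Rmult_le_compat_l; lra. }
  nra.
Qed.

(** Real and imaginary parts contribute at most [4 |h|^2] each, so 10 is a comfortable constant. It
    gives the derivative of [cexp] at [0], and the functional equation carries it to every point. *)
Lemma cexp_quadratic (h : C) :
  Cmod h <= 1 / 2 -> Cmod (cexp h - 1 - h) <= 10 * (Cmod h * Cmod h).
Proof.
  intros Hh.
  pose proof (re_le_Cmod h) as Ha. pose proof (Im_le_Cmod h) as Hb.
  pose proof (Cmod_ge_0 h) as H0.
  destruct h as [a b]; simpl in Ha, Hb. set (r := Cmod (a, b)) in *.
  assert (Ea : a * a <= r * r) by (apply Rsqr_le_abs_1; rewrite (Rabs_pos_eq r); auto).
  assert (Eb : b * b <= r * r) by (apply Rsqr_le_abs_1; rewrite (Rabs_pos_eq r); auto).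
  destruct (exp_quadratic a) as [X1 X2]; [lra|].
  assert (Hexp : exp a <= 2) by (apply Rabs_le_between in Ha; nra).
  pose proof (exp_pos a) as Hep.
  pose proof (cos_ge_quadratic b) as C1. pose proof (COS_bound b) as C2.
  pose proof (sin_minus_id_le b ltac:(lra)) as S1.
  assert (EE : Rabs (exp a - 1) <= 2 * r).
  { apply Rabs_le_between in Ha. apply Rabs_le; nra. }
  eapply Rle_trans; [apply Cmod_le_Rabs|]. unfold cexp; simpl.
  assert (R1 : Rabs (exp a * cos b + - (1) + - a) <= 4 * (r * r)).
  { apply Rabs_le; nra. }
  assert (R2 : Rabs (exp a * sin b + - 0 + - b) <= 4 * (r * r)).
  { replace (exp a * sin b + - 0 + - b) with (exp a * (sin b - b) + (exp a - 1) * b) by ring.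
    eapply Rle_trans; [apply Rabs_triang|]. rewrite !Rabs_mult, (Rabs_pos_eq (exp a)) by lra.
    pose proof (Rabs_pos (sin b - b)); pose proof (Rabs_pos b); pose proof (Rabs_pos (exp a - 1)).
    assert (exp a * Rabs (sin b - b) <= 2 * (r * r)) by nra.
    assert (Rabs (exp a - 1) * Rabs b <= 2 * r * r) by (apply Rmult_le_compat; auto).
    lra. }
  nra.
Qed.

Lemma holomorphic_cexp : holomorphic cexp.
Proof.
  intros z; exists (cexp z); intros eps He.
  set (M := 10 * Cmod (cexp z) + 1).
  assert (HM : 0 < M) by (unfold M; pose proof (Cmod_ge_0 (cexp z)); lra).
  exists (Rmin (1 / 2) (eps / M)). split.
  { apply Rmin_glb_lt; [lra|]. now apply Rdiv_lt_0_compat. }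
  intros w Hw.
  assert (H1 : Cmod (w - z) < 1 / 2) by (eapply Rlt_le_trans; [exact Hw|apply Rmin_l]).
  assert (H2 : Cmod (w - z) < eps / M) by (eapply Rlt_le_trans; [exact Hw|apply Rmin_r]).
  replace w with (z + (w - z))%C at 1 by ring. rewrite cexp_plus.
  replace (cexp z * cexp (w - z) - cexp z - (w - z) * cexp z)%C with
    (cexp z * (cexp (w - z) - 1 - (w - z)))%C by ring.
  rewrite Cmod_mult.
  pose proof (cexp_quadratic (w - z) ltac:(lra)) as Q.
  set (h := Cmod (w - z)) in *.
  assert (Hh : 0 <= h) by apply Cmod_ge_0.
  assert (h * M <= eps).
  { apply Rlt_le. apply Rmult_lt_compat_r with (r := M) in H2; auto.
    unfold Rdiv in H2. rewrite Rmult_assoc, Rinv_l, Rmult_1_r in H2 by lra. exact H2. }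
  pose proof (Cmod_ge_0 (cexp z)).
  apply Rle_trans with (Cmod (cexp z) * (10 * (h * h))); [apply Rmult_le_compat_l; auto|].
  unfold M in *. nra.
Qed.

Definition ccontinuous (f : C -> C) : Prop :=
  forall z eps, 0 < eps -> exists d, 0 < d /\ forall w, Cmod (w - z) < d ->
    Cmod (f w - f z) < eps.

Lemma holomorphic_continuous (f : C -> C) : holomorphic f -> ccontinuous f.
Proof.
  intros H z eps He. destruct (H z) as [l Hl].
  destruct (Hl 1 ltac:(lra)) as [d [Hd Hw]].
  set (M := 1 + Cmod l).
  assert (HM : 0 < M) by (unfold M; pose proof (Cmod_ge_0 l); lra).
  exists (Rmin d (eps / M)). split.
  { apply Rmin_glb_lt; [lra|]. now apply Rdiv_lt_0_compat. }
  intros w Hwd.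
  specialize (Hw w ltac:(eapply Rlt_le_trans; [exact Hwd|apply Rmin_l])).
  assert (H2 : Cmod (w - z) < eps / M) by (eapply Rlt_le_trans; [exact Hwd|apply Rmin_r]).
  replace (f w - f z)%C with ((f w - f z - (w - z) * l) + (w - z) * l)%C by ring.
  eapply Rle_lt_trans; [apply Cmod_triangle|]. rewrite Cmod_mult.
  apply Rmult_lt_compat_r with (r := M) in H2; auto.
  unfold Rdiv in H2. rewrite Rmult_assoc, Rinv_l, Rmult_1_r in H2 by lra.
  unfold M in *. nra.
Qed.

Lemma ccontinuous_hline (f : C -> C) (y t : R) : ccontinuous f ->
  @continuous R_UniformSpace C_R_NormedModule (fun t => f (t, y)) t.
Proof.
  intros H. apply filterlim_locally; intros eps.
  destruct (H (t, y) eps (cond_pos eps)) as [d [Hd Hw]].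
  exists (mkposreal d Hd); intros s Hs.
  apply C_NormedModule_mixin_compat1. apply Hw.
  replace ((s, y) - (t, y))%C with (RtoC (s - t)) by (apply injective_projections; simpl; ring).
  rewrite Cmod_R. exact Hs.
Qed.

Lemma ccontinuous_vline (f : C -> C) (x t : R) : ccontinuous f ->
  @continuous R_UniformSpace C_R_NormedModule (fun t => f (x, t)) t.
Proof.
  intros H. apply filterlim_locally; intros eps.
  destruct (H (x, t) eps (cond_pos eps)) as [d [Hd Hw]].
  exists (mkposreal d Hd); intros s Hs.
  apply C_NormedModule_mixin_compat1. apply Hw.
  replace ((x, s) - (x, t))%C with (Ci * RtoC (s - t))%C by (apply injective_projections; simpl; ring).
  rewrite Cmod_mult, Cmod_Ci, Cmod_R, Rmult_1_l. exact Hs.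
Qed.

Definition CInt (f : R -> C) (a b : R) : C := @RInt C_R_CompleteNormedModule f a b.

Lemma ex_CInt (f : R -> C) (a b : R) :
  (forall t, @continuous R_UniformSpace C_R_NormedModule f t) ->
  @ex_RInt C_R_NormedModule f a b.
Proof.
  intros H. apply (ex_RInt_continuous (V := C_R_CompleteNormedModule)). auto.
Qed.

Lemma Cmod_CInt_le (f : R -> C) (a b M : R) : a <= b ->
  (forall t, @continuous R_UniformSpace C_R_NormedModule f t) ->
  (forall t, a <= t <= b -> Cmod (f t) <= M) ->
  Cmod (CInt f a b) <= (b - a) * M.
Proof.
  intros Hab Hc HM. rewrite Cmod_norm.
  apply (norm_RInt_le_const (V := C_R_NormedModule) f a b); auto.
  - intros x Hx. rewrite <- Cmod_norm. auto.
  - apply (RInt_correct (V := C_R_CompleteNormedModule)). now apply ex_CInt.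
Qed.

Lemma CInt_Chasles (f : R -> C) (a b c : R) :
  (forall t, @continuous R_UniformSpace C_R_NormedModule f t) ->
  CInt f a c = (CInt f a b + CInt f b c)%C.
Proof.
  intros H. symmetry.
  apply (RInt_Chasles (V := C_R_CompleteNormedModule)); now apply ex_CInt.
Qed.

Lemma CInt_plus (f g : R -> C) (a b : R) :
  (forall t, @continuous R_UniformSpace C_R_NormedModule f t) ->
  (forall t, @continuous R_UniformSpace C_R_NormedModule g t) ->
  CInt (fun t => (f t + g t)%C) a b = (CInt f a b + CInt g a b)%C.
Proof.
  intros Hf Hg.
  apply (RInt_plus (V := C_R_CompleteNormedModule)); now apply ex_CInt.
Qed.

Lemma CInt_ext (f g : R -> C) (a b : R) :
  (forall t, f t = g t) -> CInt f a b = CInt g a b.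
Proof. intros H. apply (RInt_ext (V := C_R_CompleteNormedModule)). auto. Qed.

(** The contour integral taken counterclockwise; [Ci] appears because [dz = i dt] on the vertical
    sides. *)
Definition rect_int (f : C -> C) (a b c d : R) : C :=
  (CInt (fun t => f (t, c)) a b + Ci * CInt (fun t => f (b, t)) c d
   - CInt (fun t => f (t, d)) a b - Ci * CInt (fun t => f (a, t)) c d)%C.

Lemma rect_int_plus (f g : C -> C) (a b c d : R) :
  ccontinuous f -> ccontinuous g ->
  rect_int (fun z => (f z + g z)%C) a b c d = (rect_int f a b c d + rect_int g a b c d)%C.
Proof.
  intros Hf Hg. unfold rect_int.
  rewrite (CInt_plus (fun t => f (t, c)) (fun t => g (t, c))),
    (CInt_plus (fun t => f (t, d)) (fun t => g (t, d))),
    (CInt_plus (fun t => f (b, t)) (fun t => g (b, t))),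
    (CInt_plus (fun t => f (a, t)) (fun t => g (a, t)))
    by (intros; auto using ccontinuous_hline, ccontinuous_vline).
  ring.
Qed.

Lemma rect_int_split (f : C -> C) (a m b c n d : R) : ccontinuous f ->
  rect_int f a b c d = (rect_int f a m c n + rect_int f m b c n
    + rect_int f a m n d + rect_int f m b n d)%C.
Proof.
  intros Hf. unfold rect_int.
  rewrite (CInt_Chasles (fun t => f (t, c)) a m b), (CInt_Chasles (fun t => f (t, d)) a m b),
    (CInt_Chasles (fun t => f (a, t)) c n d), (CInt_Chasles (fun t => f (b, t)) c n d)
    by (intros; auto using ccontinuous_hline, ccontinuous_vline).
  ring.
Qed.

Lemma Cmod_rect_int_le (f : C -> C) (a b c d M : R) : ccontinuous f ->
  a <= b -> c <= d ->
  (forall x y, a <= x <= b -> c <= y <= d -> Cmod (f (x, y)) <= M) ->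
  Cmod (rect_int f a b c d) <= 2 * M * ((b - a) + (d - c)).
Proof.
  intros Hf Hab Hcd HM. unfold rect_int.
  assert (H1 := Cmod_CInt_le (fun t => f (t, c)) a b M Hab
    (fun t => ccontinuous_hline f c t Hf) (fun t Ht => HM t c Ht ltac:(lra))).
  assert (H2 := Cmod_CInt_le (fun t => f (t, d)) a b M Hab
    (fun t => ccontinuous_hline f d t Hf) (fun t Ht => HM t d Ht ltac:(lra))).
  assert (H3 := Cmod_CInt_le (fun t => f (b, t)) c d M Hcd
    (fun t => ccontinuous_vline f b t Hf) (fun t Ht => HM b t ltac:(lra) Ht)).
  assert (H4 := Cmod_CInt_le (fun t => f (a, t)) c d M Hcd
    (fun t => ccontinuous_vline f a t Hf) (fun t Ht => HM a t ltac:(lra) Ht)).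
  unfold Cminus.
  eapply Rle_trans; [apply Cmod_triangle|]. rewrite Cmod_opp, Cmod_mult, Cmod_Ci.
  eapply Rle_trans; [apply Rplus_le_compat_r; apply Cmod_triangle|]. rewrite Cmod_opp.
  eapply Rle_trans; [apply Rplus_le_compat_r, Rplus_le_compat_r; apply Cmod_triangle|].
  rewrite Cmod_mult, Cmod_Ci. lra.
Qed.

Lemma CInt_affine (u v : C) (a b : R) :
  CInt (fun t => (u + RtoC t * v)%C) a b =
  (RtoC (b - a) * u + RtoC ((b * b - a * a) / 2) * v)%C.
Proof.
  apply (is_RInt_unique (V := C_R_CompleteNormedModule)).
  apply (is_RInt_fct_extend_pair (U := R_NormedModule) (V := R_NormedModule)); simpl.
  - destruct u as [u1 u2], v as [v1 v2]; simpl.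
    evar_last.
    + apply (is_RInt_derive (V := R_CompleteNormedModule) (fun t => t * u1 + t * t / 2 * v1)).
      * intros x _. auto_derive; auto. field.
      * intros x _. apply (ex_derive_continuous (V := R_NormedModule)). auto_derive; auto.
    + unfold minus, plus, opp; simpl. field.
  - destruct u as [u1 u2], v as [v1 v2]; simpl.
    evar_last.
    + apply (is_RInt_derive (V := R_CompleteNormedModule) (fun t => t * u2 + t * t / 2 * v2)).
      * intros x _. auto_derive; auto. field.
      * intros x _. apply (ex_derive_continuous (V := R_NormedModule)). auto_derive; auto.
    + unfold minus, plus, opp; simpl. field.
Qed.

Lemma rect_int_affine (u v : C) (a b c d : R) :
  rect_int (fun z => (u + z * v)%C) a b c d = 0.
Proof.
  unfold rect_int.
  assert (H : forall y a b, CInt (fun t => (u + (t, y) * v)%C) a b =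
    CInt (fun t => ((u + Ci * RtoC y * v) + RtoC t * v)%C) a b).
  { intros y a' b'. apply CInt_ext; intros t. apply injective_projections; simpl; ring. }
  assert (V : forall x a b, CInt (fun t => (u + (x, t) * v)%C) a b =
    CInt (fun t => ((u + RtoC x * v) + RtoC t * (Ci * v))%C) a b).
  { intros x a' b'. apply CInt_ext; intros t. apply injective_projections; simpl; ring. }
  rewrite !H, !V, !CInt_affine.
  apply injective_projections; simpl; field.
Qed.

Lemma nested_intervals (a b : nat -> R) :
  (forall n, a n <= a (S n)) -> (forall n, b (S n) <= b n) -> (forall n, a n <= b n) ->
  exists u, forall n, a n <= u <= b n.
Proof.
  intros Ha Hb Hab.
  assert (Hmono : forall n k, a n <= a (n + k)%nat).
  { intros n k; induction k as [|k IH]; [rewrite Nat.add_0_r; lra|].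
    rewrite Nat.add_succ_r. specialize (Ha (n + k)%nat). lra. }
  assert (Hmonob : forall n k, b (n + k)%nat <= b n).
  { intros n k; induction k as [|k IH]; [rewrite Nat.add_0_r; lra|].
    rewrite Nat.add_succ_r. specialize (Hb (n + k)%nat). lra. }
  assert (Hx : forall n m, a n <= b m).
  { intros n m. pose proof (Hmono n m). pose proof (Hmonob m n).
    pose proof (Hab (n + m)%nat). rewrite (Nat.add_comm m n) in *. lra. }
  destruct (completeness (fun x => exists n, x = a n)) as [u [Hu1 Hu2]].
  - exists (b O). intros x [n ->]. apply Hx.
  - exists (a O); now exists O.
  - exists u; intros n; split.
    + apply Hu1. now exists n.
    + apply Hu2. intros x [m ->]. apply Hx.
Qed.

Definition box : Type := (R * R) * (R * R).

(** Compactness of a rectangle as an induction principle, used for Goursat's theorem and for the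
    boundedness of continuous functions. A box violating [P] would contain a violating quarter, and
    the nested quarters would shrink to a point where [P] holds on all small boxes. *)
Lemma box_bisection (P : box -> Prop) :
  (forall a b c d, a <= b -> c <= d ->
    let m := (a + b) / 2 in let n := (c + d) / 2 in
    P ((a, m), (c, n)) -> P ((m, b), (c, n)) -> P ((a, m), (n, d)) -> P ((m, b), (n, d)) ->
    P ((a, b), (c, d))) ->
  (forall u v, exists e, 0 < e /\ forall a b c d, a <= u <= b -> c <= v <= d ->
    b - a < e -> d - c < e -> P ((a, b), (c, d))) ->
  forall a b c d, a <= b -> c <= d -> P ((a, b), (c, d)).
Proof.
  intros Hsplit Hloc a0 b0 c0 d0 Hab0 Hcd0. apply NNPP; intros Hbad.
  set (half := fun (q : bool) (I : R * R) =>
    if q then (fst I, (fst I + snd I) / 2) else ((fst I + snd I) / 2, snd I)).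
  (* The fourth quarter is taken without a test: if the three others satisfy [P], it cannot, by
     [Hsplit]. *)
  set (step := fun B : box =>
    if excluded_middle_informative (P (half true (fst B), half true (snd B))) then
    if excluded_middle_informative (P (half false (fst B), half true (snd B))) then
    if excluded_middle_informative (P (half true (fst B), half false (snd B))) then
      (half false (fst B), half false (snd B))
    else (half true (fst B), half false (snd B))
    else (half false (fst B), half true (snd B))
    else (half true (fst B), half true (snd B))).
  assert (Hstep : forall B, fst (fst B) <= snd (fst B) -> fst (snd B) <= snd (snd B) ->
    ~ P B -> (exists q r, step B = (half q (fst B), half r (snd B))) /\ ~ P (step B)).
  { intros [[a b] [c d]]; simpl; intros Hab Hcd HB. unfold step.
    destruct (excluded_middle_informative _) as [h1|h1]; [|split; eauto].
    destruct (excluded_middle_informative _) as [h2|h2]; [|split; eauto].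
    destruct (excluded_middle_informative _) as [h3|h3]; [|split; eauto].
    split; [eauto|]. intros h4. apply HB. apply Hsplit; auto. }
  set (B := fix B (n : nat) : box := match n with O => ((a0, b0), (c0, d0)) | S n => step (B n) end).
  assert (HB : forall n, ~ P (B n) /\ fst (fst (B n)) <= snd (fst (B n)) /\
    fst (snd (B n)) <= snd (snd (B n)) /\
    snd (fst (B n)) - fst (fst (B n)) = (b0 - a0) * (1 / 2) ^ n /\
    snd (snd (B n)) - fst (snd (B n)) = (d0 - c0) * (1 / 2) ^ n).
  { induction n as [|n (I1 & I2 & I3 & I4 & I5)].
    - simpl. repeat split; auto; ring.
    - destruct (Hstep (B n) I2 I3 I1) as [[q [r E]] Hn].
      change (B (S n)) with (step (B n)). split; [exact Hn|]. rewrite E.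
      simpl pow. destruct q, r; simpl; lra. }
  assert (HS : forall n, exists q r, B (S n) = (half q (fst (B n)), half r (snd (B n)))).
  { intros n. destruct (HB n) as (I1 & I2 & I3 & _).
    exact (proj1 (Hstep (B n) I2 I3 I1)). }
  destruct (nested_intervals (fun n => fst (fst (B n))) (fun n => snd (fst (B n)))) as [u Hu].
  { intros n; destruct (HS n) as [q [r ->]]; destruct (HB n) as (_ & I2 & _).
    destruct q; simpl; lra. }
  { intros n; destruct (HS n) as [q [r ->]]; destruct (HB n) as (_ & I2 & _).
    destruct q; simpl; lra. }
  { intros n; apply HB. }
  destruct (nested_intervals (fun n => fst (snd (B n))) (fun n => snd (snd (B n)))) as [v Hv].
  { intros n; destruct (HS n) as [q [r ->]]; destruct (HB n) as (_ & _ & I3 & _).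
    destruct r; simpl; lra. }
  { intros n; destruct (HS n) as [q [r ->]]; destruct (HB n) as (_ & _ & I3 & _).
    destruct r; simpl; lra. }
  { intros n; apply HB. }
  destruct (Hloc u v) as [e [He HP]].
  (* The [+ 1] keeps [s] positive for a degenerate box. *)
  set (s := (b0 - a0) + (d0 - c0) + 1).
  destruct (pow_lt_1_zero (1 / 2) ltac:(rewrite Rabs_pos_eq; lra) (e / s)) as [N HN].
  { apply Rdiv_lt_0_compat; unfold s; lra. }
  specialize (HN N (Nat.le_refl N)). rewrite Rabs_pos_eq in HN by (apply pow_le; lra).
  destruct (HB N) as (I1 & I2 & I3 & I4 & I5).
  assert (Hs : s * (1 / 2) ^ N < e).
  { apply Rmult_lt_compat_l with (r := s) in HN; [|unfold s; lra].
    replace (s * (e / s)) with e in HN by (field; unfold s; lra). exact HN. }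
  assert (0 < (1 / 2) ^ N) by (apply pow_lt; lra).
  apply I1. specialize (Hu N); specialize (Hv N).
  destruct (B N) as [[a b] [c d]]; simpl in *.
  apply HP; auto; unfold s in Hs; nra.
Qed.

(** With [s] half the perimeter, the bound [eps s^2] survives quartering, since each of the four
    pieces has half the perimeter. On small boxes the tangent affine function, whose contour
    integral is zero, is subtracted, and the remainder is [o(|z - p|)]. *)
Theorem goursat_rectangle (f : C -> C) (a b c d : R) :
  holomorphic f -> a <= b -> c <= d -> rect_int f a b c d = 0.
Proof.
  intros Hf Hab Hcd.
  assert (Hc := holomorphic_continuous f Hf).
  assert (Main : forall eps, 0 < eps ->
    Cmod (rect_int f a b c d) <= eps * ((b - a) + (d - c)) ^ 2).
  { intros eps Heps.
    apply (box_bisection (fun B => Cmod (rect_int f (fst (fst B)) (snd (fst B)) (fst (snd B)) (snd (snd B)))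
      <= eps * ((snd (fst B) - fst (fst B)) + (snd (snd B) - fst (snd B))) ^ 2)); auto; simpl.
    - clear a b c d Hab Hcd; intros a b c d Hab Hcd H1 H2 H3 H4.
      rewrite (rect_int_split f a ((a + b) / 2) b c ((c + d) / 2) d) by auto.
      eapply Rle_trans; [apply Cmod_triangle|].
      eapply Rle_trans; [apply Rplus_le_compat_r, Cmod_triangle|].
      eapply Rle_trans; [apply Rplus_le_compat_r, Rplus_le_compat_r, Cmod_triangle|].
      eapply Rle_trans; [repeat apply Rplus_le_compat; eassumption|]. apply Req_le. field.
    - intros u v. destruct (Hf (u, v)) as [l Hl].
      (* [eps / 2] because the perimeter is [2 s]. With both sides below [e / 2], each point of the
         box is within [s < e] of [p]. *)
      destruct (Hl (eps / 2) ltac:(lra)) as [e [He Hw]].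
      exists (e / 2). split; [lra|]. clear a b c d Hab Hcd. intros a b c d Hu Hv Hba Hdc.
      set (p := (u, v) : C) in *.
      set (g := fun z => (f z + ((p * l - f p) + z * (- l)))%C).
      assert (Hlin : holomorphic (fun z => ((p * l - f p) + z * (- l))%C)).
      { apply holomorphic_plus; [apply holomorphic_const|].
        apply holomorphic_mult; [apply holomorphic_id|apply holomorphic_const]. }
      assert (E : rect_int f a b c d = rect_int g a b c d).
      { unfold g. rewrite (rect_int_plus f (fun z => ((p * l - f p) + z * (- l))%C)), rect_int_affine;
        auto using holomorphic_continuous. ring. }
      rewrite E. set (s := (b - a) + (d - c)).
      eapply Rle_trans; [apply (Cmod_rect_int_le g a b c d (eps / 2 * s))|].
      + apply holomorphic_continuous. unfold g. now apply holomorphic_plus.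
      + lra.
      + lra.
      + intros x y Hx Hy. unfold g.
        replace (f (x, y) + (p * l - f p + (x, y) * - l))%C with
          (f (x, y) - f p - ((x, y) - p) * l)%C by ring.
        assert (Hd : Cmod ((x, y) - p) <= s).
        { eapply Rle_trans; [apply Cmod_le_Rabs|]. simpl. unfold s.
          apply Rplus_le_compat; apply Rabs_le; lra. }
        eapply Rle_trans; [apply Hw; unfold s in Hd; lra|].
        apply Rmult_le_compat_l; lra.
      + fold s. apply Req_le. field. }
  apply Cmod_eq_0. apply Rle_antisym; [|apply Cmod_ge_0].
  set (s := ((b - a) + (d - c)) ^ 2) in *.
  assert (Hs : 0 <= s) by apply pow2_ge_0.
  apply Rnot_lt_le; intros Hp.
  specialize (Main (Cmod (rect_int f a b c d) / (2 * (s + 1)))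
    ltac:(apply Rdiv_lt_0_compat; lra)).
  set (X := Cmod _) in *.
  replace (X / (2 * (s + 1)) * s) with (X * (s / (2 * (s + 1)))) in Main by (field; lra).
  assert (s / (2 * (s + 1)) < 1).
  { apply Rmult_lt_reg_r with (2 * (s + 1)); [lra|].
    unfold Rdiv; rewrite Rmult_assoc, Rinv_l by lra. lra. }
  nra.
Qed.

(** * Unique continuation from a half-plane *)

Lemma ccontinuous_bounded (f : C -> C) (a b c d : R) :
  ccontinuous f -> a <= b -> c <= d ->
  exists M, forall x y, a <= x <= b -> c <= y <= d -> Cmod (f (x, y)) <= M.
Proof.
  intros Hf Hab Hcd.
  apply (box_bisection (fun B => exists M, forall x y, fst (fst B) <= x <= snd (fst B) ->
    fst (snd B) <= y <= snd (snd B) -> Cmod (f (x, y)) <= M)); auto; simpl.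
  - clear. intros a b c d Hab Hcd [M1 H1] [M2 H2] [M3 H3] [M4 H4].
    exists (Rmax (Rmax M1 M2) (Rmax M3 M4)). intros x y Hx Hy.
    destruct (Rle_lt_dec x ((a + b) / 2)) as [h|h], (Rle_lt_dec y ((c + d) / 2)) as [k|k].
    + eapply Rle_trans; [apply H1; lra|]. eapply Rle_trans; [|apply Rmax_l]. apply Rmax_l.
    + eapply Rle_trans; [apply H3; lra|]. eapply Rle_trans; [|apply Rmax_r]. apply Rmax_l.
    + eapply Rle_trans; [apply H2; lra|]. eapply Rle_trans; [|apply Rmax_l]. apply Rmax_r.
    + eapply Rle_trans; [apply H4; lra|]. eapply Rle_trans; [|apply Rmax_r]. apply Rmax_r.
  - intros u v. destruct (Hf (u, v) 1 ltac:(lra)) as [e [He Hw]].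
    exists (e / 2). split; [lra|]. intros a' b' c' d' Hu Hv Hba Hdc.
    exists (1 + Cmod (f (u, v))). intros x y Hx Hy.
    replace (f (x, y)) with ((f (x, y) - f (u, v)) + f (u, v))%C by ring.
    eapply Rle_trans; [apply Cmod_triangle|]. apply Rplus_le_compat_r, Rlt_le, Hw.
    eapply Rle_lt_trans; [apply Cmod_le_Rabs|]. simpl.
    replace e with (e / 2 + e / 2) by field.
    apply Rplus_lt_compat; apply Rabs_def1; lra.
Qed.

Lemma continuous_RtoC_mult (g : R -> R) (f : R -> C) (t : R) :
  continuous g t -> @continuous R_UniformSpace C_R_NormedModule f t ->
  @continuous R_UniformSpace C_R_NormedModule (fun t => (RtoC (g t) * f t)%C) t.
Proof.
  intros Hg Hf.
  apply (continuous_ext (fun t => @scal R_AbsRing C_R_NormedModule (g t) (f t))).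
  - intros x. apply scal_R_Cmult.
  - now apply (continuous_scal (V := C_R_NormedModule)).
Qed.

Lemma continuous_gauss (lam y0 t : R) : continuous (fun t => exp (- (lam * (t - y0) ^ 2))) t.
Proof.
  apply (ex_derive_continuous (V := R_NormedModule)). auto_derive; auto.
Qed.

(* The factor [exp (lam (z - w)^2)] is a Gaussian on the vertical line through
   [w], and small on the horizontal sides as soon as [Y > x1 - x0]. *)
Lemma gauss_line_integral_le (F : C -> C) (x0 x1 y0 Y lam M eps : R) :
  holomorphic F -> x0 <= x1 -> 0 <= Y -> 0 <= lam ->
  (forall x y, x0 <= x <= x1 -> y0 - Y <= y <= y0 + Y -> Cmod (F (x, y)) <= M) ->
  (forall y, y0 - Y <= y <= y0 + Y -> Cmod (F (x1, y)) <= eps) ->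
  Cmod (CInt (fun t => (RtoC (exp (- (lam * (t - y0) ^ 2))) * F (x0, t))%C) (y0 - Y) (y0 + Y))
  <= 2 * (x1 - x0) * (M * exp (lam * ((x1 - x0) ^ 2 - Y ^ 2)))
     + 2 * Y * (eps * exp (lam * (x1 - x0) ^ 2)).
Proof.
  intros HF Hx HY Hlam HM Heps.
  set (w := (x0, y0) : C).
  set (W := fun z : C => cexp (RtoC lam * ((z + - w) * (z + - w)))).
  set (G := fun z => (W z * F z)%C).
  assert (HW : holomorphic W).
  { apply (holomorphic_comp cexp (fun z => (RtoC lam * ((z + - w) * (z + - w)))%C)
      holomorphic_cexp).
    apply holomorphic_mult; [apply holomorphic_const|].
    apply holomorphic_mult; apply holomorphic_plus;
      (apply holomorphic_id || apply holomorphic_const). }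
  assert (HG : holomorphic G) by now apply holomorphic_mult.
  assert (HGc := holomorphic_continuous G HG).
  assert (HWm : forall x y, Cmod (W (x, y)) = exp (lam * ((x - x0) ^ 2 - (y - y0) ^ 2))).
  { intros x y. unfold W. rewrite Cmod_cexp. f_equal. simpl. ring. }
  pose proof (goursat_rectangle G x0 x1 (y0 - Y) (y0 + Y) HG Hx ltac:(lra)) as E.
  unfold rect_int in E.
  rewrite (CInt_ext _ (fun t => G (x0, t))).
  2:{ intros t. unfold G, W, cexp. f_equal. simpl.
      match goal with |- RtoC (exp ?a) = (exp ?b * cos ?c, _) =>
        replace b with a by ring; replace c with 0 by ring end.
      rewrite cos_0, sin_0. apply injective_projections; simpl; ring. }
  set (V0 := CInt (fun t => G (x0, t)) (y0 - Y) (y0 + Y)) in *.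
  set (V1 := CInt (fun t => G (x1, t)) (y0 - Y) (y0 + Y)) in *.
  set (H0 := CInt (fun t => G (t, y0 - Y)) x0 x1) in *.
  set (H1 := CInt (fun t => G (t, y0 + Y)) x0 x1) in *.
  assert (B0 : Cmod H0 <= (x1 - x0) * (M * exp (lam * ((x1 - x0) ^ 2 - Y ^ 2)))).
  { apply Cmod_CInt_le; auto; [intros; now apply ccontinuous_hline|].
    intros t Ht. unfold G. rewrite Cmod_mult, HWm, Rmult_comm.
    apply Rmult_le_compat; auto using Cmod_ge_0.
    - apply Rlt_le, exp_pos.
    - apply HM; lra.
    - apply exp_nondecreasing, Rmult_le_compat_l; auto.
      assert ((t - x0) ^ 2 <= (x1 - x0) ^ 2) by (apply pow_incr; lra). nra. }
  assert (B1 : Cmod H1 <= (x1 - x0) * (M * exp (lam * ((x1 - x0) ^ 2 - Y ^ 2)))).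
  { apply Cmod_CInt_le; auto; [intros; now apply ccontinuous_hline|].
    intros t Ht. unfold G. rewrite Cmod_mult, HWm, Rmult_comm.
    apply Rmult_le_compat; auto using Cmod_ge_0.
    - apply Rlt_le, exp_pos.
    - apply HM; lra.
    - apply exp_nondecreasing, Rmult_le_compat_l; auto.
      assert ((t - x0) ^ 2 <= (x1 - x0) ^ 2) by (apply pow_incr; lra). nra. }
  assert (BV : Cmod V1 <= (y0 + Y - (y0 - Y)) * (eps * exp (lam * (x1 - x0) ^ 2))).
  { apply Cmod_CInt_le; [lra|intros; now apply ccontinuous_vline|].
    intros t Ht. unfold G. rewrite Cmod_mult, HWm, Rmult_comm.
    apply Rmult_le_compat; auto using Cmod_ge_0.
    - apply Rlt_le, exp_pos.
    - apply exp_nondecreasing, Rmult_le_compat_l; auto.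
      pose proof (pow2_ge_0 (t - y0)). lra. }
  replace (Cmod V0) with (Cmod (Ci * V0)) by (rewrite Cmod_mult, Cmod_Ci; ring).
  replace (Ci * V0)%C with (H0 + Ci * V1 + - H1)%C.
  2:{ replace (Ci * V0)%C with (Ci * V0 + 0)%C by ring. rewrite <- E. ring. }
  eapply Rle_trans; [apply Cmod_triangle|]. rewrite Cmod_opp.
  eapply Rle_trans; [apply Rplus_le_compat_r, Cmod_triangle|].
  rewrite Cmod_mult, Cmod_Ci. lra.
Qed.

(** If [f y0] were nonzero, then for large [lam] the Gaussian mass near [y0] would make the weighted
    integral larger than [B * exp (- lam)] and the contribution of the remaining [t] allow. *)
Lemma gauss_concentration (f : R -> C) (y0 Y M B : R) :
  (forall t, @continuous R_UniformSpace C_R_NormedModule f t) ->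
  1 <= Y -> 0 <= B ->
  (forall t, y0 - Y <= t <= y0 + Y -> Cmod (f t) <= M) ->
  (forall lam, 0 <= lam -> Cmod (CInt (fun t => (RtoC (exp (- (lam * (t - y0) ^ 2))) * f t)%C)
     (y0 - Y) (y0 + Y)) <= B * exp (- lam)) ->
  f y0 = 0.
Proof.
  intros Hf HY HB HM Hlam. apply NNPP; intros Hnz.
  set (v := f y0) in *. set (nu := Cmod v).
  assert (Hnu : 0 < nu) by now apply Cmod_gt_0.
  assert (HM0 : 0 <= M) by (eapply Rle_trans; [apply Cmod_ge_0|apply (HM y0); lra]).
  assert (Hd : exists d, 0 < d <= 1 /\ forall t, Rabs (t - y0) <= d -> Cmod (f t - v) <= nu / 2).
  { assert (Hp : 0 < nu / 4) by lra.
    destruct (proj1 (filterlim_locally _ _) (Hf y0) (mkposreal _ Hp)) as [d Hd].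
    exists (Rmin (d / 2) 1). destruct d as [d hd]; simpl in *. split.
    - split; [apply Rmin_glb_lt; lra|apply Rmin_r].
    - intros t Ht. assert (Hb : ball y0 d t).
      { change (Rabs (t - y0) < d). pose proof (Rmin_l (d / 2) 1). lra. }
      specialize (Hd t Hb). apply (C_NormedModule_mixin_compat2 _ _ (mkposreal _ Hp)) in Hd; simpl in Hd.
      pose proof sqrt2_le_2.
      change (Cmod (f t - v) < sqrt 2 * (nu / 4)) in Hd. nra. }
  destruct Hd as [d [Hd0 Hd]].
  set (K := B + 2 * Y * (M + nu)).
  assert (HK : 0 <= K) by (unfold K; nra).
  (* The weighted integral is [v] times the Gaussian mass plus the error of replacing [f] by [v].
     Within [d] of [y0] this error costs at most half of the main term; further away the weight is
     at most [exp (- (lam * d ^ 2))], which also dominates [exp (- lam)] because [d <= 1]. The mass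
     is bounded below by its part on the interval of length [d] around [y0]. *)
  assert (Main : forall lam, 0 <= lam ->
    nu / 2 * (d * exp (- (lam * (d / 2) ^ 2))) <= K * exp (- (lam * d ^ 2))).
  { intros lam Hl.
    set (g := fun t => exp (- (lam * (t - y0) ^ 2))).
    assert (Hg : forall t, continuous g t) by (intros; apply continuous_gauss).
    assert (Ig : forall a b, ex_RInt g a b).
    { intros. apply (ex_RInt_continuous (V := R_CompleteNormedModule)); auto. }
    set (a := y0 - Y). set (b := y0 + Y).
    assert (Hgp : forall t, 0 <= g t) by (intros; apply Rlt_le, exp_pos).
    assert (W : d * exp (- (lam * (d / 2) ^ 2)) <= RInt g a b).
    { rewrite <- (RInt_Chasles g a (y0 - d / 2) b), <- (RInt_Chasles g (y0 - d / 2) (y0 + d / 2) b) by auto.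
      unfold plus; simpl.
      assert (0 <= RInt g a (y0 - d / 2)) by (apply RInt_ge_0; auto; unfold a; lra).
      assert (0 <= RInt g (y0 + d / 2) b) by (apply RInt_ge_0; auto; unfold b; lra).
      assert (RInt (fun _ => exp (- (lam * (d / 2) ^ 2))) (y0 - d / 2) (y0 + d / 2)
        <= RInt g (y0 - d / 2) (y0 + d / 2)).
      { apply RInt_le; auto; [lra|apply ex_RInt_const|].
        intros x Hx. apply exp_nondecreasing, Ropp_le_contravar, Rmult_le_compat_l; auto. nra. }
      rewrite RInt_const in H1. unfold scal in H1; simpl in H1; unfold mult in H1; simpl in H1.
      simpl in *. lra. }
    assert (Hc1 : forall t, @continuous R_UniformSpace C_R_NormedModule (fun t => (RtoC (g t) * f t)%C) t)
      by (intros; now apply continuous_RtoC_mult).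
    assert (Hcm : forall t, @continuous R_UniformSpace C_R_NormedModule (fun t => (f t + - v)%C) t).
    { intros t. apply (continuous_plus (V := C_R_NormedModule)); [apply Hf|apply continuous_const]. }
    assert (Hc2 : forall t, @continuous R_UniformSpace C_R_NormedModule (fun t => (RtoC (g t) * (f t + - v))%C) t)
      by (intros; now apply continuous_RtoC_mult).
    assert (Hc3 : forall t, @continuous R_UniformSpace C_R_NormedModule (fun t => (RtoC (g t) * v)%C) t)
      by (intros; apply continuous_RtoC_mult; [auto|apply continuous_const]).
    assert (E : CInt (fun t => (RtoC (g t) * f t)%C) a b =
      (RtoC (RInt g a b) * v + CInt (fun t => (RtoC (g t) * (f t + - v))%C) a b)%C).
    { rewrite (CInt_ext _ (fun t => (RtoC (g t) * v + RtoC (g t) * (f t + - v))%C)) by (intros; ring).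
      rewrite CInt_plus by auto. f_equal.
      apply (is_RInt_unique (V := C_R_CompleteNormedModule)).
      apply (is_RInt_fct_extend_pair (U := R_NormedModule) (V := R_NormedModule)); simpl.
      - replace (RInt g a b * fst v - 0 * snd v) with (scal (fst v) (RInt g a b))
          by (unfold scal; simpl; unfold mult; simpl; ring).
        apply (is_RInt_ext (fun t => scal (fst v) (g t))).
        { intros; unfold scal; simpl; unfold mult; simpl; ring. }
        apply (is_RInt_scal (V := R_NormedModule)). apply (RInt_correct (V := R_CompleteNormedModule)); auto.
      - replace (RInt g a b * snd v + 0 * fst v) with (scal (snd v) (RInt g a b))
          by (unfold scal; simpl; unfold mult; simpl; ring).
        apply (is_RInt_ext (fun t => scal (snd v) (g t))).
        { intros; unfold scal; simpl; unfold mult; simpl; ring. }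
        apply (is_RInt_scal (V := R_NormedModule)). apply (RInt_correct (V := R_CompleteNormedModule)); auto. }
    set (rest := CInt (fun t => (RtoC (g t) * (f t + - v))%C) a b) in *.
    assert (Hrest : Cmod rest <= nu / 2 * RInt g a b + 2 * Y * ((M + nu) * exp (- (lam * d ^ 2)))).
    { rewrite Cmod_norm.
      apply (norm_RInt_le (V := C_R_NormedModule) (fun t => (RtoC (g t) * (f t + - v))%C)
        (fun t => nu / 2 * g t + (M + nu) * exp (- (lam * d ^ 2))) a b); [unfold a, b; lra| | |].
      - intros t Ht. rewrite <- Cmod_norm, Cmod_mult, Cmod_R, Rabs_pos_eq by auto.
        destruct (Rle_lt_dec (Rabs (t - y0)) d) as [h|h].
        + specialize (Hd t h). change (f t + - v)%C with (f t - v)%C.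
          pose proof (Hgp t). pose proof (exp_pos (- (lam * d ^ 2))).
          assert (g t * Cmod (f t - v) <= g t * (nu / 2)) by (apply Rmult_le_compat_l; auto).
          nra.
        + assert (g t <= exp (- (lam * d ^ 2))).
          { apply exp_nondecreasing, Ropp_le_contravar, Rmult_le_compat_l; auto.
            rewrite <- (Rsqr_pow2 d), <- (Rsqr_pow2 (t - y0)). apply Rsqr_le_abs_1.
            rewrite (Rabs_pos_eq d); lra. }
          assert (Cmod (f t + - v) <= M + nu).
          { eapply Rle_trans; [apply Cmod_triangle|]. rewrite Cmod_opp.
            apply Rplus_le_compat_r. apply HM. exact Ht. }
          pose proof (Hgp t). pose proof (Cmod_ge_0 (f t + - v)).
          assert (g t * Cmod (f t + - v) <= exp (- (lam * d ^ 2)) * (M + nu))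
            by (apply Rmult_le_compat; auto).
          nra.
      - apply (RInt_correct (V := C_R_CompleteNormedModule)). now apply ex_CInt.
      - replace (2 * Y * ((M + nu) * exp (- (lam * d ^ 2)))) with
          (scal (b - a) ((M + nu) * exp (- (lam * d ^ 2))))
          by (unfold scal; simpl; unfold mult; simpl; unfold a, b; ring).
        apply (is_RInt_plus (V := R_NormedModule)).
        + apply (is_RInt_scal (V := R_NormedModule)). apply (RInt_correct (V := R_CompleteNormedModule)); auto.
        + apply (is_RInt_const (V := R_NormedModule)). }
    specialize (Hlam lam Hl). change (Cmod (CInt (fun t => (RtoC (g t) * f t)%C) a b) <= B * exp (- lam)) in Hlam.
    assert (Hnw : nu * RInt g a b <= B * exp (- lam) + (nu / 2 * RInt g a b + 2 * Y * ((M + nu) * exp (- (lam * d ^ 2))))).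
    { replace (nu * RInt g a b) with (Cmod (RtoC (RInt g a b) * v)).
      - replace (RtoC (RInt g a b) * v)%C with (CInt (fun t => (RtoC (g t) * f t)%C) a b + - rest)%C
          by (rewrite E; ring).
        eapply Rle_trans; [apply Cmod_triangle|]. rewrite Cmod_opp. lra.
      - rewrite Cmod_mult, Cmod_R, Rabs_pos_eq.
        + unfold nu; ring.
        + apply RInt_ge_0; auto. unfold a, b; lra. }
    assert (exp (- lam) <= exp (- (lam * d ^ 2))).
    { apply exp_nondecreasing. assert (d ^ 2 <= 1) by nra. nra. }
    assert (B * exp (- lam) <= B * exp (- (lam * d ^ 2))) by (apply Rmult_le_compat_l; auto).
    unfold K. nra. }
  assert (Main2 : forall x, 0 <= x -> nu / 2 * d * (1 + x) <= K).
  { intros x Hx. set (lam := x / (3 * (d / 2) ^ 2)).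
    assert (Hdd : 0 < (d / 2) ^ 2) by (apply pow_lt; lra).
    assert (Hl : 0 <= lam) by (apply Rdiv_le_0_compat; lra).
    specialize (Main lam Hl).
    replace (- (lam * d ^ 2)) with (- (lam * (d / 2) ^ 2) + - x) in Main
      by (unfold lam; field; lra).
    rewrite exp_plus in Main.
    assert (Hp := exp_pos (- (lam * (d / 2) ^ 2))).
    assert (Main' : nu / 2 * d <= K * exp (- x)).
    { apply Rmult_le_reg_r with (exp (- (lam * (d / 2) ^ 2))); auto. nra. }
    assert (Hx1 : (1 + x) * exp (- x) <= 1).
    { rewrite exp_Ropp. pose proof (exp_ineq1_le x). pose proof (exp_pos x).
      apply Rmult_le_reg_r with (exp x); auto. rewrite Rmult_assoc, Rinv_l by lra. lra. }
    apply Rle_trans with (K * exp (- x) * (1 + x)); [apply Rmult_le_compat_r; lra|].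
    replace (K * exp (- x) * (1 + x)) with (K * ((1 + x) * exp (- x))) by ring.
    rewrite <- (Rmult_1_r K) at 2. apply Rmult_le_compat_l; auto. }
  assert (Hnd : 0 < nu / 2 * d) by nra.
  specialize (Main2 (K / (nu / 2 * d)) ltac:(apply Rdiv_le_0_compat; lra)).
  replace (nu / 2 * d * (1 + K / (nu / 2 * d))) with (nu / 2 * d + K) in Main2 by (field; lra).
  lra.
Qed.

(** [D] is only known as a locally uniform limit of entire functions. Goursat's theorem is therefore
    applied to the approximants, and the approximation error is sent to zero at fixed [lam];
    holomorphy of the limit is never established. *)
Theorem unique_continuation (D : C -> C) (F : nat -> C -> C) (X : R) :
  (forall k, holomorphic (F k)) ->
  (forall r eps, 0 < eps -> exists k, forall z, Cmod z <= r -> Cmod (F k z - D z) <= eps) ->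
  (forall z, X <= Re z -> D z = 0) ->
  forall z, D z = 0.
Proof.
  intros HF Happ HX w.
  assert (Hc : ccontinuous D).
  { intros z eps He. destruct (Happ (Cmod z + 1) (eps / 4) ltac:(lra)) as [k Hk].
    destruct (holomorphic_continuous _ (HF k) z (eps / 4) ltac:(lra)) as [d [Hd Hw]].
    exists (Rmin d 1). split; [apply Rmin_glb_lt; lra|]. intros u Hu.
    pose proof (Rmin_l d 1). pose proof (Rmin_r d 1).
    specialize (Hw u ltac:(lra)).
    assert (Hku := Hk u). assert (Hkz := Hk z ltac:(lra)).
    assert (Cmod u <= Cmod z + 1).
    { replace u with (z + (u - z))%C by ring.
      eapply Rle_trans; [apply Cmod_triangle|]. lra. }
    specialize (Hku ltac:(lra)).
    replace (D u - D z)%C with (- (F k u - D u) + (F k u - F k z) + (F k z - D z))%C by ring.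
    eapply Rle_lt_trans; [apply Cmod_triangle|].
    eapply Rle_lt_trans; [apply Rplus_le_compat_r, Cmod_triangle|].
    rewrite Cmod_opp. lra. }
  destruct w as [x0 y0].
  (* With [Y = L + 1], [L^2 - Y^2 <= -1], so the horizontal sides contribute at most a multiple of
     [exp (- lam)]; the right side lies where [D] vanishes. *)
  set (x1 := Rmax X x0). set (L := x1 - x0). set (Y := L + 1).
  assert (HL : 0 <= L) by (unfold L, x1; pose proof (Rmax_r X x0); lra).
  destruct (ccontinuous_bounded D x0 x1 (y0 - Y) (y0 + Y) Hc) as [M HM];
    [unfold L in HL; lra|unfold Y; lra|].
  assert (HM0 : 0 <= M).
  { eapply Rle_trans; [apply Cmod_ge_0|apply (HM x0 y0)]; [unfold L in HL; lra|unfold Y; lra]. }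
  apply (gauss_concentration (fun t => D (x0, t)) y0 Y M (2 * L * M)).
  - intros; now apply ccontinuous_vline.
  - unfold Y; lra.
  - nra.
  - intros t Ht. apply HM; auto. unfold L in HL; lra.
  - intros lam Hlam.
    set (g := fun t => exp (- (lam * (t - y0) ^ 2))).
    (* The three terms come from the horizontal sides, from the right side, where [F k] is at most
       [eps], and from the passage between [F k] and [D] on the left side. *)
    assert (HI : forall eps, 0 < eps ->
      Cmod (CInt (fun t => (RtoC (g t) * D (x0, t))%C) (y0 - Y) (y0 + Y)) <=
      2 * L * ((M + eps) * exp (lam * (L ^ 2 - Y ^ 2))) + 2 * Y * (eps * exp (lam * L ^ 2)) + 2 * Y * eps).
    { intros eps He.
      destruct (Happ (Rabs x0 + Rabs x1 + Rabs y0 + Y) eps He) as [k Hk].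
      assert (Hbox : forall x y, x0 <= x <= x1 -> y0 - Y <= y <= y0 + Y ->
        Cmod (F k (x, y) - D (x, y)) <= eps).
      { intros x y Hx Hy. apply Hk. eapply Rle_trans; [apply Cmod_le_Rabs|]. simpl.
        assert (Rabs x <= Rabs x0 + Rabs x1).
        { unfold Rabs. destruct (Rcase_abs x), (Rcase_abs x0), (Rcase_abs x1); lra. }
        assert (Rabs y <= Rabs y0 + Y).
        { unfold Rabs. destruct (Rcase_abs y), (Rcase_abs y0); lra. }
        lra. }
      assert (Hx01 : x0 <= x1) by (unfold L in HL; lra).
      pose proof (gauss_line_integral_le (F k) x0 x1 y0 Y lam (M + eps) eps (HF k) Hx01
        ltac:(unfold Y; lra) Hlam) as G.
      assert (Hck := holomorphic_continuous _ (HF k)).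
      assert (Hcd : forall t, @continuous R_UniformSpace C_R_NormedModule (fun t => (F k (x0, t) + - D (x0, t))%C) t).
      { intros t. apply (continuous_plus (V := C_R_NormedModule)); [now apply ccontinuous_vline|].
        apply (continuous_opp (V := C_R_NormedModule)). now apply ccontinuous_vline. }
      assert (Hg : forall t, continuous g t) by (intros; apply continuous_gauss).
      assert (E : CInt (fun t => (RtoC (g t) * F k (x0, t))%C) (y0 - Y) (y0 + Y) =
        (CInt (fun t => (RtoC (g t) * D (x0, t))%C) (y0 - Y) (y0 + Y) +
         CInt (fun t => (RtoC (g t) * (F k (x0, t) + - D (x0, t)))%C) (y0 - Y) (y0 + Y))%C).
      { rewrite <- CInt_plus.
        - apply CInt_ext; intros; ring.
        - intros; apply continuous_RtoC_mult; auto. now apply ccontinuous_vline.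
        - intros; apply continuous_RtoC_mult; auto. }
      assert (B2 : Cmod (CInt (fun t => (RtoC (g t) * (F k (x0, t) + - D (x0, t)))%C) (y0 - Y) (y0 + Y))
        <= (y0 + Y - (y0 - Y)) * eps).
      { apply Cmod_CInt_le; [unfold Y; lra|intros; now apply continuous_RtoC_mult|].
        intros t Ht. rewrite Cmod_mult, Cmod_R, Rabs_pos_eq by apply Rlt_le, exp_pos.
        assert (g t <= 1).
        { unfold g. rewrite <- exp_0. apply exp_nondecreasing. pose proof (pow2_ge_0 (t - y0)). nra. }
        assert (0 <= g t) by apply Rlt_le, exp_pos.
        specialize (Hbox x0 t ltac:(lra) Ht). unfold Cminus in Hbox.
        pose proof (Cmod_ge_0 (F k (x0, t) + - D (x0, t))). nra. }
      assert (G' := G).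
      specialize (G' ltac:(intros x y Hx Hy;
        replace (F k (x, y)) with (D (x, y) + (F k (x, y) - D (x, y)))%C by ring;
        eapply Rle_trans; [apply Cmod_triangle|]; apply Rplus_le_compat; auto)).
      specialize (G' ltac:(intros y Hy; specialize (Hbox x1 y ltac:(lra) Hy);
        rewrite (HX (x1, y)) in Hbox by (simpl; unfold x1; apply Rmax_l);
        replace (F k (x1, y)) with (F k (x1, y) - 0)%C by ring; exact Hbox)).
      fold L in G'. fold g in G'.
      change (Cmod (CInt (fun t => (RtoC (g t) * F k (x0, t))%C) (y0 - Y) (y0 + Y)) <=
        2 * L * ((M + eps) * exp (lam * (L ^ 2 - Y ^ 2))) + 2 * Y * (eps * exp (lam * L ^ 2))) in G'.
      replace (CInt (fun t => (RtoC (g t) * D (x0, t))%C) (y0 - Y) (y0 + Y)) with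
        (CInt (fun t => (RtoC (g t) * F k (x0, t))%C) (y0 - Y) (y0 + Y) +
         - CInt (fun t => (RtoC (g t) * (F k (x0, t) + - D (x0, t)))%C) (y0 - Y) (y0 + Y))%C
        by (rewrite E; ring).
      eapply Rle_trans; [apply Cmod_triangle|]. rewrite Cmod_opp. lra. }
    apply Rle_trans with (2 * L * (M * exp (lam * (L ^ 2 - Y ^ 2)))).
    + set (Q := 2 * L * exp (lam * (L ^ 2 - Y ^ 2)) + 2 * Y * exp (lam * L ^ 2) + 2 * Y).
      assert (HQ : 0 < Q).
      { unfold Q. pose proof (exp_pos (lam * (L ^ 2 - Y ^ 2))). pose proof (exp_pos (lam * L ^ 2)).
        unfold Y in *. nra. }
      apply le_epsilon. intros eps He. specialize (HI (eps / Q) ltac:(now apply Rdiv_lt_0_compat)).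
      eapply Rle_trans; [exact HI|]. apply Req_le.
      transitivity (2 * L * (M * exp (lam * (L ^ 2 - Y ^ 2))) + eps / Q * Q).
      * unfold Q at 5. ring.
      * f_equal. field. lra.
    + rewrite <- (Rmult_assoc (2 * L)). apply Rmult_le_compat_l; [nra|].
      apply exp_nondecreasing. unfold Y. nra.
Qed.

(** * Series *)

Lemma sum_n_finite_support (f : nat -> R) (M n : nat) :
  (forall k, (M < k)%nat -> f k = 0) -> (M <= n)%nat -> sum_n f n = sum_n f M.
Proof.
  intros H Hn. induction Hn as [|n Hn IH]; [easy|].
  rewrite sum_Sn, IH, H by lia. unfold plus; simpl; ring.
Qed.

(** The tail keeps its indices, its first terms being set to zero, so it can be compared termwise
    with an unshifted series. *)
Lemma is_series_tail (T : nat -> R) (l : R) (M : nat) :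
  is_series T l -> is_series (fun k => if (k <=? M)%nat then 0 else T k) (l - sum_n T M).
Proof.
  intros H.
  set (h := fun k => if (k <=? M)%nat then T k else 0).
  assert (Hh : is_series h (sum_n T M)).
  { change (is_lim_seq (sum_n h) (sum_n T M)).
    apply (is_lim_seq_ext_loc (fun _ => sum_n T M)); [|apply is_lim_seq_const].
    exists M; intros n Hn. rewrite (sum_n_finite_support h M n); auto.
    - apply sum_n_ext_loc; intros k Hk. unfold h. now rewrite (proj2 (Nat.leb_le k M)).
    - intros k Hk. unfold h. now rewrite (proj2 (Nat.leb_gt k M)). }
  apply (is_series_ext (fun k => plus (T k) (opp (h k)))).
  - intros k. unfold h, plus, opp; simpl. destruct (k <=? M)%nat; ring.
  - exact (is_series_minus (V := R_NormedModule) T h l (sum_n T M) H Hh).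
Qed.

Lemma csum_finite_support (f : nat -> C) (M n : nat) :
  (forall k, (M < k)%nat -> f k = 0) -> (M <= n)%nat -> csum f n = csum f M.
Proof.
  intros H Hn. induction Hn as [|n Hn IH]; [easy|].
  simpl. rewrite IH, H by lia. ring.
Qed.

Lemma cseries_finite_support (f : nat -> C) (M : nat) :
  (forall k, (M < k)%nat -> f k = 0) -> cseries f (csum f M).
Proof.
  intros H. apply (is_lim_seq_ext_loc (fun _ => 0)); [|apply is_lim_seq_const].
  exists M; intros n Hn. rewrite (csum_finite_support f M n) by auto.
  unfold Cminus. rewrite Cplus_opp_r, Cmod_0. easy.
Qed.

Lemma cseries_tail_le (a : nat -> C) (T : nat -> R) (l : C) (S : R) (M : nat) :
  (forall n, Cmod (a n) <= T n) -> is_series T S -> cseries a l ->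
  Cmod (l - csum a M) <= S - sum_n T M.
Proof.
  intros H HT Ha.
  set (h := fun k => if (k <=? M)%nat then a k else RtoC 0).
  assert (Hh : cseries h (csum a M)).
  { rewrite (csum_ext a h).
    - apply cseries_finite_support. intros k Hk; unfold h.
      now rewrite (proj2 (Nat.leb_gt k M)).
    - intros k Hk. unfold h. now rewrite (proj2 (Nat.leb_le k M)). }
  refine (cseries_Cmod_le (fun k => (a k + (-1) * h k)%C) _ _ _ _ (is_series_tail T S M HT) _).
  - intros n. unfold h. destruct (n <=? M)%nat.
    + replace (a n + -1 * a n)%C with (RtoC 0) by ring. rewrite Cmod_0; lra.
    + replace (a n + -1 * 0)%C with (a n) by ring. auto.
  - replace (l - csum a M)%C with (l + (-1) * csum a M)%C by ring.
    apply cseries_plus; auto. now apply cseries_scal.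
Qed.

Lemma tail_lim (T : nat -> R) (S : R) :
  is_series T S -> is_lim_seq (fun M => S - sum_n T M) 0.
Proof.
  intros H. replace (Finite 0) with (Finite (S - S)) by (f_equal; ring).
  apply is_lim_seq_minus'; [apply is_lim_seq_const|exact H].
Qed.

(** Columns [0..M] of a lower triangular array contain rows [0..M] entirely. The partial sum of [B]
    up to [M] thus differs from [S] only through rows beyond [M], that is by at most a tail of
    [T]. *)
Lemma cseries_triangle (a : nat -> nat -> C) (B : nat -> C) (T : nat -> R) (S : C) :
  (forall k m, (k < m)%nat -> a k m = 0) ->
  (forall k, sum_f_R0 (fun m => Cmod (a k m)) k <= T k) -> ex_series T ->
  (forall m, cseries (fun k => a k m) (B m)) ->
  cseries (fun k => csum (a k) k) S ->
  cseries B S.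
Proof.
  intros Hz HT [lT HlT] HB HS.
  apply is_lim_seq_le_le with (u := fun _ => 0) (w := fun M => lT - sum_n T M);
    [|apply is_lim_seq_const|now apply tail_lim].
  intros M; split; [apply Cmod_ge_0|].
  refine (cseries_Cmod_le (fun k => (csum (a k) M + (-1) * csum (a k) k)%C) _ _ _ _
    (is_series_tail T lT M HlT) _).
  - intros k. destruct (k <=? M)%nat eqn:E.
    + apply Nat.leb_le in E.
      rewrite (csum_finite_support (a k) k M) by auto.
      replace (csum (a k) k + -1 * csum (a k) k)%C with (RtoC 0) by ring.
      rewrite Cmod_0; lra.
    + apply Nat.leb_gt in E. eapply Rle_trans; [|apply HT].
      set (h := fun m => if (m <=? M)%nat then RtoC 0 else a k m).
      replace (csum (a k) M + -1 * csum (a k) k)%C with (- csum h k)%C.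
      * rewrite Cmod_opp. eapply Rle_trans; [apply Cmod_csum|].
        apply sum_Rle; intros m _. unfold h. destruct (m <=? M)%nat; [|lra].
        rewrite Cmod_0; apply Cmod_ge_0.
      * set (g := fun m => if (m <=? M)%nat then a k m else RtoC 0).
        rewrite (csum_ext (a k) g M).
        -- rewrite <- (csum_finite_support g M k) by
             (intros; try lia; unfold g; now rewrite (proj2 (Nat.leb_gt _ M))).
           rewrite (csum_ext (a k) (fun m => (g m + h m)%C) k), csum_plus; [ring|].
           intros i _. unfold g, h. destruct (i <=? M)%nat; ring.
        -- intros i Hi. unfold g. now rewrite (proj2 (Nat.leb_le i M)).
  - replace (csum B M - S)%C with (csum B M + (-1) * S)%C by ring.
    apply cseries_plus; [|now apply cseries_scal].
    now apply (cseries_csum (fun m k => a k m)).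
Qed.

Lemma cseries_RtoC (a : nat -> R) (l : R) :
  is_series a l -> cseries (fun k => RtoC (a k)) (RtoC l).
Proof.
  intros H. unfold cseries.
  apply (is_lim_seq_ext (fun n => Rabs (sum_n a n - l))).
  - intros n. rewrite <- Cmod_R, RtoC_minus. do 2 f_equal.
    induction n as [|n IH]; simpl; [now rewrite sum_O|].
    rewrite sum_Sn. unfold plus; simpl. rewrite RtoC_plus. now rewrite IH.
  - replace (Finite 0) with (Finite (Rabs (l - l))) by (rewrite Rminus_diag, Rabs_R0; easy).
    apply (is_lim_seq_abs _ (l - l)). apply is_lim_seq_minus'; [exact H|apply is_lim_seq_const].
Qed.

Lemma is_series_shift (f : nat -> R) (m : nat) (l : R) :
  (forall k, (k < m)%nat -> f k = 0) -> is_series (fun p => f (m + p)%nat) l ->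
  is_series f l.
Proof.
  revert f; induction m as [|m IH]; intros f H0 H; [exact H|].
  apply is_series_decr_1. rewrite H0 by lia.
  match goal with |- is_series _ ?x =>
    replace x with l by (unfold plus, opp; simpl; ring) end.
  apply IH; [intros; apply H0; lia|exact H].
Qed.

Lemma binom_hockey_stick (m p : nat) :
  sum_f_R0 (fun i => INR (binom (m + i) m)) p = INR (binom (S m + p) (S m)).
Proof.
  induction p as [|p IH].
  - simpl sum_f_R0. now rewrite !Nat.add_0_r, !binom_diag.
  - simpl sum_f_R0. rewrite IH, <- plus_INR. f_equal.
    replace (S m + S p)%nat with (S (m + S p)) by lia. simpl binom.
    replace (m + S p)%nat with (S (m + p)) by lia. simpl; lia.
Qed.

(** Multiplying by one more geometric series turns the coefficients into their partial sums, given
    by the hockey-stick identity. *)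
Lemma is_series_neg_binomial (m : nat) (x : R) : 0 <= x < 1 ->
  is_series (fun p => INR (binom (m + p) m) * x ^ p) (/ (1 - x) ^ (m + 1)).
Proof.
  intros Hx. induction m as [|m IH].
  - replace (/ (1 - x) ^ (0 + 1)) with (/ (1 - x)) by (f_equal; simpl; ring).
    apply (is_series_ext (fun n => x ^ n)).
    { intros n. rewrite binom_0_r. simpl; ring. }
    apply is_series_geom. rewrite Rabs_pos_eq; lra.
  - replace (/ (1 - x) ^ (S m + 1)) with (/ (1 - x) ^ (m + 1) * / (1 - x))
      by (simpl; field; repeat split; try apply pow_nonzero; lra).
    assert (G : is_series (fun n => x ^ n) (/ (1 - x)))
      by (apply is_series_geom; rewrite Rabs_pos_eq; lra).
    eapply is_series_ext; [|apply (is_series_mult_pos _ _ _ _ IH G)].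
    + intros p; cbv beta. rewrite <- (binom_hockey_stick m p), Rmult_comm, scal_sum.
      apply sum_eq; intros i Hi. rewrite Rmult_assoc, <- pow_add.
      do 2 f_equal. lia.
    + intros n. apply Rmult_le_pos; [apply pos_INR|apply pow_le; lra].
    + intros n. apply pow_le; lra.
Qed.

(** The column sums of the Euler transform: every term of the original series is recovered with
    weight exactly one. *)
Lemma is_series_binom_half (j : nat) :
  is_series (fun k => (1 / 2) ^ (k + 1) * INR (binom k j)) 1.
Proof.
  apply (is_series_shift _ j); [intros k Hk; rewrite binom_gt by lia; simpl; ring|].
  evar_last.
  - apply (is_series_ext (fun p => scal ((1 / 2) ^ (j + 1)) (INR (binom (j + p) j) * (1 / 2) ^ p))).
    + intros p. unfold scal; simpl; unfold mult; simpl.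
      rewrite !pow_add. ring.
    + apply (is_series_scal (V := R_NormedModule)). apply is_series_neg_binomial; lra.
  - unfold scal; simpl; unfold mult; simpl. replace (1 - 1 / 2) with (1 / 2) by field.
    apply Rinv_r. apply pow_nonzero; lra.
Qed.

Lemma ex_series_poly_geom (N : nat) (c : R) :
  ex_series (fun k => c * (INR (k + 1) ^ N * (1 / 2) ^ (k + 1))).
Proof.
  (* Since [e * (k+1) <= 1 + k * e <= exp (k * e)] and [N * e <= 1/2], the power [(k+1)^N] is at
     most a constant times [exp (1/2) ^ k], and [exp (1/2) < 2]. *)
  set (e := / (2 * INR (N + 1))).
  assert (HN : 1 <= INR (N + 1)) by (rewrite plus_INR; simpl; pose proof (pos_INR N); lra).
  assert (He : 0 < e <= 1).
  { unfold e; split; [apply Rinv_0_lt_compat; lra|].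
    rewrite <- Rinv_1. apply Rinv_le_contravar; lra. }
  assert (Hq : exp (1 / 2) < 2).
  { assert (exp (1 / 2) * exp (1 / 2) <= 3).
    { rewrite <- exp_plus. replace (1 / 2 + 1 / 2) with 1 by field. apply exp_le_3. }
    pose proof (exp_pos (1 / 2)). nra. }
  assert (Hb : forall k, INR (k + 1) ^ N <= (/ e) ^ N * exp (1 / 2) ^ k).
  { intros k.
    assert (H1 : INR (k + 1) <= / e * exp (INR k * e)).
    { pose proof (exp_ineq1_le (INR k * e)). rewrite plus_INR. simpl.
      apply Rmult_le_reg_l with e; [lra|]. rewrite <- Rmult_assoc, Rinv_r, Rmult_1_l by lra.
      pose proof (pos_INR k). nra. }
    apply Rle_trans with ((/ e * exp (INR k * e)) ^ N).
    { apply pow_incr; split; [apply pos_INR|auto]. }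
    rewrite Rpow_mult_distr. apply Rmult_le_compat_l.
    { apply pow_le, Rlt_le, Rinv_0_lt_compat; lra. }
    rewrite <- !Rpower_pow by apply exp_pos. unfold Rpower. rewrite !ln_exp.
    apply exp_nondecreasing.
    assert (INR N * e <= 1 / 2).
    { unfold e. apply Rmult_le_reg_r with (2 * INR (N + 1)); [lra|].
      rewrite Rmult_assoc, Rinv_l by lra. rewrite plus_INR. simpl. lra. }
    pose proof (pos_INR k). nra. }
  apply (ex_series_le (V := R_CompleteNormedModule) _
    (fun k => Rabs c * (/ e) ^ N * (exp (1 / 2) / 2) ^ k)).
  - intros k. unfold norm; simpl; unfold abs; simpl.
    rewrite Rabs_mult, Rmult_assoc. apply Rmult_le_compat_l; [apply Rabs_pos|].
    assert (0 < (1 / 2) ^ k) by (apply pow_lt; lra).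
    rewrite Rabs_pos_eq.
    + rewrite pow_add, pow_1. unfold Rdiv at 3. rewrite Rpow_mult_distr.
      replace (/ 2) with (1 / 2) by field.
      specialize (Hb k). assert (0 <= INR (k + 1) ^ N) by (apply pow_le, pos_INR). nra.
    + apply Rmult_le_pos; [apply pow_le, pos_INR|apply pow_le; lra].
  - apply (ex_series_scal (V := R_NormedModule)). exists (/ (1 - exp (1 / 2) / 2)).
    apply is_series_geom. pose proof (exp_pos (1 / 2)). rewrite Rabs_pos_eq; lra.
Qed.

(** * The Euler transform of the eta series *)

Definition euler_term (z : C) (k : nat) : C :=
  (RtoC ((1 / 2) ^ (k + 1)) * adiff k 0 (npow z))%C.

Lemma exists_nat_ge (x : R) : exists N, x <= INR N.
Proof.
  destruct (nfloor_ex (Rmax x 0) (Rmax_r _ _)) as [n [_ Hn]].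
  exists (S n). rewrite S_INR. pose proof (Rmax_l x 0). lra.
Qed.

Lemma Cmod_euler_term_le (z : C) (N k : nat) : 2 * Cmod z <= INR N ->
  Cmod (euler_term z k) <= 2 * (INR (k + 1) ^ N * (1 / 2) ^ (k + 1)).
Proof.
  intros HN. unfold euler_term. rewrite Cmod_mult, Cmod_R.
  rewrite Rabs_pos_eq by (apply pow_le; lra).
  pose proof (Cmod_adiff_npow_poly k N z HN).
  assert (0 < (1 / 2) ^ (k + 1)) by (apply pow_lt; lra). nra.
Qed.

Lemma ex_cseries_euler (z : C) : exists l, cseries (euler_term z) l.
Proof.
  destruct (exists_nat_ge (2 * Cmod z)) as [N HN].
  apply (ex_cseries_abs _ (fun k => 2 * (INR (k + 1) ^ N * (1 / 2) ^ (k + 1)))).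
  - intros; now apply Cmod_euler_term_le.
  - apply ex_series_poly_geom.
Qed.

Lemma holomorphic_adiff_npow (p m : nat) : holomorphic (fun z => adiff p m (npow z)).
Proof.
  revert m; induction p as [|p IH]; intros m; simpl.
  - unfold npow, cpow.
    apply (holomorphic_comp cexp (fun z => (- z * RtoC (ln (INR (m + 1))))%C) holomorphic_cexp).
    apply (holomorphic_ext (fun z => (z * RtoC (- ln (INR (m + 1))))%C)).
    + intros z. rewrite RtoC_opp. ring.
    + apply holomorphic_mult; [apply holomorphic_id|apply holomorphic_const].
  - apply (holomorphic_ext (fun z => (adiff p m (npow z) + (-1) * adiff p (S m) (npow z))%C)).
    + intros z; ring.
    + apply holomorphic_plus; auto. apply holomorphic_mult; auto using holomorphic_const.
Qed.

Lemma ex_series_telescope : ex_series (fun k => 4 / (INR (k + 1) * INR (k + 2))).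
Proof.
  exists 4. change (is_lim_seq (sum_n (fun k => 4 / (INR (k + 1) * INR (k + 2)))) 4).
  apply (is_lim_seq_ext (fun n => 4 - 4 * / INR (n + 2))).
  - intros n. induction n as [|n IH].
    + rewrite sum_O. simpl. field.
    + rewrite sum_Sn, <- IH. unfold plus; simpl plus.
      replace (S n + 1)%nat with (n + 2)%nat by lia.
      replace (S n + 2)%nat with (S (n + 2)) by lia.
      assert (0 < INR (n + 2)) by (apply lt_0_INR; lia).
      rewrite S_INR. simpl. field. lra.
  - replace (Finite 4) with (Finite (4 - 4 * 0)) by (f_equal; ring).
    apply is_lim_seq_minus'; [apply is_lim_seq_const|].
    apply is_lim_seq_mult'; [apply is_lim_seq_const|].
    apply (is_lim_seq_inv _ p_infty); [|easy].
    apply (is_lim_seq_incr_n INR 2). apply is_lim_seq_INR.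
Qed.

Lemma sum_binom_pow2 (n : nat) : sum_f_R0 (fun i => INR (binom n i)) n = 2 ^ n.
Proof.
  replace 2 with (1 + 1) by ring. rewrite binomial.
  apply sum_eq; intros i Hi. rewrite binom_C, !pow1 by auto. ring.
Qed.

(** Absorbing both denominators gives [C(k,j) / ((j+1)(j+2)) = C(k+2,j+2) / ((k+1)(k+2))], and the
    new binomials sum to at most [2^(k+2)]. This form of the inverse square is used because it makes
    the row sums explicit. *)
Lemma sum_binom_inv_squares_le (k : nat) :
  sum_f_R0 (fun j => INR (binom k j) * (2 / (INR (j + 1) * INR (j + 2)))) k
  <= 8 * 2 ^ k / (INR (k + 1) * INR (k + 2)).
Proof.
  assert (E : forall j, INR (binom k j) * (2 / (INR (j + 1) * INR (j + 2))) =
    INR (binom (S (S k)) (S (S j))) * (2 / (INR (k + 1) * INR (k + 2)))).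
  { intros j.
    pose proof (f_equal INR (binom_absorb k j)) as H1.
    pose proof (f_equal INR (binom_absorb (S k) (S j))) as H2.
    rewrite !mult_INR in H1, H2.
    replace (k + 1)%nat with (S k) by lia. replace (k + 2)%nat with (S (S k)) by lia.
    replace (j + 1)%nat with (S j) by lia. replace (j + 2)%nat with (S (S j)) by lia.
    assert (P1 : 0 < INR (S k)) by (apply lt_0_INR; lia).
    assert (P2 : 0 < INR (S (S k))) by (apply lt_0_INR; lia).
    assert (P3 : 0 < INR (S j)) by (apply lt_0_INR; lia).
    assert (P4 : 0 < INR (S (S j))) by (apply lt_0_INR; lia).
    set (a := INR (S k)) in *. set (b := INR (S (S k))) in *.
    set (c := INR (S j)) in *. set (d := INR (S (S j))) in *.
    set (u := INR (binom k j)) in *. set (v := INR (binom (S k) (S j))) in *.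
    set (w := INR (binom (S (S k)) (S (S j)))) in *.
    replace w with (b * v / d) by (rewrite <- H2; field; lra).
    replace v with (a * u / c) by (rewrite <- H1; field; lra).
    field. repeat split; lra. }
  rewrite (sum_eq _ _ k (fun i _ => E i)).
  rewrite <- scal_sum.
  assert (Hs : sum_f_R0 (fun j => INR (binom (S (S k)) (S (S j)))) k <= 2 ^ S (S k)).
  { rewrite <- sum_binom_pow2.
    rewrite (decomp_sum _ (S (S k))) by lia. simpl pred.
    rewrite (decomp_sum (fun i => INR (binom (S (S k)) (S i))) (S k)) by lia. simpl pred.
    pose proof (pos_INR (binom (S (S k)) 0)). pose proof (pos_INR (binom (S (S k)) 1)). lra. }
  assert (P1 : 0 < INR (k + 1)) by (apply lt_0_INR; lia).
  assert (P2 : 0 < INR (k + 2)) by (apply lt_0_INR; lia).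
  replace (8 * 2 ^ k / (INR (k + 1) * INR (k + 2))) with
    (2 / (INR (k + 1) * INR (k + 2)) * 2 ^ S (S k)) by (simpl; field; lra).
  apply Rmult_le_compat_l; auto.
  apply Rlt_le, Rdiv_lt_0_compat; nra.
Qed.

(** For [Re z >= 2] the array [2^-(k+1) C(k,j) (j+1)^-z] has absolute row sums at most
    [4 / ((k+1)(k+2))], so rows and columns may be exchanged; the column sums are the terms of the
    Dirichlet series. Any right half-plane suffices for the continuation. *)
Lemma eta_euler_right (eta : C -> C) (z : C) :
  is_dirichlet_eta eta -> 2 <= Re z -> cseries (euler_term z) (eta z).
Proof.
  intros [_ Heta] Hz.
  destruct (ex_cseries_euler z) as [l Hl].
  set (a := fun k j => (RtoC ((1 / 2) ^ (k + 1)) * (RtoC ((-1) ^ j * INR (binom k j)) * npow z j))%C).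
  assert (HB : cseries (fun n => (RtoC ((-1) ^ n) * npow z n)%C) (eta z)).
  { apply cseries_is_series. apply Heta. lra. }
  replace (eta z) with l; [exact Hl|].
  apply (cseries_unique (fun n => (RtoC ((-1) ^ n) * npow z n)%C)); [|exact HB].
  apply (cseries_triangle a _ (fun k => 4 / (INR (k + 1) * INR (k + 2)))).
  - intros k m H. unfold a. rewrite binom_gt, Rmult_0_r by auto. ring.
  - intros k.
    apply Rle_trans with ((1 / 2) ^ (k + 1) *
      sum_f_R0 (fun j => INR (binom k j) * (2 / (INR (j + 1) * INR (j + 2)))) k).
    + rewrite scal_sum. apply sum_Rle; intros j Hj. unfold a.
      rewrite !Cmod_mult, !Cmod_R, Rabs_mult, pow_1_abs, Rmult_1_l.
      rewrite (Rabs_pos_eq (INR _)) by apply pos_INR.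
      rewrite Rabs_pos_eq by (apply pow_le; lra).
      rewrite Rmult_comm. apply Rmult_le_compat_r; [apply pow_le; lra|].
      apply Rmult_le_compat_l; [apply pos_INR|].
      unfold npow. rewrite Cmod_cpow.
      assert (Hj1 : 1 <= INR (j + 1)) by (rewrite plus_INR; simpl; pose proof (pos_INR j); lra).
      apply Rle_trans with (exp (- (2 * ln (INR (j + 1))))).
      { apply exp_nondecreasing. simpl.
        assert (0 <= ln (INR (j + 1))) by (rewrite <- ln_1; apply Rcomplements.ln_le; lra).
        unfold Re in Hz. nra. }
      rewrite exp_Ropp.
      replace (exp (2 * ln (INR (j + 1)))) with (INR (j + 1) ^ 2)
        by (rewrite <- (Rpower_pow 2) by lra; reflexivity).
      replace (INR (j + 2)) with (INR (j + 1) + 1) by (rewrite !plus_INR; simpl; ring).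
      set (t := INR (j + 1)) in *.
      apply Rmult_le_reg_r with (t ^ 2 * (t * (t + 1))); [nra|].
      replace (/ t ^ 2 * (t ^ 2 * (t * (t + 1)))) with (t * (t + 1)) by (field; lra).
      replace (2 / (t * (t + 1)) * (t ^ 2 * (t * (t + 1)))) with (2 * t ^ 2) by (field; lra).
      nra.
    + assert (0 < (1 / 2) ^ (k + 1)) by (apply pow_lt; lra).
      eapply Rle_trans; [apply Rmult_le_compat_l; [lra|apply sum_binom_inv_squares_le]|].
      apply Req_le. rewrite pow_add, pow_1. unfold Rdiv at 1. rewrite Rpow_mult_distr, pow1, pow_inv.
      assert (P1 : 0 < INR (k + 1)) by (apply lt_0_INR; lia).
      assert (P2 : 0 < INR (k + 2)) by (apply lt_0_INR; lia).
      assert (2 ^ k <> 0) by (apply pow_nonzero; lra).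
      field. repeat split; lra.
  - apply ex_series_telescope.
  - intros m.
    apply (cseries_ext (fun k => (RtoC ((-1) ^ m) * npow z m *
      RtoC ((1 / 2) ^ (k + 1) * INR (binom k m)))%C)).
    + intros k; unfold a. rewrite !RtoC_mult. ring.
    + evar_last; [apply cseries_scal, cseries_RtoC, is_series_binom_half|ring].
  - apply (cseries_ext (euler_term z)); auto.
    intros k. unfold euler_term, a. rewrite csum_scal, adiff_binom_sum. easy.
Qed.

Theorem eta_euler (eta : C -> C) (z : C) :
  is_dirichlet_eta eta -> cseries (euler_term z) (eta z).
Proof.
  intros Heta.
  set (eta0 := fun z => proj1_sig (constructive_indefinite_description _ (ex_cseries_euler z))).
  assert (H0 : forall z, cseries (euler_term z) (eta0 z)).
  { intros w; unfold eta0. now destruct (constructive_indefinite_description _ _). }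
  set (D := fun z => (eta z - eta0 z)%C).
  assert (HD : forall z, D z = 0).
  { apply (unique_continuation D (fun K z => (eta z + (-1) * csum (fun k => euler_term z k) K)%C) 2).
    - intros K. apply holomorphic_plus.
      + intros w. apply ex_derive_cderiv. apply Heta.
      + apply holomorphic_mult; [apply holomorphic_const|].
        apply holomorphic_csum; intros k. unfold euler_term.
        apply holomorphic_mult; [apply holomorphic_const|apply holomorphic_adiff_npow].
    (* One exponent [N] serves the whole disc of radius [r], which makes the convergence uniform
       there. *)
    - intros r eps He. destruct (exists_nat_ge (2 * r)) as [N HN].
      destruct (ex_series_poly_geom N 2) as [S HS].
      pose proof (tail_lim _ _ HS) as HT. apply is_lim_seq_spec in HT.
      destruct (HT (mkposreal eps He)) as [K HK]. exists K. intros w Hw.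
      specialize (HK K (Nat.le_refl K)). simpl in HK. rewrite Rminus_0_r in HK.
      change (fun k => euler_term w k) with (euler_term w).
      replace (eta w + -1 * csum (euler_term w) K - D w)%C with
        (eta0 w - csum (euler_term w) K)%C by (unfold D; ring).
      eapply Rle_trans; [apply (cseries_tail_le _ _ _ _ K (fun n => Cmod_euler_term_le w N n ltac:(lra)) HS (H0 w))|].
      eapply Rle_trans; [apply Rle_abs|]. lra.
    - intros w Hw. unfold D.
      rewrite (cseries_unique _ _ _ (H0 w) (eta_euler_right eta w Heta Hw)). ring. }
  specialize (HD z). unfold D in HD.
  replace (eta z) with (eta0 z); auto.
  replace (eta z) with ((eta z - eta0 z) + eta0 z)%C by ring. rewrite HD. ring.
Qed.

(** * The Stirling coefficients *)

Lemma stirling1_gt (n k : nat) : (n < k)%nat -> stirling1 n k = 0%Z.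
Proof.
  revert k; induction n as [|n IH]; intros [|k] H; try lia; simpl; auto.
  rewrite !IH by lia. lia.
Qed.

Lemma binom_mult_sub (n m : nat) :
  INR (S m) * INR (binom n (S m)) = (INR n - INR m) * INR (binom n m).
Proof.
  pose proof (f_equal INR (binom_absorb n m)) as H.
  rewrite !mult_INR in H. simpl binom in H. rewrite plus_INR in H.
  rewrite !S_INR in *. lra.
Qed.

(** At [x = n + 1] the product [x(x-1)...(x-m)] divided by [x] is [n(n-1)...(n-m+1)]. The division
    is an index shift, because [s(m+1,0) = 0]. *)
Lemma stirling1_falling (m n : nat) :
  sum_f_R0 (fun i => IZR (stirling1 (S m) (S i)) * INR (n + 1) ^ i) m =
  INR (fact m) * INR (binom n m).
Proof.
  set (x := INR (n + 1)).
  induction m as [|m IH].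
  - rewrite binom_0_r. simpl. ring.
  - set (f := fun i => IZR (stirling1 (S m) i) * x ^ i).
    assert (E : sum_f_R0 (fun i => IZR (stirling1 (S (S m)) (S i)) * x ^ i) (S m) =
      sum_f_R0 f (S m) - INR (S m) * sum_f_R0 (fun i => IZR (stirling1 (S m) (S i)) * x ^ i) (S m)).
    { rewrite scal_sum, <- minus_sum. apply sum_eq; intros i _. unfold f.
      change (stirling1 (S (S m)) (S i)) with
        (stirling1 (S m) i - Z.of_nat (S m) * stirling1 (S m) (S i))%Z.
      rewrite minus_IZR, mult_IZR, <- INR_IZR_INZ. ring. }
    rewrite E, (tech5 (fun i => IZR (stirling1 (S m) (S i)) * x ^ i) m).
    rewrite (stirling1_gt (S m) (S (S m))) by lia.
    rewrite IH. rewrite (decomp_sum f) by lia. simpl pred.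
    replace (sum_f_R0 (fun i => f (S i)) m) with (x * (INR (fact m) * INR (binom n m))).
    + unfold f at 1. change (stirling1 (S m) 0) with 0%Z.
      rewrite fact_simpl, mult_INR.
      replace (INR (S m) * INR (fact m) * INR (binom n (S m))) with
        (INR (fact m) * (INR (S m) * INR (binom n (S m)))) by ring.
      rewrite binom_mult_sub, S_INR.
      assert (Hx : x = INR n + 1) by (unfold x; rewrite plus_INR; reflexivity).
      rewrite Hx. ring.
    + rewrite <- IH, scal_sum. apply sum_eq; intros i _. unfold f. simpl. ring.
Qed.

Lemma npow_plus (s t : C) (n : nat) : npow (s + t) n = (npow s n * npow t n)%C.
Proof.
  unfold npow. replace (- (s + t))%C with (- s + - t)%C by ring. apply cpow_plus.
Qed.

Lemma npow_sub_nat (s : C) (i n : nat) :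
  npow (s - RtoC (INR i)) n = (RtoC (INR (n + 1) ^ i) * npow s n)%C.
Proof.
  unfold npow. replace (- (s - RtoC (INR i)))%C with (RtoC (INR i) + - s)%C by ring.
  rewrite cpow_plus, cpow_INR; auto. apply lt_0_INR; lia.
Qed.

Lemma csum_RtoC (f : nat -> R) (n : nat) :
  csum (fun i => RtoC (f i)) n = RtoC (sum_f_R0 f n).
Proof. induction n as [|n IH]; simpl; [easy|]. now rewrite IH, RtoC_plus. Qed.

Definition stirling_coef (eta : C -> C) (m : nat) (s0 : C) : C :=
  (RtoC ((-1) ^ m / INR (fact m)) *
   csum (fun i : nat => let l := (i + 1)%nat in
     Cmult (RtoC (IZR (stirling1 (m + 1) l)))
       (eta (Cminus (Cplus s0 1) (RtoC (INR l))))) m)%C.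

(** With [l = i + 1] the values of [eta] are taken at [s0 - i], whose Euler transforms contain
    [(n+1)^i (n+1)^-s0]. The Stirling numbers combine the powers [(n+1)^i] into [m! C(n,m)], a
    factor that lowers the order of the differences by [m]; its sign cancels [(-1)^m]. *)
Lemma stirling_coef_series (eta : C -> C) (m : nat) (s0 : C) :
  is_dirichlet_eta eta ->
  cseries (fun k => (RtoC ((1 / 2) ^ (k + 1)) *
    (RtoC (INR (binom k m)) * adiff (k - m) m (npow s0)))%C) (stirling_coef eta m s0).
Proof.
  intros Heta. unfold stirling_coef.
  apply (cseries_ext (fun k => (RtoC ((-1) ^ m / INR (fact m)) *
    csum (fun i => (RtoC (IZR (stirling1 (m + 1) (i + 1))) * euler_term (s0 - RtoC (INR i)) k)%C) m)%C)).
  - intros k. unfold euler_term.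
    rewrite (csum_ext _ (fun i => (RtoC ((1 / 2) ^ (k + 1)) *
      adiff k 0 (fun n => (RtoC (IZR (stirling1 (S m) (S i)) * INR (n + 1) ^ i) * npow s0 n)%C))%C)).
    + rewrite csum_scal, <- adiff_csum.
      rewrite (adiff_ext _ _ _ (fun n => (RtoC (INR (fact m)) * (RtoC (INR (binom n m)) * npow s0 n))%C)).
      * rewrite adiff_scal, adiff_binom_mult.
        assert (Hf : INR (fact m) <> 0) by apply INR_fact_neq_0.
        assert (Hs : (-1) ^ m * (-1) ^ m = 1).
        { rewrite <- Rpow_mult_distr. replace (-1 * -1) with 1 by ring. apply pow1. }
        transitivity (RtoC ((-1) ^ m / INR (fact m) * ((1 / 2) ^ (k + 1) * (INR (fact m) *
          ((-1) ^ m * INR (binom k m))))) * adiff (k - m) m (npow s0))%C.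
        { rewrite !RtoC_mult. ring. }
        replace ((-1) ^ m / INR (fact m) * ((1 / 2) ^ (k + 1) * (INR (fact m) * ((-1) ^ m * INR (binom k m)))))
          with ((-1) ^ m * (-1) ^ m * ((1 / 2) ^ (k + 1) * INR (binom k m))) by (field; auto).
        rewrite Hs, Rmult_1_l, RtoC_mult. ring.
      * intros n.
        rewrite (csum_ext _ (fun i => (npow s0 n * RtoC (IZR (stirling1 (S m) (S i)) * INR (n + 1) ^ i))%C))
          by (intros; ring).
        rewrite csum_scal, csum_RtoC, stirling1_falling, RtoC_mult. ring.
    + intros i _. rewrite !Nat.add_1_r.
      rewrite (adiff_ext k 0 (npow (s0 - RtoC (INR i))) _ (npow_sub_nat s0 i)).
      rewrite (adiff_ext k 0 (fun n => (RtoC (IZR (stirling1 (S m) (S i)) * INR (n + 1) ^ i) * npow s0 n)%C)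
        (fun n => (RtoC (IZR (stirling1 (S m) (S i))) * (RtoC (INR (n + 1) ^ i) * npow s0 n))%C))
        by (intros; rewrite RtoC_mult; ring).
      rewrite adiff_scal. ring.
  - apply cseries_scal.
    apply (cseries_csum (fun i k => (RtoC (IZR (stirling1 (m + 1) (i + 1))) * euler_term (s0 - RtoC (INR i)) k)%C)).
    intros i _. apply cseries_scal.
    replace (s0 + 1 - RtoC (INR (i + 1)))%C with (s0 - RtoC (INR i))%C
      by (rewrite plus_INR, RtoC_plus; simpl; ring).
    now apply eta_euler.
Qed.

Theorem eta_stirling_series (eta : C -> C) (s s0 : C) :
  is_dirichlet_eta eta ->
  cseries (fun m => (stirling_coef eta m s0 * alt_binom_sum m s)%C) (eta (s + s0)%C).
Proof.
  intros Heta.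
  destruct (exists_nat_ge (2 * Cmod s)) as [N HN].
  destruct (exists_nat_ge (2 * Cmod s0)) as [N0 HN0].
  set (a := fun k m => (RtoC ((1 / 2) ^ (k + 1)) *
    (RtoC (INR (binom k m)) * adiff (k - m) m (npow s0)) * adiff m 0 (npow s))%C).
  (* One factor [2 (k+1)^N] bounds the differences of [s], of order [m <= k]; the other,
     [2 (k+1)^N0], bounds the binomially weighted sum of those of [s0]. *)
  apply (cseries_triangle a _ (fun k => 4 * (INR (k + 1) ^ (N0 + N) * (1 / 2) ^ (k + 1)))).
  - intros k m H. unfold a. rewrite binom_gt by auto. simpl. ring.
  - intros k.
    assert (Hp : 0 < (1 / 2) ^ (k + 1)) by (apply pow_lt; lra).
    apply Rle_trans with ((1 / 2) ^ (k + 1) * (2 * INR (k + 1) ^ N) *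
      sum_f_R0 (fun m => INR (binom k m) * Cmod (adiff (k - m) m (npow s0))) k).
    + rewrite scal_sum. apply sum_Rle; intros m Hm. unfold a.
      rewrite !Cmod_mult, !Cmod_R, (Rabs_pos_eq (INR _)) by apply pos_INR.
      rewrite Rabs_pos_eq by lra.
      rewrite (Rmult_comm (INR _ * _)), !Rmult_assoc. apply Rmult_le_compat_l; [lra|].
      rewrite <- !Rmult_assoc. rewrite (Rmult_comm _ (Cmod (adiff m 0 _))), !Rmult_assoc.
      rewrite <- (Rmult_assoc 2).
      apply Rmult_le_compat_r; [apply Rmult_le_pos; [apply pos_INR|apply Cmod_ge_0]|].
      eapply Rle_trans; [apply (Cmod_adiff_npow_poly m N s HN)|].
      apply Rmult_le_compat_l; [lra|]. apply pow_incr. split; [apply pos_INR|].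
      apply le_INR; lia.
    + eapply Rle_trans; [apply Rmult_le_compat_l; [|apply (sum_Cmod_adiff_npow_le k N0 s0 HN0)]|].
      * apply Rmult_le_pos; [lra|]. apply Rmult_le_pos; [lra|apply pow_le, pos_INR].
      * apply Req_le. rewrite (pow_add _ N0 N). ring.
  - apply ex_series_poly_geom.
  - intros m. rewrite alt_binom_sum_adiff, Cmult_comm.
    eapply cseries_ext; [|apply cseries_scal, (stirling_coef_series eta m s0 Heta)].
    intros k. unfold a. ring.
  - apply (cseries_ext (euler_term (s + s0))); [|now apply eta_euler].
    intros k. unfold euler_term, a.
    rewrite (adiff_ext _ _ _ _ (npow_plus s s0)), adiff_mult, <- csum_scal.
    apply csum_ext; intros i _. ring.
Qed.

(** * Integrals over the half-line and the Gamma function *)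

(** Restricted to [x > 0], where [ln], and hence [cpow], has its proper meaning. *)
Definition pos_continuous (f : R -> C) : Prop :=
  forall x, 0 < x -> @continuous R_UniformSpace C_R_NormedModule f x.

Lemma pos_continuous_is_RInt (f : R -> C) (a b : R) :
  pos_continuous f -> 0 < a -> 0 < b -> @is_RInt C_R_NormedModule f a b (CInt f a b).
Proof.
  intros Hf Ha Hb. apply (RInt_correct (V := C_R_CompleteNormedModule)).
  apply (ex_RInt_continuous (V := C_R_CompleteNormedModule)).
  intros x [Hx _]. apply Hf. eapply Rlt_le_trans; [|exact Hx]. now apply Rmin_glb_lt.
Qed.

Lemma CInt_is_RInt (f : R -> C) (a b : R) (l : C) :
  @is_RInt C_R_NormedModule f a b l -> CInt f a b = l.
Proof. apply (is_RInt_unique (V := C_R_CompleteNormedModule)). Qed.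

Lemma is_RInt_Cmult (c : C) (f : R -> C) (a b : R) (l : C) :
  @is_RInt C_R_NormedModule f a b l ->
  @is_RInt C_R_NormedModule (fun x => (c * f x)%C) a b (c * l)%C.
Proof.
  intros H.
  assert (H1 := is_RInt_fct_extend_fst (U := R_NormedModule) (V := R_NormedModule) f a b l H).
  assert (H2 := is_RInt_fct_extend_snd (U := R_NormedModule) (V := R_NormedModule) f a b l H).
  apply (is_RInt_fct_extend_pair (U := R_NormedModule) (V := R_NormedModule)); simpl.
  - apply (is_RInt_minus (V := R_NormedModule)); now apply (is_RInt_scal (V := R_NormedModule)).
  - apply (is_RInt_plus (V := R_NormedModule)); now apply (is_RInt_scal (V := R_NormedModule)).
Qed.

Lemma continuous_C_pair (f : R -> C) (x : R) :
  continuous (fun t => Re (f t)) x -> continuous (fun t => Im (f t)) x ->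
  @continuous R_UniformSpace C_R_NormedModule f x.
Proof.
  intros H1 H2. apply filterlim_locally; intros eps.
  assert (L1 := proj1 (filterlim_locally _ _) H1 eps).
  assert (L2 := proj1 (filterlim_locally _ _) H2 eps).
  generalize (filter_and _ _ L1 L2). apply filter_imp.
  intros t [A B]; split; assumption.
Qed.

Lemma continuous_C_Re (f : R -> C) (x : R) :
  @continuous R_UniformSpace C_R_NormedModule f x -> continuous (fun t => Re (f t)) x.
Proof.
  intros H. apply filterlim_locally; intros eps.
  generalize (proj1 (filterlim_locally _ _) H eps). apply filter_imp.
  intros t [A _]; exact A.
Qed.

Lemma continuous_C_Im (f : R -> C) (x : R) :
  @continuous R_UniformSpace C_R_NormedModule f x -> continuous (fun t => Im (f t)) x.
Proof.
  intros H. apply filterlim_locally; intros eps.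
  generalize (proj1 (filterlim_locally _ _) H eps). apply filter_imp.
  intros t [_ A]; exact A.
Qed.

Lemma pos_continuous_plus (f g : R -> C) :
  pos_continuous f -> pos_continuous g -> pos_continuous (fun x => (f x + g x)%C).
Proof.
  intros Hf Hg x Hx. apply (continuous_plus (V := C_R_NormedModule)); auto.
Qed.

Lemma pos_continuous_scal (c : C) (f : R -> C) :
  pos_continuous f -> pos_continuous (fun x => (c * f x)%C).
Proof.
  intros Hf x Hx. specialize (Hf x Hx).
  assert (H1 := continuous_C_Re f x Hf). assert (H2 := continuous_C_Im f x Hf).
  apply continuous_C_pair; simpl.
  - apply (continuous_minus (V := R_NormedModule)); apply (continuous_scal_r (V := R_NormedModule)); assumption.
  - apply (continuous_plus (V := R_NormedModule)); apply (continuous_scal_r (V := R_NormedModule)); assumption.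
Qed.

(** The improper integral with both ends controlled at once. Continuity is included because [CInt]
    is a total function, meaningful only where the integral exists; [0 < b] is asked separately
    since [B] may be negative. *)
Definition halfline_int (f : R -> C) (l : C) : Prop :=
  pos_continuous f /\
  forall eps, 0 < eps -> exists d B, 0 < d /\ forall a b, 0 < a < d -> B < b ->
    0 < b -> Cmod (CInt f a b - l) <= eps.

Lemma halfline_int_RInt_gen (f : R -> C) (l : C) : halfline_int f l ->
  @RInt_gen C_R_CompleteNormedModule f (at_right 0) (Rbar_locally p_infty) = l.
Proof.
  intros [Hc H].
  apply (is_RInt_gen_unique (V := C_R_CompleteNormedModule)).
  apply filterlimi_locally; intros eps.
  destruct (H (eps / 2) ltac:(destruct eps; simpl; lra)) as [d [B [Hd HB]]].
  apply (Filter_prod _ _ _ (fun a => 0 < a < d) (fun b => Rmax B 0 < b)).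
  - exists (mkposreal d Hd). intros y Hy Hy0. split; auto.
    change (Rabs (y - 0) < d) in Hy. rewrite Rminus_0_r, Rabs_pos_eq in Hy; lra.
  - exists (Rmax B 0). auto.
  - intros a b Ha Hb. pose proof (Rmax_l B 0). pose proof (Rmax_r B 0). simpl.
    exists (CInt f a b). split.
    + apply pos_continuous_is_RInt; auto; lra.
    + apply C_NormedModule_mixin_compat1.
      eapply Rle_lt_trans; [apply HB; lra|]. destruct eps; simpl; lra.
Qed.

Lemma halfline_int_unique (f : R -> C) (l l' : C) :
  halfline_int f l -> halfline_int f l' -> l = l'.
Proof.
  intros H H'.
  now rewrite <- (halfline_int_RInt_gen f l H), <- (halfline_int_RInt_gen f l' H').
Qed.

Lemma halfline_int_plus (f g : R -> C) (l m : C) :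
  halfline_int f l -> halfline_int g m -> halfline_int (fun x => (f x + g x)%C) (l + m)%C.
Proof.
  intros [Hf H1] [Hg H2]; split; [now apply pos_continuous_plus|].
  intros eps He.
  destruct (H1 (eps / 2) ltac:(lra)) as [d1 [B1 [Hd1 HB1]]].
  destruct (H2 (eps / 2) ltac:(lra)) as [d2 [B2 [Hd2 HB2]]].
  exists (Rmin d1 d2), (Rmax B1 B2). split; [now apply Rmin_glb_lt|].
  intros a b Ha Hb Hb0. pose proof (Rmin_l d1 d2). pose proof (Rmin_r d1 d2).
  pose proof (Rmax_l B1 B2). pose proof (Rmax_r B1 B2).
  rewrite (CInt_is_RInt _ a b (CInt f a b + CInt g a b)%C).
  - replace (CInt f a b + CInt g a b - (l + m))%C with ((CInt f a b - l) + (CInt g a b - m))%C by ring.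
    eapply Rle_trans; [apply Cmod_triangle|].
    specialize (HB1 a b ltac:(lra) ltac:(lra) Hb0).
    specialize (HB2 a b ltac:(lra) ltac:(lra) Hb0). lra.
  - apply (is_RInt_plus (V := C_R_NormedModule)); apply pos_continuous_is_RInt; auto; lra.
Qed.

Lemma halfline_int_scal (c : C) (f : R -> C) (l : C) :
  halfline_int f l -> halfline_int (fun x => (c * f x)%C) (c * l)%C.
Proof.
  intros [Hf H1]; split; [now apply pos_continuous_scal|].
  intros eps He.
  pose proof (Cmod_ge_0 c) as Hc.
  destruct (H1 (eps / (Cmod c + 1)) ltac:(apply Rdiv_lt_0_compat; lra)) as [d [B [Hd HB]]].
  exists d, B. split; auto. intros a b Ha Hb Hb0.
  rewrite (CInt_is_RInt _ a b (c * CInt f a b)%C).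
  - replace (c * CInt f a b - c * l)%C with (c * (CInt f a b - l))%C by ring.
    rewrite Cmod_mult. specialize (HB a b Ha Hb Hb0).
    apply Rle_trans with (Cmod c * (eps / (Cmod c + 1))); [apply Rmult_le_compat_l; auto|].
    assert (0 <= eps / (Cmod c + 1)) by (apply Rlt_le, Rdiv_lt_0_compat; lra).
    replace eps with ((Cmod c + 1) * (eps / (Cmod c + 1))) at 2 by (field; lra).
    apply Rmult_le_compat_r; lra.
  - apply is_RInt_Cmult, pos_continuous_is_RInt; auto; lra.
Qed.

Lemma pos_continuous_ext (f g : R -> C) :
  (forall x, 0 < x -> f x = g x) -> pos_continuous f -> pos_continuous g.
Proof.
  intros E Hf x Hx. apply (continuous_ext_loc (U := C_R_NormedModule) g f); [|auto].
  exists (mkposreal x Hx). intros y Hy. apply E.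
  change (Rabs (y - x) < x) in Hy. apply Rabs_def2 in Hy. lra.
Qed.

Lemma halfline_int_ext (f g : R -> C) (l : C) :
  (forall x, 0 < x -> f x = g x) -> halfline_int f l -> halfline_int g l.
Proof.
  intros E [Hf H]; split; [now apply (pos_continuous_ext f)|].
  intros eps He. destruct (H eps He) as [d [B [Hd HB]]].
  exists d, B; split; auto. intros a b Ha Hb Hb0.
  replace (CInt g a b) with (CInt f a b); [auto|].
  apply (RInt_ext (V := C_R_CompleteNormedModule)). intros x [Hx _].
  apply E. eapply Rlt_trans; [|exact Hx]. apply Rmin_glb_lt; lra.
Qed.

Lemma halfline_int_rescale (c : R) (f : R -> C) (l : C) : 0 < c ->
  halfline_int f l -> halfline_int (fun x => (RtoC c * f (c * x)%R)%C) l.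
Proof.
  intros Hc [Hf H]; split.
  - apply pos_continuous_scal. intros x Hx.
    apply (continuous_comp (fun x => c * x) f).
    + apply (ex_derive_continuous (V := R_NormedModule)). auto_derive; auto.
    + apply Hf. now apply Rmult_lt_0_compat.
  - intros eps He. destruct (H eps He) as [d [B [Hd HB]]].
    exists (d / c), (B / c). split; [now apply Rdiv_lt_0_compat|].
    intros a b Ha Hb Hb0.
    assert (Ha' : c * a < d).
    { apply Rmult_lt_reg_r with (/ c); [now apply Rinv_0_lt_compat|].
      replace (c * a * / c) with a by (field; lra). apply Ha. }
    assert (Hb' : B < c * b).
    { apply Rmult_lt_reg_r with (/ c); [now apply Rinv_0_lt_compat|].
      replace (c * b * / c) with b by (field; lra). apply Hb. }
    assert (0 < c * a) by (apply Rmult_lt_0_compat; lra).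
    assert (0 < c * b) by (apply Rmult_lt_0_compat; lra).
    rewrite (CInt_is_RInt _ a b (CInt f (c * a) (c * b))); [apply HB; lra|].
    apply (is_RInt_ext (V := C_R_NormedModule) (fun y => @scal R_AbsRing C_R_NormedModule c (f (c * y + 0)))).
    { intros x _. rewrite Rplus_0_r. apply scal_R_Cmult. }
    apply (is_RInt_comp_lin (V := C_R_NormedModule)). rewrite !Rplus_0_r.
    apply pos_continuous_is_RInt; auto.
Qed.

(** The part over [[1,2]] alone bounds the integral from below. A positive [c] yields strict
    positivity, [c = 0] plain monotonicity. *)
Lemma halfline_int_Re_ge (f : R -> C) (l : C) (c : R) :
  halfline_int f l -> (forall x, 0 < x -> 0 <= Re (f x)) ->
  (forall x, 1 <= x <= 2 -> c <= Re (f x)) -> c <= Re l.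
Proof.
  intros [Hf H] H0 H1. apply le_epsilon; intros eps He.
  destruct (H eps He) as [d [B [Hd HB]]].
  set (a := Rmin (d / 2) (1 / 2)). set (b := Rmax (B + 1) 3).
  assert (Ha : 0 < a < d /\ a < 1).
  { unfold a. pose proof (Rmin_l (d / 2) (1 / 2)). pose proof (Rmin_r (d / 2) (1 / 2)).
    assert (0 < Rmin (d / 2) (1 / 2)) by (apply Rmin_glb_lt; lra). lra. }
  assert (Hb : B < b /\ 2 < b).
  { unfold b. pose proof (Rmax_l (B + 1) 3). pose proof (Rmax_r (B + 1) 3). lra. }
  specialize (HB a b ltac:(lra) ltac:(lra) ltac:(lra)).
  assert (I := pos_continuous_is_RInt f a b Hf ltac:(lra) ltac:(lra)).
  apply (is_RInt_fct_extend_fst (U := R_NormedModule) (V := R_NormedModule)) in I.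
  set (g := fun t => Re (f t)).
  assert (Ig : forall p q, 0 < p -> 0 < q -> ex_RInt g p q).
  { intros p q Hp Hq. exists (Re (CInt f p q)).
    apply (is_RInt_fct_extend_fst (U := R_NormedModule) (V := R_NormedModule)).
    now apply pos_continuous_is_RInt. }
  apply (is_RInt_unique (V := R_CompleteNormedModule)) in I.
  assert (Hc : c <= RInt g a b).
  { rewrite <- (RInt_Chasles g a 1 b), <- (RInt_Chasles g 1 2 b) by (apply Ig; lra).
    unfold plus; simpl.
    assert (0 <= RInt g a 1) by (apply RInt_ge_0; [lra|apply Ig; lra|intros; apply H0; lra]).
    assert (0 <= RInt g 2 b) by (apply RInt_ge_0; [lra|apply Ig; lra|intros; apply H0; lra]).
    assert (RInt (fun _ => c) 1 2 <= RInt g 1 2).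
    { apply RInt_le; [lra|apply ex_RInt_const|apply Ig; lra|intros; apply H1; lra]. }
    rewrite RInt_const in H4. unfold scal in H4; simpl in H4; unfold mult in H4; simpl in H4.
    simpl in *. lra. }
  change (RInt g a b = Re (CInt f a b)) in I. rewrite I in Hc.
  pose proof (re_le_Cmod (CInt f a b - l)) as Hre.
  assert (Re (CInt f a b - l) = Re (CInt f a b) - Re l) by (unfold Re; simpl; ring).
  rewrite H2 in Hre. pose proof (Rle_abs (Re (CInt f a b) - Re l)). lra.
Qed.

(** Boundary terms that vanish at both ends; this is the integration by parts behind the functional
    equation of Gamma. *)
Lemma halfline_int_derivative (u du : R -> C) :
  pos_continuous du ->
  (forall x, 0 < x -> is_derive (fun t => Re (u t)) x (Re (du x))) ->
  (forall x, 0 < x -> is_derive (fun t => Im (u t)) x (Im (du x))) ->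
  (forall eps, 0 < eps -> exists d B, 0 < d /\
     (forall x, 0 < x < d -> Cmod (u x) <= eps) /\ (forall x, B < x -> 0 < x -> Cmod (u x) <= eps)) ->
  halfline_int du 0.
Proof.
  intros Hc HR HI HL; split; auto. intros eps He.
  destruct (HL (eps / 2) ltac:(lra)) as [d [B [Hd [H0 HB]]]].
  exists d, B. split; auto. intros a b Ha Hb Hb0.
  rewrite (CInt_is_RInt du a b (u b - u a)%C).
  - replace (u b - u a - 0)%C with (u b + - u a)%C by ring.
    eapply Rle_trans; [apply Cmod_triangle|]. rewrite Cmod_opp.
    specialize (H0 a Ha). specialize (HB b Hb Hb0). lra.
  - assert (Hpos : forall x, Rmin a b <= x <= Rmax a b -> 0 < x).
    { intros x [Hx _]. eapply Rlt_le_trans; [|exact Hx]. apply Rmin_glb_lt; lra. }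
    apply (is_RInt_fct_extend_pair (U := R_NormedModule) (V := R_NormedModule)).
    + apply (is_RInt_derive (V := R_CompleteNormedModule) (fun t => Re (u t))).
      * intros x Hx. apply HR; auto.
      * intros x Hx. apply continuous_C_Re; auto.
    + apply (is_RInt_derive (V := R_CompleteNormedModule) (fun t => Im (u t))).
      * intros x Hx. apply HI; auto.
      * intros x Hx. apply continuous_C_Im; auto.
Qed.

(** The maximum of [x^c exp (- x)] is at [x = c]; it follows from [1 + t <= exp t] at
    [t = ln (x / c)]. *)
Lemma exp_ln_sub_le (c x : R) : 0 < c -> 0 < x -> exp (c * ln x - x) <= exp (c * ln c - c).
Proof.
  intros Hc Hx. apply exp_nondecreasing.
  pose proof (exp_ineq1_le (ln (x / c))) as H.
  rewrite exp_ln in H by now apply Rdiv_lt_0_compat.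
  unfold Rdiv in H. rewrite ln_mult, ln_Rinv in H by (auto using Rinv_0_lt_compat).
  apply Rmult_le_compat_l with (r := c) in H; [|lra].
  replace (c * (x * / c)) with x in H by (field; lra). lra.
Qed.

(* [x^b / (1 + x^b)] increases from 0 to 1 and its derivative dominates
   [x^(b-1) exp (-x)] up to a constant. *)
Lemma halfline_int_dominated (s : R) : -1 < s ->
  exists K, 0 < K /\ forall (f : R -> C) (M : R), 0 <= M -> pos_continuous f ->
    (forall x, 0 < x -> Cmod (f x) <= M * exp (s * ln x - x)) ->
    exists l, halfline_int f l /\ Cmod l <= M * K.
Proof.
  intros Hs. set (b := s + 1). assert (Hb : 0 < b) by (unfold b; lra).
  set (G := fun x => 1 - / (1 + exp (b * ln x))).
  set (g := fun x => b * exp (s * ln x) / (1 + exp (b * ln x)) ^ 2).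
  assert (HG : forall x, 0 < x -> is_derive G x (g x)).
  { intros x Hx. unfold G, g. pose proof (exp_pos (b * ln x)) as Hp.
    auto_derive; [split; [auto|lra]|].
    replace (s * ln x) with (b * ln x + - ln x) by (unfold b; ring).
    rewrite (exp_plus (b * ln x)), exp_Ropp, exp_ln by auto. field. lra. }
  assert (Hgc : forall x, 0 < x -> continuous g x).
  { intros x Hx. apply (ex_derive_continuous (V := R_NormedModule)). unfold g.
    pose proof (exp_pos (b * ln x)) as Hp. auto_derive. repeat split; auto; try nra. }
  (* With [y = x^b], [(1+y)^2 exp (- x) <= 2 + 2 y^2 exp (- x)], and [x^(2b) exp (- x)] is largest
     at [x = 2b]. Dividing by [b] cancels the factor [b] of [g]. *)
  set (K := (2 + 2 * exp (2 * b * ln (2 * b) - 2 * b)) / b).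
  assert (HK : 0 < K).
  { unfold K. apply Rdiv_lt_0_compat; auto. pose proof (exp_pos (2 * b * ln (2 * b) - 2 * b)). lra. }
  assert (Hdom : forall x, 0 < x -> exp (s * ln x - x) <= K * g x).
  { intros x Hx. unfold g, K.
    pose proof (exp_ln_sub_le (2 * b) x ltac:(lra) Hx) as H1.
    set (Q := exp (2 * b * ln (2 * b) - 2 * b)) in *.
    set (y := exp (b * ln x)) in *.
    assert (Hy : 0 < y) by apply exp_pos.
    assert (E2 : exp (2 * b * ln x - x) = y * y * exp (- x)).
    { unfold y. rewrite <- !exp_plus. f_equal. ring. }
    rewrite E2 in H1.
    unfold Rminus at 1. rewrite exp_plus.
    set (w := exp (- x)) in *.
    assert (Hw : 0 < w <= 1).
    { unfold w; split; [apply exp_pos|]. rewrite <- exp_0. apply exp_nondecreasing. lra. }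
    set (v := exp (s * ln x)). assert (Hv : 0 < v) by apply exp_pos.
    replace ((2 + 2 * Q) / b * (b * v / (1 + y) ^ 2)) with (v * ((2 + 2 * Q) / (1 + y) ^ 2))
      by (field; split; lra).
    apply Rmult_le_compat_l; [lra|].
    apply Rmult_le_reg_r with ((1 + y) ^ 2); [apply pow_lt; lra|].
    replace ((2 + 2 * Q) / (1 + y) ^ 2 * (1 + y) ^ 2) with (2 + 2 * Q) by (field; lra).
    assert ((1 + y) ^ 2 <= 2 + 2 * (y * y)) by (pose proof (pow2_ge_0 (1 - y)); lra).
    apply Rle_trans with (w * (2 + 2 * (y * y))); [apply Rmult_le_compat_l; lra|]. lra. }
  assert (HG01 : forall x, 0 <= G x <= 1).
  { intros x. unfold G. pose proof (exp_pos (b * ln x)) as Hp.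
    assert (0 < / (1 + exp (b * ln x))) by (apply Rinv_0_lt_compat; lra).
    assert (/ (1 + exp (b * ln x)) <= 1) by (rewrite <- Rinv_1 at 2; apply Rinv_le_contravar; lra).
    lra. }
  exists K; split; auto. intros f M HM Hf Hfb.
  assert (Hint : forall x y, 0 < x -> x <= y -> Cmod (CInt f x y) <= M * K * (G y - G x)).
  { intros x y Hx Hxy. rewrite Cmod_norm.
    apply (norm_RInt_le (V := C_R_NormedModule) f (fun t => M * K * g t) x y); auto.
    - intros t Ht. rewrite <- Cmod_norm. eapply Rle_trans; [apply Hfb; lra|].
      rewrite Rmult_assoc. apply Rmult_le_compat_l; auto. apply Hdom; lra.
    - apply pos_continuous_is_RInt; auto; lra.
    - apply (is_RInt_scal (V := R_NormedModule)).
      apply (is_RInt_derive (V := R_CompleteNormedModule) G g).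
      + intros t [Ht _]. rewrite Rmin_left in Ht by auto. apply HG; lra.
      + intros t [Ht _]. rewrite Rmin_left in Ht by auto. apply Hgc; lra. }
  assert (Hsw : forall x y, 0 < x -> 0 < y -> Cmod (CInt f x y) <= M * K * Rabs (G y - G x)).
  { intros x y Hx Hy. assert (0 <= M * K) by nra.
    destruct (Rle_lt_dec x y) as [h|h].
    - eapply Rle_trans; [now apply Hint|]. apply Rmult_le_compat_l; auto. apply Rle_abs.
    - replace (CInt f x y) with (- CInt f y x)%C.
      + rewrite Cmod_opp. eapply Rle_trans; [apply Hint; lra|].
        apply Rmult_le_compat_l; auto. rewrite Rabs_minus_sym. apply Rle_abs.
      + apply (opp_RInt_swap (V := C_R_CompleteNormedModule)).
        eexists. apply pos_continuous_is_RInt; auto. }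
  assert (HG0 : forall eps, 0 < eps -> exists d, 0 < d /\ forall x, 0 < x < d -> G x <= eps).
  { intros eps He. exists (exp (ln eps / b)). split; [apply exp_pos|]. intros x [Hx Hxd].
    unfold G. assert (exp (b * ln x) <= eps).
    { rewrite <- (exp_ln eps) by auto. apply exp_nondecreasing.
      apply ln_increasing in Hxd; auto. rewrite ln_exp in Hxd.
      apply Rmult_le_reg_r with (/ b); [now apply Rinv_0_lt_compat|].
      replace (b * ln x * / b) with (ln x) by (field; lra). unfold Rdiv in Hxd. lra. }
    pose proof (exp_pos (b * ln x)) as Hp. set (y := exp (b * ln x)) in *.
    replace (1 - / (1 + y)) with (y / (1 + y)) by (field; lra).
    apply Rmult_le_reg_r with (1 + y); [lra|].
    replace (y / (1 + y) * (1 + y)) with y by (field; lra). nra. }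
  assert (HG1 : forall eps, 0 < eps -> exists B, 0 < B /\ forall x, B < x -> 1 - G x <= eps).
  { intros eps He. exists (exp (- ln eps / b)). split; [apply exp_pos|]. intros x Hxd.
    assert (Hx : 0 < x) by (eapply Rlt_trans; [apply exp_pos|exact Hxd]).
    unfold G. assert (/ eps <= exp (b * ln x)).
    { rewrite <- (exp_ln (/ eps)), ln_Rinv by (auto using Rinv_0_lt_compat).
      apply exp_nondecreasing. apply ln_increasing in Hxd; [|apply exp_pos].
      rewrite ln_exp in Hxd.
      apply Rmult_le_reg_r with (/ b); [now apply Rinv_0_lt_compat|].
      replace (b * ln x * / b) with (ln x) by (field; lra). unfold Rdiv in Hxd. lra. }
    replace (1 - (1 - / (1 + exp (b * ln x)))) with (/ (1 + exp (b * ln x))) by ring.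
    rewrite <- (Rinv_inv eps). apply Rinv_le_contravar; [now apply Rinv_0_lt_compat|lra]. }
  (* Integrals are controlled by increments of [G], which tends to 0 at 0 and to 1 at infinity; the
     Cauchy criterion follows by comparing the end pieces. *)
  assert (Hex : exists l, filterlim (fun ab : R * R => CInt f (fst ab) (snd ab))
    (filter_prod (at_right 0) (Rbar_locally p_infty)) (@locally C_R_CompleteNormedModule l)).
  { apply (filterlim_locally_cauchy (U := C_R_CompleteNormedModule)). intros eps.
    set (e := eps / (3 * (M * K + 1))).
    assert (HMK : 0 <= M * K) by nra.
    assert (He : 0 < e) by (unfold e; apply Rdiv_lt_0_compat; [apply cond_pos|lra]).
    destruct (HG0 e He) as [d [Hd Hd']]. destruct (HG1 e He) as [B [HB HB']].
    exists (fun ab => 0 < fst ab < d /\ B < snd ab). split.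
    - apply (Filter_prod _ _ _ (fun a => 0 < a < d) (fun b => B < b)).
      + exists (mkposreal d Hd). intros y Hy Hy0. split; auto.
        change (Rabs (y - 0) < d) in Hy. rewrite Rminus_0_r, Rabs_pos_eq in Hy; lra.
      + exists B. auto.
      + simpl; auto.
    - intros [a1 b1] [a2 b2]; simpl. intros [Ha1 Hb1] [Ha2 Hb2].
      apply C_NormedModule_mixin_compat1.
      change (Cmod (CInt f a2 b2 - CInt f a1 b1) < eps).
      replace (CInt f a2 b2) with (CInt f a2 a1 + (CInt f a1 b1 + CInt f b1 b2))%C.
      2:{ assert (Ch : forall p q r, 0 < p -> 0 < q -> 0 < r -> (CInt f p q + CInt f q r)%C = CInt f p r).
          { intros p q r Hp Hq Hr. symmetry. apply CInt_is_RInt.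
            apply (is_RInt_Chasles (V := C_R_NormedModule) f p q r); apply pos_continuous_is_RInt; auto. }
          rewrite !Ch; auto; lra. }
      replace (CInt f a2 a1 + (CInt f a1 b1 + CInt f b1 b2) - CInt f a1 b1)%C with
        (CInt f a2 a1 + CInt f b1 b2)%C by ring.
      eapply Rle_lt_trans; [apply Cmod_triangle|].
      pose proof (Hsw a2 a1 ltac:(lra) ltac:(lra)) as S1.
      pose proof (Hsw b1 b2 ltac:(lra) ltac:(lra)) as S2.
      assert (R1 : Rabs (G a1 - G a2) <= e).
      { pose proof (Hd' a1 Ha1). pose proof (Hd' a2 Ha2).
        pose proof (HG01 a1). pose proof (HG01 a2). apply Rabs_le; lra. }
      assert (R2 : Rabs (G b2 - G b1) <= e).
      { pose proof (HB' b1 Hb1). pose proof (HB' b2 Hb2).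
        pose proof (HG01 b1). pose proof (HG01 b2). apply Rabs_le; lra. }
      assert (M * K * Rabs (G a1 - G a2) <= M * K * e) by (apply Rmult_le_compat_l; auto).
      assert (M * K * Rabs (G b2 - G b1) <= M * K * e) by (apply Rmult_le_compat_l; auto).
      assert (e * (3 * (M * K + 1)) = eps) by (unfold e; field; lra).
      nra. }
  destruct Hex as [l Hl]. exists l.
  assert (Hh : halfline_int f l).
  { split; auto. intros eps He. assert (Hp : 0 < eps / 2) by lra.
    destruct (proj1 (filterlim_locally _ _) Hl (mkposreal _ Hp)) as [P Q HP HQ HPQ].
    destruct HP as [d Hd]. destruct HQ as [B HB].
    exists d, B. split; [apply cond_pos|]. intros a b0 Ha Hb0 _.
    assert (Hab := HPQ a b0 (Hd a ltac:(change (Rabs (a - 0) < d); rewrite Rminus_0_r, Rabs_pos_eq; lra) ltac:(lra)) (HB b0 Hb0)).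
    apply (C_NormedModule_mixin_compat2 _ _ (mkposreal _ Hp)) in Hab; simpl in Hab.
    pose proof sqrt2_le_2.
    change (Cmod (CInt f a b0 - l) < sqrt 2 * (eps / 2)) in Hab. nra. }
  split; auto.
  apply le_epsilon; intros eps He.
  destruct (proj2 Hh eps He) as [d [B [Hd HB]]].
  set (a := Rmin (d / 2) 1). set (c := Rmax (B + 1) 2).
  assert (Ha : 0 < a < d /\ a <= 1).
  { unfold a. pose proof (Rmin_l (d / 2) 1). pose proof (Rmin_r (d / 2) 1).
    assert (0 < Rmin (d / 2) 1) by (apply Rmin_glb_lt; lra). lra. }
  assert (Hc : B < c /\ 2 <= c).
  { unfold c. pose proof (Rmax_l (B + 1) 2). pose proof (Rmax_r (B + 1) 2). lra. }
  specialize (HB a c ltac:(lra) ltac:(lra) ltac:(lra)).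
  pose proof (Hint a c ltac:(lra) ltac:(lra)) as I.
  replace l with (- (CInt f a c - l) + CInt f a c)%C by ring.
  eapply Rle_trans; [apply Cmod_triangle|]. rewrite Cmod_opp.
  pose proof (HG01 a). pose proof (HG01 c).
  assert (M * K * (G c - G a) <= M * K * 1) by (apply Rmult_le_compat_l; nra). lra.
Qed.

Lemma pos_continuous_cpow (z : C) (g : R -> R) :
  (forall x, 0 < x -> continuous g x) ->
  pos_continuous (fun x => (cpow x z * RtoC (g x))%C).
Proof.
  intros Hg. apply (pos_continuous_ext (fun x => (RtoC (g x) * cpow x z)%C)); [intros; ring|].
  intros x Hx. apply continuous_RtoC_mult; auto.
  apply continuous_C_pair; apply (ex_derive_continuous (V := R_NormedModule)).
  - eexists. now apply is_derive_Re_cpow.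
  - eexists. now apply is_derive_Im_cpow.
Qed.

Definition gamma_integrand (z : C) (x : R) : C := (cpow x (z - 1) * RtoC (exp (- x)))%C.

Lemma pos_continuous_gamma_integrand (z : C) : pos_continuous (gamma_integrand z).
Proof.
  apply (pos_continuous_cpow (z - 1) (fun x => exp (- x))).
  intros x _. apply (ex_derive_continuous (V := R_NormedModule)). auto_derive; auto.
Qed.

Lemma Cmod_gamma_integrand (z : C) (x : R) :
  Cmod (gamma_integrand z x) = exp ((Re z - 1) * ln x - x).
Proof.
  unfold gamma_integrand. rewrite Cmod_mult, Cmod_cpow, Cmod_R, Rabs_pos_eq by apply Rlt_le, exp_pos.
  rewrite <- exp_plus. f_equal; destruct z; simpl; ring.
Qed.

Lemma halfline_int_gamma (z : C) : 0 < Re z ->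
  halfline_int (gamma_integrand z) (Gamma_int z).
Proof.
  intros Hz. destruct (halfline_int_dominated (Re z - 1) ltac:(lra)) as [K [_ HK]].
  destruct (HK (gamma_integrand z) 1) as [l [Hl _]].
  - lra.
  - apply pos_continuous_gamma_integrand.
  - intros x Hx. rewrite Cmod_gamma_integrand. lra.
  - unfold Gamma_int. change (halfline_int (gamma_integrand z)
      (@RInt_gen C_R_CompleteNormedModule (gamma_integrand z) (at_right 0) (Rbar_locally p_infty))).
    now rewrite (halfline_int_RInt_gen _ _ Hl).
Qed.

Lemma Gamma_int_succ (z : C) : 0 < Re z -> Gamma_int (z + 1)%C = (z * Gamma_int z)%C.
Proof.
  intros Hz.
  assert (Hz1 : 0 < Re (z + 1)%C) by (unfold Re in *; simpl; lra).
  assert (H1 := halfline_int_gamma z Hz). assert (H2 := halfline_int_gamma (z + 1) Hz1).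
  (* [du] is the derivative of [x^z exp (- x)], which vanishes at both ends. *)
  set (du := fun x => (z * gamma_integrand z x + (-1) * gamma_integrand (z + 1) x)%C).
  assert (Hd : halfline_int du (z * Gamma_int z + (-1) * Gamma_int (z + 1))%C).
  { apply halfline_int_plus; now apply halfline_int_scal. }
  assert (H0 : halfline_int du 0).
  { apply (halfline_int_derivative (fun x => (cpow x z * RtoC (exp (- x)))%C)).
    - apply Hd.
    - intros x Hx.
      apply (is_derive_ext (fun t => Re (cpow t z) * exp (- t))).
      { intros t; unfold Re; simpl; ring. }
      evar_last.
      + apply (is_derive_mult (fun t => Re (cpow t z)) (fun t => exp (- t))).
        * now apply is_derive_Re_cpow.
        * auto_derive; [auto|reflexivity].
        * intros; apply Rmult_comm.
      + unfold du, gamma_integrand. replace (z + 1 - 1)%C with z by ring.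
        unfold plus, mult; simpl. unfold Re; simpl. ring.
    - intros x Hx.
      apply (is_derive_ext (fun t => Im (cpow t z) * exp (- t))).
      { intros t; unfold Im; simpl; ring. }
      evar_last.
      + apply (is_derive_mult (fun t => Im (cpow t z)) (fun t => exp (- t))).
        * now apply is_derive_Im_cpow.
        * auto_derive; [auto|reflexivity].
        * intros; apply Rmult_comm.
      + unfold du, gamma_integrand. replace (z + 1 - 1)%C with z by ring.
        unfold plus, mult; simpl. unfold Im; simpl. ring.
    - intros eps He. set (s := Re z) in *.
      assert (E : forall x, Cmod (cpow x z * RtoC (exp (- x))) = exp (s * ln x - x)).
      { intros x. rewrite Cmod_mult, Cmod_cpow, Cmod_R, Rabs_pos_eq by apply Rlt_le, exp_pos.
        rewrite <- exp_plus. f_equal; unfold s; ring. }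
      (* Near 0, [x^s exp (- x) <= x^s <= eps] once [x < eps^(1/s)]. At infinity,
         [x^(s+1) exp (- x) <= Q] gives [x^s exp (- x) <= Q / x]. *)
      set (Q := exp ((s + 1) * ln (s + 1) - (s + 1))).
      assert (HQ : 0 < Q) by apply exp_pos.
      exists (exp (ln eps / s)), (Q / eps). split; [apply exp_pos|]. split.
      + intros x [Hx Hxd]. rewrite E.
        rewrite <- (exp_ln eps) by auto. apply exp_nondecreasing.
        apply ln_increasing in Hxd; auto. rewrite ln_exp in Hxd.
        assert (s * ln x <= ln eps).
        { apply Rmult_le_reg_r with (/ s); [now apply Rinv_0_lt_compat|].
          replace (s * ln x * / s) with (ln x) by (field; lra). unfold Rdiv in Hxd. lra. }
        lra.
      + intros x Hxd Hx. rewrite E.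
        pose proof (exp_ln_sub_le (s + 1) x ltac:(lra) Hx) as HQx. fold Q in HQx.
        replace ((s + 1) * ln x - x) with ((s * ln x - x) + ln x) in HQx by ring.
        rewrite exp_plus, exp_ln in HQx by auto.
        assert (Q < eps * x).
        { apply Rmult_lt_compat_l with (r := eps) in Hxd; auto.
          replace (eps * (Q / eps)) with Q in Hxd by (field; lra). exact Hxd. }
        apply Rmult_le_reg_r with x; auto. lra. }
  pose proof (halfline_int_unique _ _ _ Hd H0) as E.
  replace (z * Gamma_int z)%C with ((z * Gamma_int z + (-1) * Gamma_int (z + 1)) + Gamma_int (z + 1))%C by ring.
  rewrite E. ring.
Qed.

Lemma gamma_integrand_real (r x : R) :
  gamma_integrand (RtoC r) x = RtoC (exp ((r - 1) * ln x - x)).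
Proof.
  unfold gamma_integrand. rewrite <- RtoC_minus, cpow_real, <- RtoC_mult, <- exp_plus.
  do 2 f_equal; ring.
Qed.

Lemma Re_Gamma_pos (r : R) : 0 < r -> 0 < Re (Gamma_int (RtoC r)).
Proof.
  intros Hr.
  set (c := exp (- Rabs (r - 1) * ln 2 - 2)).
  apply Rlt_le_trans with c; [apply exp_pos|].
  apply (halfline_int_Re_ge (gamma_integrand (RtoC r))).
  - now apply halfline_int_gamma.
  - intros x Hx. rewrite gamma_integrand_real. simpl. apply Rlt_le, exp_pos.
  - intros x Hx. rewrite gamma_integrand_real. simpl. apply exp_nondecreasing.
    assert (0 <= ln x <= ln 2).
    { split; [rewrite <- ln_1|]; apply Rcomplements.ln_le; lra. }
    assert (- Rabs (r - 1) <= r - 1).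
    { pose proof (Rle_abs (- (r - 1))). rewrite Rabs_Ropp in H0. lra. }
    pose proof (Rabs_pos (r - 1)). nra.
Qed.

(** [ln u <= u - 1] serves for [u >= 1] and [- ln u <= 1/u - 1] for [u < 1]. The logarithm is traded
    for powers of [u], whose integrals against the Gamma density follow from the functional
    equation. *)
Lemma ln_sqr_le (u : R) : 0 < u -> ln u * ln u <= (u - 1) ^ 2 + (/ u - 1) ^ 2.
Proof.
  intros Hu.
  pose proof (exp_ineq1_le (ln u)) as H1. rewrite exp_ln in H1 by auto.
  pose proof (exp_ineq1_le (- ln u)) as H2. rewrite exp_Ropp, exp_ln in H2 by auto.
  pose proof (pow2_ge_0 (u - 1)). pose proof (pow2_ge_0 (/ u - 1)).
  destruct (Rle_lt_dec 0 (ln u)); nra.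
Qed.

(* For large [a] the measure [x^(a-1) exp (-x) dx] concentrates around [x = a],
   where [x^(i t)] is almost constant: the second moments of [x/a - 1] and
   [a/x - 1] are of order [1/a]. *)
Lemma Gamma_neq_0_large (z : C) : (Im z) ^ 2 + 4 <= Re z -> Gamma_int z <> 0.
Proof.
  intros Hz HG0. set (a := Re z) in *. set (t := Im z) in *.
  assert (Ht : 0 <= t ^ 2) by apply pow2_ge_0.
  (* The constant [c] turns [x^(i t)] into [(x/a)^(i t)], which is 1 at the point of concentration
     [x = a]. *)
  set (A := RtoC a). set (c := cpow a (- (Ci * RtoC t))).
  set (g := fun j : R => gamma_integrand (RtoC (a + j))).
  set (k := t ^ 2 / 2).
  (* With [u = x/a], the real part of [h] is [x^(a-1) exp (- x)] times [cos (t ln u) - 1 + k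
     ((u-1)^2 + (1/u-1)^2)], nonnegative by the quadratic bound on the cosine. If [Gamma_int z = 0],
     integration forces [Gamma(a)] below [k] times the second moments. *)
  set (h := fun x => (c * gamma_integrand z x + (RtoC (-1) * g 0 x +
    (RtoC (k / a ^ 2) * g 2 x + (RtoC (- (2 * k) / a) * g 1 x + (RtoC (2 * k) * g 0 x
     + (RtoC (k * a ^ 2) * g (-2) x + RtoC (- (2 * k * a)) * g (-1) x))))))%C).
  set (Gm := fun j : R => Gamma_int (RtoC (a + j))).
  assert (Hg : forall j, -3 < j -> halfline_int (g j) (Gm j)).
  { intros j Hj. apply halfline_int_gamma. simpl. lra. }
  assert (Hh : halfline_int h (c * Gamma_int z + (RtoC (-1) * Gm 0 +
    (RtoC (k / a ^ 2) * Gm 2 + (RtoC (- (2 * k) / a) * Gm 1 + (RtoC (2 * k) * Gm 0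
     + (RtoC (k * a ^ 2) * Gm (-2) + RtoC (- (2 * k * a)) * Gm (-1)))))))%C).
  { unfold h. apply halfline_int_plus.
    - apply halfline_int_scal, halfline_int_gamma. unfold a in Hz. lra.
    - do 5 (apply halfline_int_plus; [apply halfline_int_scal, Hg; lra|]).
      apply halfline_int_scal, Hg; lra. }
  assert (Hpos : forall x, 0 < x -> 0 <= Re (h x)).
  { intros x Hx.
    set (w := exp ((a - 1) * ln x - x)). assert (Hw : 0 < w) by apply exp_pos.
    assert (Egz : Re (c * gamma_integrand z x) = w * cos (t * ln (x / a))).
    { unfold c, gamma_integrand.
      replace z with (RtoC a + Ci * RtoC t)%C
        by (apply injective_projections; simpl; unfold a, t, Re, Im; ring).
      unfold cpow, cexp, w. simpl.
      unfold Rminus.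
      match goal with |- context [exp ?u * cos ?v * (exp ?p * cos ?q * _ + _)] =>
        replace u with 0 by ring; replace v with (- (t * ln a)) by ring;
        replace p with ((a + - (1)) * ln x) by ring; replace q with (t * ln x) by ring end.
      rewrite (exp_plus _ (- x)), Rcomplements.ln_div by lra.
      replace (t * (ln x - ln a)) with (t * ln x + - (t * ln a)) by ring.
      rewrite (cos_plus (t * ln x)), !cos_neg, !sin_neg, exp_0. ring. }
    assert (Eg : forall j, Re (g j x) = w * exp (j * ln x)).
    { intros j. unfold g. rewrite gamma_integrand_real. simpl. unfold w. rewrite <- exp_plus. f_equal. ring. }
    assert (ER : forall (r : R) (u : C), Re (RtoC r * u) = r * Re u) by (intros; unfold Re; simpl; ring).
    assert (EP : forall u v : C, Re (u + v) = Re u + Re v) by (intros; reflexivity).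
    unfold h. rewrite !EP, !ER, Egz, !Eg.
    replace (exp (0 * ln x)) with 1 by (rewrite Rmult_0_l, exp_0; auto).
    replace (exp (1 * ln x)) with x by (rewrite Rmult_1_l, exp_ln; auto).
    replace (exp (2 * ln x)) with (x * x)
      by (replace (2 * ln x) with (ln x + ln x) by ring; rewrite exp_plus, exp_ln; auto).
    replace (exp (-1 * ln x)) with (/ x)
      by (replace (-1 * ln x) with (- ln x) by ring; rewrite exp_Ropp, exp_ln; auto).
    replace (exp (-2 * ln x)) with (/ x * / x)
      by (replace (-2 * ln x) with (- ln x + - ln x) by ring; rewrite exp_plus, exp_Ropp, exp_ln; auto).
    pose proof (cos_ge_quadratic (t * ln (x / a))) as C1.
    assert (Hu : 0 < x / a) by (apply Rdiv_lt_0_compat; lra).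
    pose proof (ln_sqr_le (x / a) Hu) as L1.
    match goal with |- 0 <= ?X => replace X with
      (w * (cos (t * ln (x / a)) - 1 + k * ((x / a - 1) ^ 2 + (/ (x / a) - 1) ^ 2))) by (field; split; lra) end.
    apply Rmult_le_pos; [lra|].
    assert (k * (ln (x / a) * ln (x / a)) <= k * ((x / a - 1) ^ 2 + (/ (x / a) - 1) ^ 2))
      by (apply Rmult_le_compat_l; auto; unfold k; lra).
    unfold k in *. nra. }
  assert (Hre := halfline_int_Re_ge h _ 0 Hh Hpos (fun x Hx => Hpos x ltac:(lra))).
  assert (HS : forall j, -3 < j -> Gm (j + 1) = (RtoC (a + j) * Gm j)%C).
  { intros j Hj. unfold Gm. rewrite <- Gamma_int_succ by (simpl; lra).
    f_equal. rewrite <- RtoC_plus. f_equal. ring. }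
  pose proof (HS (-2) ltac:(lra)) as E1. pose proof (HS (-1) ltac:(lra)) as E2.
  pose proof (HS 0 ltac:(lra)) as E3. pose proof (HS 1 ltac:(lra)) as E4.
  replace (-2 + 1) with (-1) in E1 by ring. replace (-1 + 1) with 0 in E2 by ring.
  replace (0 + 1) with 1 in E3 by ring. replace (1 + 1) with 2 in E4 by ring.
  rewrite E4, E3, E2, E1, HG0 in Hre.
  assert (Hg0 : 0 < Re (Gm (-2))) by (unfold Gm; apply Re_Gamma_pos; lra).
  set (G0 := Gm (-2)) in *.
  (* In units of [Gamma(a-2)], the moments are [(a-1)(a-2)/a] and [a+2], of sum [2a - 1 + 2/a],
     while [Gamma(a)] is [(a-1)(a-2)]. As [k = t^2/2] and [t^2 <= a - 4], the moments are too
     small. *)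
  assert (Hfin : 0 <= - ((a - 1) * (a - 2) - k * (2 * a - 1 + 2 / a)) * Re G0).
  { eapply Rle_trans; [exact Hre|]. apply Req_le.
    destruct G0 as [g1 g2]; simpl. field. lra. }
  assert (Ha2 : 2 / a <= 1).
  { apply Rmult_le_reg_r with a; [lra|]. unfold Rdiv. rewrite Rmult_assoc, Rinv_l; lra. }
  assert (k * (2 * a - 1 + 2 / a) <= k * (2 * a)) by (apply Rmult_le_compat_l; unfold k; lra).
  assert (t ^ 2 * a <= (a - 4) * a) by (apply Rmult_le_compat_r; lra).
  assert (0 < (a - 1) * (a - 2) - k * (2 * a - 1 + 2 / a)) by (unfold k in *; nra).
  nra.
Qed.

(** By the functional equation a zero at [z] recurs at every [z + n]; the imaginary part stays
    fixed, so the case of large real part is reached. *)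
Lemma Gamma_neq_0 (z : C) : 0 < Re z -> Gamma_int z <> 0.
Proof.
  intros Hz H0.
  assert (Hn : forall n : nat, Gamma_int (z + RtoC (INR n))%C = 0).
  { induction n as [|n IH].
    - replace (z + RtoC (INR 0))%C with z by (simpl; ring). exact H0.
    - rewrite S_INR, RtoC_plus, Cplus_assoc, Gamma_int_succ, IH; [ring|].
      pose proof (pos_INR n). unfold Re in *; simpl; lra. }
  destruct (exists_nat_ge ((Im z) ^ 2 + 4)) as [n Hge].
  apply (Gamma_neq_0_large (z + RtoC (INR n))); [|apply Hn].
  replace (Im (z + RtoC (INR n))) with (Im z) by (unfold Im; simpl; ring).
  unfold Re in *; simpl; lra.
Qed.

(** * Integral form of the coefficients *)

Lemma halfline_int_cpow_exp (s0 : C) (c : R) : -1 < Re s0 -> 0 < c ->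
  halfline_int (fun x => (cpow x s0 * RtoC (exp (- (x * c))))%C)
    (cpow c (- (s0 + 1)) * Gamma_int (s0 + 1))%C.
Proof.
  intros Hs Hc.
  assert (Hz : 0 < Re (s0 + 1)%C) by (unfold Re in *; simpl; lra).
  pose proof (halfline_int_scal (cpow c (- (s0 + 1))) _ _
    (halfline_int_rescale c _ _ Hc (halfline_int_gamma (s0 + 1) Hz))) as H.
  refine (halfline_int_ext _ _ _ _ H). intros x Hx. cbv beta.
  unfold gamma_integrand. replace (s0 + 1 - 1)%C with s0 by ring.
  rewrite cpow_mult, (Rmult_comm x c) by auto.
  assert (E : (cpow c (- (s0 + 1)) * (RtoC c * cpow c s0))%C = 1).
  { rewrite <- (cpow_1_r c) by auto. rewrite <- !cpow_plus.
    replace (- (s0 + 1) + (1 + s0))%C with (RtoC 0) by ring.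
    rewrite cpow_real, Rmult_0_l, exp_0. easy. }
  transitivity ((cpow c (- (s0 + 1)) * (RtoC c * cpow c s0)) * (cpow x s0 * RtoC (exp (- (c * x)))))%C.
  - ring.
  - rewrite E. ring.
Qed.

(** Passing from [m] to [S m] multiplies the integrand by [exp (- x)], so each difference
    contributes a factor [1 - exp (- x)]. *)
Lemma halfline_int_adiff (s0 : C) (p m : nat) : -1 < Re s0 ->
  halfline_int
    (fun x => (cpow x s0 * RtoC (exp (- (x * INR (m + 1))) * (1 - exp (- x)) ^ p))%C)
    (adiff p m (npow (s0 + 1)) * Gamma_int (s0 + 1))%C.
Proof.
  intros Hs. revert m; induction p as [|p IH]; intros m.
  - apply (halfline_int_ext (fun x => (cpow x s0 * RtoC (exp (- (x * INR (m + 1)))))%C)).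
    { intros x Hx. simpl pow. now rewrite Rmult_1_r. }
    apply halfline_int_cpow_exp; auto. apply lt_0_INR; lia.
  - cbn [adiff].
    replace ((adiff p m (npow (s0 + 1)) - adiff p (S m) (npow (s0 + 1))) * Gamma_int (s0 + 1))%C with
      (adiff p m (npow (s0 + 1)) * Gamma_int (s0 + 1) +
       (-1) * (adiff p (S m) (npow (s0 + 1)) * Gamma_int (s0 + 1)))%C by ring.
    refine (halfline_int_ext _ _ _ _ (halfline_int_plus _ _ _ _ (IH m) (halfline_int_scal (-1) _ _ (IH (S m))))).
    intros x Hx. cbv beta.
    change (S m + 1)%nat with (S (m + 1)). rewrite S_INR.
    replace (- (x * (INR (m + 1) + 1))) with (- (x * INR (m + 1)) + - x) by ring.
    rewrite exp_plus. set (e := exp (- x)). set (q := (1 - e) ^ p).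
    change ((1 - e) ^ S p) with ((1 - e) * q).
    rewrite !RtoC_mult, !RtoC_minus. ring.
Qed.

(** Since [(k+1) C(k,m) = (m+1) C(k+1,m+1)], these are the terms of a negative binomial series in
    [q/2] with sum [(m+1) / (2-q)^(m+2)]. At [q = 1 - exp (- x)] the denominator is that of the
    integrand in the theorem. *)
Definition coef_weight (m : nat) (q : R) (k : nat) : R :=
  INR (k + 1) * INR (binom k m) * (1 / 2) ^ (k + 2) * q ^ (k - m).

Lemma is_series_coef_weight (m : nat) (q : R) : 0 <= q <= 1 ->
  is_series (coef_weight m q) (INR (m + 1) / (2 - q) ^ (m + 2)).
Proof.
  intros Hq. apply (is_series_shift _ m).
  { intros k Hk. unfold coef_weight. rewrite binom_gt by auto. simpl; ring. }
  evar_last.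
  - apply (is_series_ext (fun p => scal (INR (m + 1) * (1 / 2) ^ (m + 2))
      (INR (binom (S m + p) (S m)) * (q / 2) ^ p))).
    + intros p.
      change (INR (m + 1) * (1 / 2) ^ (m + 2) * (INR (binom (S m + p) (S m)) * (q / 2) ^ p)
        = coef_weight m q (m + p)).
      unfold coef_weight.
      replace (m + p - m)%nat with p by lia.
      pose proof (f_equal INR (binom_absorb (m + p) m)) as H. rewrite !mult_INR in H.
      rewrite !Nat.add_1_r. change (S m + p)%nat with (S (m + p)).
      transitivity (INR (S m) * INR (binom (S (m + p)) (S m)) * ((1 / 2) ^ (m + 2) * (q / 2) ^ p)).
      * ring.
      * rewrite H. replace (m + p + 2)%nat with ((m + 2) + p)%nat by lia.
        rewrite (pow_add _ (m + 2)). unfold Rdiv at 2. rewrite Rpow_mult_distr.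
        replace (/ 2) with (1 / 2) by field. ring.
    + apply (is_series_scal (V := R_NormedModule)). apply (is_series_neg_binomial (S m)). lra.
  - change (INR (m + 1) * (1 / 2) ^ (m + 2) * / (1 - q / 2) ^ (S m + 1)
      = INR (m + 1) / (2 - q) ^ (m + 2)).
    replace (S m + 1)%nat with (m + 2)%nat by lia.
    replace (2 - q) with (2 * (1 - q / 2)) by field. rewrite Rpow_mult_distr.
    replace ((1 / 2) ^ (m + 2)) with (/ 2 ^ (m + 2)) by (rewrite <- pow_inv; f_equal; field).
    assert ((1 - q / 2) ^ (m + 2) <> 0) by (apply pow_nonzero; lra).
    assert (2 ^ (m + 2) <> 0) by (apply pow_nonzero; lra).
    field. auto.
Qed.

Lemma sum_n_csum (f : nat -> R) (n : nat) : csum (fun i => RtoC (f i)) n = RtoC (sum_n f n).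
Proof. now rewrite csum_RtoC, sum_n_Reals. Qed.

Lemma halfline_int_csum (f : nat -> R -> C) (l : nat -> C) (n : nat) :
  (forall k, halfline_int (f k) (l k)) ->
  halfline_int (fun x => csum (fun k => f k x) n) (csum l n).
Proof.
  intros H; induction n as [|n IH]; simpl; [apply H|]. now apply halfline_int_plus.
Qed.

Definition int_coef_integrand (m : nat) (s0 : C) (x : R) : C :=
  (cpow x s0 * RtoC (exp (- x * INR (m + 1)) / (1 + exp (- x)) ^ (m + 2)))%C.

Definition euler_coef (s0 : C) (m k : nat) : C :=
  (RtoC (INR (binom k m)) * adiff (k - m) m (npow s0))%C.

(** Termwise integration without a dominated convergence theorem: the weights are nonnegative and
    nondecreasing in [q], so for every [x] the remainder is at most the one at [q = 1]. Its integral
    is then at most that tail times the constant [K] of the dominating integral. *)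
Lemma int_coef_series (m : nat) (s0 : C) : -1 < Re s0 ->
  exists I, halfline_int (int_coef_integrand m s0) I /\
  cseries (fun k => (RtoC (INR (k + 1) * (1 / 2) ^ (k + 2)) *
     (euler_coef (s0 + 1) m k * Gamma_int (s0 + 1)))%C) (RtoC (INR (m + 1)) * I)%C.
Proof.
  intros Hs.
  destruct (halfline_int_dominated (Re s0) Hs) as [K [HK Hdom]].
  assert (Hcont : forall (g : R -> R), (forall x, 0 < x -> ex_derive g x) ->
    pos_continuous (fun x => (cpow x s0 * RtoC (g x))%C)).
  { intros g Hg. apply pos_continuous_cpow. intros x Hx.
    apply (ex_derive_continuous (V := R_NormedModule)). auto. }
  assert (Hy : forall x, 0 < x -> 0 < exp (- x) <= 1).
  { intros x Hx; split; [apply exp_pos|]. rewrite <- exp_0. apply exp_nondecreasing. lra. }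
  assert (Hbnd : forall x, 0 < x -> exp (Re s0 * ln x) * exp (- (x * INR (m + 1))) <= exp (Re s0 * ln x - x)).
  { intros x Hx. unfold Rminus. rewrite exp_plus. apply Rmult_le_compat_l; [apply Rlt_le, exp_pos|].
    apply exp_nondecreasing. rewrite plus_INR. simpl. pose proof (pos_INR m). nra. }
  assert (HcI : pos_continuous (int_coef_integrand m s0)).
  { apply (Hcont (fun x => exp (- x * INR (m + 1)) / (1 + exp (- x)) ^ (m + 2))).
    intros x Hx. auto_derive. apply pow_nonzero. pose proof (exp_pos (- x)). lra. }
  destruct (Hdom (int_coef_integrand m s0) 1 ltac:(lra) HcI) as [I [HI _]].
  { intros x Hx. unfold int_coef_integrand. rewrite Cmod_mult, Cmod_cpow, Cmod_R, Rmult_1_l.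
    pose proof (Hy x Hx). assert (1 <= (1 + exp (- x)) ^ (m + 2)) by (apply pow_R1_Rle; lra).
    assert (0 < exp (- x * INR (m + 1)) / (1 + exp (- x)) ^ (m + 2))
      by (apply Rdiv_lt_0_compat; [apply exp_pos|lra]).
    rewrite Rabs_pos_eq by lra. eapply Rle_trans; [|apply (Hbnd x Hx)].
    apply Rmult_le_compat_l; [apply Rlt_le, exp_pos|].
    replace (- (x * INR (m + 1))) with (- x * INR (m + 1)) by ring.
    unfold Rdiv. rewrite <- (Rmult_1_r (exp (- x * INR (m + 1)))) at 2.
    apply Rmult_le_compat_l; [apply Rlt_le, exp_pos|].
    apply Rle_trans with (/ 1); [apply Rinv_le_contravar; lra|rewrite Rinv_1; lra]. }
  exists I; split; auto.
  set (f := fun k x => (RtoC (INR (k + 1) * (1 / 2) ^ (k + 2)) * (RtoC (INR (binom k m)) *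
    (cpow x s0 * RtoC (exp (- (x * INR (m + 1))) * (1 - exp (- x)) ^ (k - m)))))%C).
  set (l := fun k => (RtoC (INR (k + 1) * (1 / 2) ^ (k + 2)) *
     (euler_coef (s0 + 1) m k * Gamma_int (s0 + 1)))%C).
  assert (Hl : forall k, halfline_int (f k) (l k)).
  { intros k. unfold f, l, euler_coef. apply halfline_int_scal.
    rewrite <- Cmult_assoc. apply halfline_int_scal. now apply halfline_int_adiff. }
  assert (HS1 := is_series_coef_weight m 1 ltac:(lra)).
  set (S1 := INR (m + 1) / (2 - 1) ^ (m + 2)) in *.
  apply is_lim_seq_le_le with (u := fun _ => 0) (w := fun n => (S1 - sum_n (coef_weight m 1) n) * K).
  - intros n; split; [apply Cmod_ge_0|].
    assert (Htail : forall q, 0 <= q <= 1 ->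
      Rabs (INR (m + 1) / (2 - q) ^ (m + 2) - sum_n (coef_weight m q) n) <= S1 - sum_n (coef_weight m 1) n).
    { intros q Hq. rewrite <- Cmod_R, RtoC_minus, <- sum_n_csum.
      apply (cseries_tail_le _ (coef_weight m 1) _ S1).
      - intros k. rewrite Cmod_R. unfold coef_weight. rewrite pow1, Rmult_1_r.
        assert (H1 : 0 <= INR (k + 1) * INR (binom k m) * (1 / 2) ^ (k + 2)).
        { apply Rmult_le_pos; [apply Rmult_le_pos; apply pos_INR|apply pow_le; lra]. }
        assert (H2 : 0 <= q ^ (k - m) <= 1).
        { split; [apply pow_le; lra|]. rewrite <- (pow1 (k - m)). apply pow_incr; lra. }
        rewrite Rabs_pos_eq by (apply Rmult_le_pos; lra).
        rewrite <- (Rmult_1_r (INR (k + 1) * INR (binom k m) * (1 / 2) ^ (k + 2))) at 2.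
        apply Rmult_le_compat_l; lra.
      - exact HS1.
      - apply cseries_RtoC. now apply is_series_coef_weight. }
    assert (HM : 0 <= S1 - sum_n (coef_weight m 1) n).
    { eapply Rle_trans; [apply Rabs_pos|apply (Htail 0); lra]. }
    set (r := fun x => (RtoC (INR (m + 1)) * int_coef_integrand m s0 x + (-1) * csum (fun k => f k x) n)%C).
    assert (Hr : halfline_int r (RtoC (INR (m + 1)) * I + (-1) * csum l n)%C).
    { apply halfline_int_plus; apply halfline_int_scal; auto. now apply halfline_int_csum. }
    destruct (Hdom r (S1 - sum_n (coef_weight m 1) n) HM (proj1 Hr)) as [l' [Hl' Hb]].
    + intros x Hx. set (y := exp (- x)). pose proof (Hy x Hx) as Hyx. fold y in Hyx.
      assert (E : r x = (cpow x s0 * RtoC (exp (- (x * INR (m + 1))) *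
        (INR (m + 1) / (2 - (1 - y)) ^ (m + 2) - sum_n (coef_weight m (1 - y)) n)))%C).
      { unfold r, f, int_coef_integrand. fold y.
        rewrite (csum_ext _ (fun k => (cpow x s0 * RtoC (exp (- (x * INR (m + 1)))) *
          RtoC (coef_weight m (1 - y) k))%C)).
        - rewrite csum_scal, sum_n_csum.
          replace (2 - (1 - y)) with (1 + y) by ring.
          replace (- x * INR (m + 1)) with (- (x * INR (m + 1))) by ring.
          unfold Rdiv. rewrite !RtoC_mult, RtoC_minus, !RtoC_mult. ring.
        - intros k _. unfold coef_weight. rewrite !RtoC_mult. ring. }
      rewrite E, Cmod_mult, Cmod_cpow, Cmod_R, Rabs_mult.
      rewrite (Rabs_pos_eq (exp _)) by apply Rlt_le, exp_pos.
      specialize (Htail (1 - y) ltac:(lra)).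
      rewrite <- Rmult_assoc, Rmult_comm.
      apply Rmult_le_compat; auto using Rabs_pos.
      apply Rmult_le_pos; apply Rlt_le, exp_pos.
    + rewrite <- (halfline_int_unique _ _ _ Hr Hl') in Hb.
      replace (csum l n - RtoC (INR (m + 1)) * I)%C with
        (- (RtoC (INR (m + 1)) * I + (-1) * csum l n))%C by ring.
      now rewrite Cmod_opp.
  - apply is_lim_seq_const.
  - replace (Finite 0) with (Rbar_mult 0 K) by (simpl; f_equal; ring).
    apply is_lim_seq_scal_r. now apply tail_lim.
Qed.

Lemma npow_mult_succ (s0 : C) (n : nat) :
  npow s0 n = (RtoC (INR (n + 1)) * npow (s0 + 1) n)%C.
Proof.
  replace s0 with ((s0 + 1) - RtoC (INR 1))%C at 1 by (simpl; ring).
  rewrite npow_sub_nat, pow_1. easy.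
Qed.

Lemma euler_coef_0 (s0 : C) (m : nat) :
  euler_coef s0 m 0 = euler_coef (s0 + 1) m 0.
Proof.
  unfold euler_coef. destruct m as [|m]; simpl; [|ring].
  rewrite (npow_mult_succ s0 0). simpl. ring.
Qed.

(** With [u_k = (k+1) euler_coef (s0+1) m k], the coefficient at [s0] is the increment
    [u_(k+1) - u_k]. *)
Lemma euler_coef_S (s0 : C) (m k : nat) :
  euler_coef s0 m (S k) =
  (RtoC (INR (k + 2)) * euler_coef (s0 + 1) m (S k) - RtoC (INR (k + 1)) * euler_coef (s0 + 1) m k)%C.
Proof.
  unfold euler_coef.
  rewrite (adiff_ext _ _ _ _ (npow_mult_succ s0)).
  destruct (Nat.lt_trichotomy (S k) m) as [H|[H|H]].
  - rewrite !binom_gt by lia. simpl; ring.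
  - rewrite <- H, Nat.sub_diag, (binom_gt k (S k)) by lia. cbn [adiff].
    replace (S k + 1)%nat with (k + 2)%nat by lia. simpl (INR 0). ring.
  - replace (S k - m)%nat with (S (k - m)) by lia.
    rewrite adiff_mult_succ.
    replace (m + S (k - m) + 1)%nat with (k + 2)%nat by lia.
    assert (E : INR (binom (S k) m) * INR (S (k - m)) = INR (k + 1) * INR (binom k m)).
    { pose proof (binom_mult_sub (S k) m) as H1.
      pose proof (f_equal INR (binom_absorb k m)) as H2. rewrite !mult_INR in H2.
      rewrite H2 in H1. replace (k + 1)%nat with (S k) by lia. rewrite H1.
      replace (INR (S (k - m))) with (INR (S k) - INR m).
      - ring.
      - rewrite <- minus_INR by lia. f_equal. lia. }
    transitivity (RtoC (INR (k + 2)) * (RtoC (INR (binom (S k) m)) * adiff (S (k - m)) m (npow (s0 + 1)))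
      - RtoC (INR (binom (S k) m) * INR (S (k - m))) * adiff (k - m) m (npow (s0 + 1)))%C.
    + rewrite RtoC_mult. ring.
    + rewrite E, RtoC_mult. ring.
Qed.

(** Summation by parts: summing [2^-(k+1)] against increments of [u_k] leaves
    [2^-(k+1) - 2^-(k+2) = 2^-(k+2)] in front of each [u_k], and the last term [c n] is the boundary
    term. *)
Lemma csum_euler_coef (s0 : C) (m n : nat) :
  let c k := (RtoC (INR (k + 1) * (1 / 2) ^ (k + 2)) * euler_coef (s0 + 1) m k)%C in
  csum (fun k => (RtoC ((1 / 2) ^ (k + 1)) * euler_coef s0 m k)%C) n = (csum c n + c n)%C.
Proof.
  intros c. induction n as [|n IH].
  - simpl csum. unfold c. rewrite euler_coef_0.
    apply injective_projections; simpl; field.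
  - change (csum (fun k => (RtoC ((1 / 2) ^ (k + 1)) * euler_coef s0 m k)%C) n +
      RtoC ((1 / 2) ^ (S n + 1)) * euler_coef s0 m (S n) = csum c n + c (S n) + c (S n))%C.
    rewrite IH, euler_coef_S. unfold c at 2 4 5.
    replace (S n + 1)%nat with (n + 2)%nat by lia.
    replace (S n + 2)%nat with (S (n + 2)) by lia.
    change ((1 / 2) ^ S (n + 2)) with (1 / 2 * (1 / 2) ^ (n + 2)).
    generalize (euler_coef (s0 + 1) m (S n)), (euler_coef (s0 + 1) m n). intros u v.
    rewrite !RtoC_mult.
    replace (RtoC (INR (n + 2)) * (RtoC (1 / 2) * RtoC ((1 / 2) ^ (n + 2))) * u)%C with
      (RtoC (1 / 2) * (RtoC (INR (n + 2)) * RtoC ((1 / 2) ^ (n + 2)) * u))%C by ring.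
    set (W := (RtoC (INR (n + 2)) * RtoC ((1 / 2) ^ (n + 2)) * u)%C).
    replace (csum c n + RtoC (1 / 2) * W + RtoC (1 / 2) * W)%C with (csum c n + W)%C.
    + unfold W. ring.
    + apply injective_projections; simpl; field.
Qed.

Lemma stirling_coef_integral (eta : C -> C) (m : nat) (s0 : C) :
  is_dirichlet_eta eta -> -1 < Re s0 ->
  exists I, halfline_int (int_coef_integrand m s0) I /\
  (RtoC (INR (m + 1)) * I)%C = (stirling_coef eta m s0 * Gamma_int (s0 + 1))%C.
Proof.
  intros Heta Hs. destruct (int_coef_series m s0 Hs) as [I [HI HS]].
  exists I; split; auto.
  set (G := Gamma_int (s0 + 1)) in *. set (L := (RtoC (INR (m + 1)) * I)%C) in *.
  set (c := fun k => (RtoC (INR (k + 1) * (1 / 2) ^ (k + 2)) * euler_coef (s0 + 1) m k)%C).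
  assert (Hc : cseries (fun k => (G * c k)%C) L).
  { refine (cseries_ext _ _ _ _ HS). intros k. unfold c. ring. }
  pose proof (cseries_scal G _ _ (stirling_coef_series eta m s0 Heta)) as Hb.
  rewrite Cmult_comm.
  refine (cseries_unique _ _ _ _ Hb).
  (* The boundary term is the difference of two consecutive partial sums. With [S_n] those of
     [G * c], the quantity to bound is [2 (S_(n+1) - L) - (S_n - L)], which requires an index at
     least 1. *)
  unfold cseries. apply is_lim_seq_incr_1.
  apply is_lim_seq_le_le with (u := fun _ => 0)
    (w := fun n => Cmod (csum (fun k => (G * c k)%C) (S n) - L) + Cmod (csum (fun k => (G * c k)%C) (S n) - L)
      + Cmod (csum (fun k => (G * c k)%C) n - L)).
  - intros n; split; [apply Cmod_ge_0|].
    rewrite !csum_scal.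
    change (fun k => (RtoC ((1 / 2) ^ (k + 1)) * (RtoC (INR (binom k m)) * adiff (k - m) m (npow s0)))%C)
      with (fun k => (RtoC ((1 / 2) ^ (k + 1)) * euler_coef s0 m k)%C).
    assert (EA : csum (fun k => (RtoC ((1 / 2) ^ (k + 1)) * euler_coef s0 m k)%C) (S n) =
      (csum c (S n) + c (S n))%C) by exact (csum_euler_coef s0 m (S n)).
    rewrite EA.
    replace (G * (csum c (S n) + c (S n)) - L)%C with
      ((G * csum c (S n) - L) + (G * csum c (S n) - L) + - (G * csum c n - L))%C by (simpl; ring).
    rewrite <- (Cmod_opp (G * csum c n - L)).
    eapply Rle_trans; [apply Cmod_triangle|]. apply Rplus_le_compat_r, Cmod_triangle.
  - apply is_lim_seq_const.
  - replace (Finite 0) with (Finite (0 + 0 + 0)) by (f_equal; ring).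
    assert (Hc1 := proj1 (is_lim_seq_incr_1 _ _) Hc).
    apply is_lim_seq_plus'; [apply is_lim_seq_plus'|]; assumption.
Qed.

Theorem theorem3 (eta : C -> C) (Heta : is_dirichlet_eta eta) :
  (forall s s0 : C, -1 < Re s0 ->
     @is_series C_AbsRing C_NormedModule
       (fun m : nat =>
          Cmult (Cmult (Cinv (Gamma_int (Cplus s0 1))) (RtoC (INR (m + 1))))
            (Cmult
               (@RInt_gen C_R_CompleteNormedModule
                  (fun x : R =>
                     Cmult (cpow x s0)
                       (RtoC (exp (- x * INR (m + 1)) / (1 + exp (- x)) ^ (m + 2))))
                  (at_right 0) (Rbar_locally p_infty))
               (alt_binom_sum m s)))
       (eta (Cplus s s0))) /\
  (forall s s0 : C,
     @is_series C_AbsRing C_NormedModule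
       (fun m : nat =>
          Cmult (RtoC ((-1) ^ m / INR (fact m)))
            (Cmult
               (csum (fun i : nat =>
                  let l := (i + 1)%nat in
                  Cmult (RtoC (IZR (stirling1 (m + 1) l)))
                        (eta (Cminus (Cplus s0 1) (RtoC (INR l))))) m)
               (alt_binom_sum m s)))
       (eta (Cplus s s0))).
Proof.
  split.
  - intros s s0 Hs. apply cseries_is_series.
    (* Both formulas are the same series; here its coefficient is rewritten as an integral divided
       by a nonzero Gamma value. *)
    apply (cseries_ext (fun m => (stirling_coef eta m s0 * alt_binom_sum m s)%C));
      [|now apply eta_stirling_series].
    intros m. destruct (stirling_coef_integral eta m s0 Heta Hs) as [I [HI E]].
    change (fun x : R => (cpow x s0 * RtoC (exp (- x * INR (m + 1)) / (1 + exp (- x)) ^ (m + 2)))%C)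
      with (int_coef_integrand m s0).
    rewrite (halfline_int_RInt_gen _ _ HI).
    assert (HG : Gamma_int (s0 + 1) <> 0).
    { apply Gamma_neq_0. unfold Re in *; simpl; lra. }
    replace (/ Gamma_int (s0 + 1) * RtoC (INR (m + 1)) * (I * alt_binom_sum m s))%C with
      (/ Gamma_int (s0 + 1) * (RtoC (INR (m + 1)) * I) * alt_binom_sum m s)%C by ring.
    rewrite E. field. exact HG.
  - intros s s0. apply cseries_is_series.
    apply (cseries_ext (fun m => (stirling_coef eta m s0 * alt_binom_sum m s)%C));
      [|now apply eta_stirling_series].
    intros m. unfold stirling_coef. ring.
Qed.
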